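(* Let $A{_\tau\times_\sigma}B$ be a smash biproduct bialgebra such that $\sigma$ is right conormal. Then $A{_\tau\times_\sigma}B$ admits a quasitriangular structure if and only if there exist normalized elements $W=\sum W^1\otimes W^2\in B\otimes B$, $X=\sum X^1\otimes X^2\in A\otimes B$, $Y=\sum Y^1\otimes Y^2\in B\otimes A$ and $Z=\sum Z^1\otimes Z^2\in A\otimes A$ satisfying the following identities C1)–C19) for all $a\in A$, $b\in B$: C1) $\sum Z^1_{\tau_1\tau_2}\bar X^1_{\tau_3}X^1a_{(1)\sigma_3}\,\epsilon_B((W^1Y^1)_{\sigma_3})\otimes Z^2Y^2_{\sigma_1\sigma_2}a_{(2)\sigma_4}\,\epsilon_B(1_{B\tau_1\sigma_2}\bar X^2_{\sigma_1})\,\epsilon_B((1_{B\tau_2}1_{B\tau_3}X^2W^2)_{\sigma_4})=\sum a_{(2)\tau}Z^1\otimes a_{(1)}Z^2_\sigma\,\epsilon_B(1_{B\tau\sigma})$; C2) $\sum X^1a_\sigma\,\epsilon_B(W^1_\sigma)\otimes X^2W^2=\sum a_\tau X^1\otimes 1_{B\tau}X^2$; C3) $\sum W^1Y^11_{B\tau}\otimes Y^2a_{\tau\sigma}\,\epsilon_B(W^2_\sigma)=\sum Y^1\otimes aY^2$; C4) $\sum Z^1\otimes Z^2\epsilon_B(b)=\sum 1_{A\tau}Z^1_{\sigma_1}\otimes Z^2_{\sigma_2}\,\epsilon_B(b_{(1)\tau\sigma_2})\,\epsilon_B(b_{(2)\sigma_1})$; C5) $\sum X^1\otimes X^2b=\sum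 1_{A\tau}X^1_\sigma\,\epsilon_B(b_{(2)\sigma})\otimes b_{(1)\tau}X^2$; C6) $\sum W^1Y^1b_\tau\otimes Y^21_{A\tau\sigma}\,\epsilon_B(W^2_\sigma)=\sum b_\sigma Y^1\otimes Y^2_\sigma$; C7) $\sum W^1b_{(1)}\otimes W^2b_{(2)}=\sum b_{(2)}W^1\otimes b_{(1)}W^2$; C8) $\sum Z^1_{(1)}\otimes Z^1_{(2)}\otimes Z^2=\sum Z^1_\tau X^1\otimes\bar Z^1\otimes Z^2\bar Z^2_\sigma\,\epsilon_B((1_{B\tau}X^2)_\sigma)$; C9) $\sum X^1_{(1)}\otimes X^1_{(2)}\otimes X^2=\sum X^1\otimes\bar X^1\otimes X^2\bar X^2$; C10) $\sum Y^1_{\tau_1}\otimes(Z^1_{\tau_2}X^1)_{\tau_1}\otimes Z^2Y^2_\sigma\,\epsilon_B((1_{B\tau_2}X^2)_\sigma)=\sum W^1Y^1\otimes Z^1\otimes Y^2Z^2_\sigma\,\epsilon_B(W^2_\sigma)$; C11) $\sum W^1_\tau\otimes X^1_\tau\otimes X^2W^2=\sum W^1\otimes X^1\otimes W^2X^2$; C12) $\sum Y^1_{(1)}\otimes Y^1_{(2)}\otimes Y^2=\sum W^1Y^1\otimes\bar Y^1\otimes Y^2\bar Y^2_\sigma\,\epsilon_B(W^2_\sigma)$; C13) $\sum W^1_{(1)}\otimes W^1_{(2)}\otimes W^2=\sum W^1\otimes\bar W^1\otimes W^2\bar W^2$; C14) $\sum Z^1\otimes Z^2_{(1)}\otimes Z^2_{(2)}=\sum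 Z^1_\tau X^1\bar Z^1_{\sigma_1}\,\epsilon_B(Y^1_{\sigma_1})\otimes\bar Z^2\otimes Z^2Y^2_{\sigma_2}\,\epsilon_B((1_{B\tau}X^2)_{\sigma_2})$; C15) $\sum Z^1_{\tau_1}X^1\otimes(1_{B\tau_1}X^2)_{\tau_2}\otimes Z^2_{\tau_2}=\sum Z^1_\tau X^1\bar X^1_{\sigma_1}\,\epsilon_B(Y^1_{\sigma_1})\otimes\bar X^2\otimes Z^2Y^2_{\sigma_2}\,\epsilon_B((1_{B\tau}X^2)_{\sigma_2})$; C16) $\sum X^1\otimes X^2_{(1)}\otimes X^2_{(2)}=\sum X^1\bar X^1_\sigma\,\epsilon_B(W^1_\sigma)\otimes\bar X^2\otimes X^2W^2$; C17) $\sum Y^1\otimes Y^2_{(1)}\otimes Y^2_{(2)}=\sum Y^1\bar Y^1\otimes\bar Y^2\otimes Y^2$; C18) $\sum W^1Y^1\otimes W^2_\tau\otimes Y^2_\tau=\sum Y^1W^1\otimes W^2\otimes Y^2$; C19) $\sum W^1\otimes W^2_{(1)}\otimes W^2_{(2)}=\sum W^1\bar W^1\otimes\bar W^2\otimes W^2$. In this case, the quasitriangular structure is given as $$\alpha=\sum Z^1_{\tau_1\tau_2}\bar X^1_{\tau_3}X^1\otimes W^1Y^1\otimes Z^2Y^2_{\sigma_1\sigma_2}\,\epsilon_B(1_{B\tau_1\sigma_2}\bar X^2_{\sigma_1})\otimes 1_{B\tau_2}1_{B\tau_3}X^2W^2\in(A\otimes B)\otimes(A\otimes B).$$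
   Context: Everything is over a field $\Bbbk$. Algebras are associative and unital, coalgebras coassociative and counital; $\Delta(c)=\sum c_{(1)}\otimes c_{(2)}$. Smash product: for algebras $A,B$ and a linear map $\sigma:B\otimes A\to A\otimes B$, written $\sigma(b\otimes a)=\sum a_\sigma\otimes b_\sigma$, consider on $A\otimes B$ the multiplication $(a\otimes b)(a'\otimes b')=\sum aa'_\sigma\otimes b_\sigma b'$. If it is associative with unit $1_A\otimes 1_B$, this algebra is the smash product $A\#_\sigma B$. Smash coproduct: for coalgebras $A,B$ and a linear map $\tau:A\otimes B\to B\otimes A$, written $\tau(a\otimes b)=\sum b_\tau\otimes a_\tau$, consider on $A\otimes B$ the comultiplication $a\otimes b\mapsto\sum a_{(1)}\otimes b_{(1)\tau}\otimes a_{(2)\tau}\otimes b_{(2)}$. If it is coassociative with counit $\epsilon_A\otimes\epsilon_B$, this coalgebra is the smash coproduct $A{_\tau\ltimes}B$. Smash biproduct: if $A,B$ are both algebras and coalgebras (neither necessarily a bialgebra), $A\#_\sigma B$ is a smash product, $A{_\tau\ltimes}B$ is a smash coproduct, and $A\otimes B$ with these two structures is a bialgebra, this bialgebra is denoted $A{_\tau\times_\sigma}B$ and called a smash biproduct bialgebra. Standing assumption: for every smash biproduct bialgebra, $A$ and $B$ are counital algebras via $\epsilon_A,\epsilon_B$ (i.e. $\epsilon_A,\epsilon_B$ are algebra maps to $\Bbbk$) and unital coalgebras via $\eta_A,\eta_B$ (i.e. the unit maps $\Bbbk\to A$, $\Bbbk\to B$ are coalgebra maps). $\sigma$ is right conormal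 if $\sum\epsilon_A(a_\sigma)b_\sigma=\epsilon_A(a)b$ for all $a\in A,b\in B$. A quasitriangular structure of a bialgebra $H$ is an element $\mathcal R=\sum\mathcal R^1\otimes\mathcal R^2\in H\otimes H$ (not required invertible) with: (QT1) $(\epsilon_H\otimes id)(\mathcal R)=1_H=(id\otimes\epsilon_H)(\mathcal R)$; (QT2) $(\Delta_H\otimes id)(\mathcal R)=\mathcal R_{13}\mathcal R_{23}$; (QT3) $(id\otimes\Delta_H)(\mathcal R)=\mathcal R_{13}\mathcal R_{12}$; (QT4) $\mathcal R\Delta_H(h)=\Delta_H^{cop}(h)\mathcal R$ for all $h\in H$. For $H=A{_\tau\times_\sigma}B$, $H\otimes H=A\otimes B\otimes A\otimes B$. Normalized elements: $W\in B\otimes B$ is normalized if $\sum\epsilon_B(W^1)W^2=1_B=\sum W^1\epsilon_B(W^2)$; $X\in A\otimes B$ if $\sum\epsilon_A(X^1)X^2=1_B$ and $\sum X^1\epsilon_B(X^2)=1_A$; $Y\in B\otimes A$ if $\sum\epsilon_B(Y^1)Y^2=1_A$ and $\sum Y^1\epsilon_A(Y^2)=1_B$; $Z\in A\otimes A$ if $\sum\epsilon_A(Z^1)Z^2=1_A=\sum Z^1\epsilon_A(Z^2)$. Index notation: $\sigma_i$ (resp. $\tau_i$) is a copy of $\sigma$ (resp. $\tau$). If an index $\sigma_i$ appears on an element coming from $B$ and on an element coming from $A$, then $\sigma_i$ has been applied to ($B$-element)$\otimes$($A$-element); similarly $\tau_i$ is applied to ($A$-element)$\otimes$($B$-element). Several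 subscripts on one element are applied successively from left to right (including comultiplication subscripts $(1),(2)$); an index on a bracketed product applies to the product. Each occurrence of $1_A$ or $1_B$ carries its own indices. Decorated letters such as $\bar X=\sum\bar X^1\otimes\bar X^2$ denote further copies of the same element $X$ (likewise for $W,Y,Z$). For example, in $\alpha$: $\tau_1$ is applied to $Z^1\otimes 1_B$, then $\tau_2$ to $Z^1_{\tau_1}\otimes 1_B$; $\tau_3$ is applied to $\bar X^1\otimes 1_B$; $\sigma_1$ is applied to $\bar X^2\otimes Y^2$, then $\sigma_2$ to $1_{B\tau_1}\otimes Y^2_{\sigma_1}$. *)

(* Defs.v *)
From HB Require Import structures.
From mathcomp Require Import all_boot all_algebra.
From mathcomp Require Import boolp.

Set Implicit Arguments.
Unset Strict Implicit.
Unset Printing Implicit Defensive.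

Import GRing.Theory.
Local Open Scope ring_scope.
Local Open Scope quotient_scope.

Reserved Notation "x \ox y" (at level 45, right associativity).
Reserved Notation "\osum_ ( x , y <- t ) F"
  (at level 45, x name, y name, t at level 60, F at level 45, right associativity,
   format "'[' \osum_ ( x ,  y  <-  t ) '/  '  F ']'").

(* A formal sum of pure tensors is a list of pairs; [tens_rel] is the congruence
   generated by bilinearity. *)

Section Tensor.
Variables (K : fieldType) (U V : lmodType K).

Inductive tens_rel : seq (U * V) -> seq (U * V) -> Prop :=
| tens_refl s : tens_rel s s
| tens_sym s t : tens_rel s t -> tens_rel t s
| tens_trans s t r : tens_rel s t -> tens_rel t r -> tens_rel s r
| tens_cat s s' t t' :
    tens_rel s s' -> tens_rel t t' -> tens_rel (s ++ t) (s' ++ t')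
| tens_catC s t : tens_rel (s ++ t) (t ++ s)
| tens_addl u u' v : tens_rel [:: (u + u', v)] [:: (u, v); (u', v)]
| tens_addr u v v' : tens_rel [:: (u, v + v')] [:: (u, v); (u, v')]
| tens_scale k u v : tens_rel [:: (k *: u, v)] [:: (u, k *: v)]
| tens_zero v : tens_rel [:: (0, v)] [::].

Definition tens_equiv (s t : seq (U * V)) : bool := `[< tens_rel s t >].

Lemma tens_equiv_refl : reflexive tens_equiv.
Proof. by move=> s; apply/asboolP/tens_refl. Qed.

Lemma tens_equiv_sym : symmetric tens_equiv.
Proof. by move=> s t; apply/asboolP/asboolP => /tens_sym. Qed.

Lemma tens_equiv_trans : transitive tens_equiv.
Proof.
by move=> t s r /asboolP st /asboolP tr; apply/asboolP/(tens_trans st tr).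
Qed.

Canonical tens_equiv_rel :=
  EquivRel tens_equiv tens_equiv_refl tens_equiv_sym tens_equiv_trans.

Definition tensor := {eq_quot tens_equiv}.

HB.instance Definition _ := Choice.on tensor.
HB.instance Definition _ := EqQuotient.on tensor.

Definition tens_class (s : seq (U * V)) : tensor := \pi_tensor s.

Lemma tens_classE s t : tens_class s = tens_class t <-> tens_rel s t.
Proof.
split=> [/eqP | st]; last by apply/eqP; rewrite /tens_class piE; apply/asboolP.
by rewrite /tens_class piE => /asboolP.
Qed.

Lemma tens_classK t : tens_class (repr t) = t.
Proof. exact: reprK. Qed.

Lemma tens_repr s : tens_rel (repr (tens_class s)) s.
Proof. by apply/tens_classE; rewrite tens_classK. Qed.

Definition tens_scale_seq (k : K) (s : seq (U * V)) :=
  [seq (k *: p.1, p.2) | p <- s].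

Lemma tens_scale_seq_rel k s t :
  tens_rel s t -> tens_rel (tens_scale_seq k s) (tens_scale_seq k t).
Proof.
elim=> {s t} [s|s t _|s t r _ st _|s s' t t' _ ss' _ tt'|s t|u u' v|u v v'|c u v|v].
- exact: tens_refl.
- exact: tens_sym.
- exact: tens_trans.
- by rewrite /tens_scale_seq !map_cat; apply: tens_cat.
- by rewrite /tens_scale_seq !map_cat; apply: tens_catC.
- by rewrite /tens_scale_seq /= scalerDr; apply: tens_addl.
- by rewrite /tens_scale_seq /=; apply: tens_addr.
- rewrite /tens_scale_seq /= scalerA mulrC -scalerA; exact: tens_scale.
- by rewrite /tens_scale_seq /= scaler0; apply: tens_zero.
Qed.

Definition tens_add (s t : tensor) : tensor := tens_class (repr s ++ repr t).
Definition tens_scaler (k : K) (t : tensor) : tensor :=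
  tens_class (tens_scale_seq k (repr t)).

Lemma tens_class_cat s t :
  tens_class (s ++ t) = tens_add (tens_class s) (tens_class t).
Proof. by apply/tens_classE/tens_cat; apply/tens_sym/tens_repr. Qed.

Lemma tens_class_scale k s :
  tens_class (tens_scale_seq k s) = tens_scaler k (tens_class s).
Proof. by apply/tens_classE/tens_scale_seq_rel/tens_sym/tens_repr. Qed.

Lemma tens_addA : associative tens_add.
Proof.
move=> s t r; rewrite -[s]tens_classK -[t]tens_classK -[r]tens_classK.
by rewrite -!tens_class_cat catA.
Qed.

Lemma tens_addC : commutative tens_add.
Proof. by move=> s t; apply/tens_classE/tens_catC. Qed.

Lemma tens_add0 : left_id (tens_class [::]) tens_add.
Proof. by move=> s; rewrite -[s]tens_classK -tens_class_cat. Qed.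

Lemma tens_scale1 s : tens_scaler 1 s = s.
Proof.
rewrite -[s]tens_classK -tens_class_scale; congr tens_class.
by rewrite -[RHS]map_id; apply: eq_map => -[u v] /=; rewrite scale1r.
Qed.

Lemma tens_scaleA k l s :
  tens_scaler k (tens_scaler l s) = tens_scaler (k * l) s.
Proof.
rewrite -[s]tens_classK -!tens_class_scale; congr tens_class.
by rewrite /tens_scale_seq -map_comp; apply: eq_map => -[u v] /=; rewrite scalerA.
Qed.

Lemma tens_scaleDr k : {morph tens_scaler k : s t / tens_add s t}.
Proof.
move=> s t; rewrite -[s]tens_classK -[t]tens_classK.
by rewrite -tens_class_cat -!tens_class_scale /tens_scale_seq map_cat tens_class_cat.
Qed.

Lemma tens_scaleDl s k l :
  tens_scaler (k + l) s = tens_add (tens_scaler k s) (tens_scaler l s).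
Proof.
rewrite -[s]tens_classK -!tens_class_scale.
elim: (repr s) => [|[u v] s' IH] /=; first by rewrite tens_add0.
rewrite -!(cat1s _ (tens_scale_seq _ _)) !tens_class_cat {}IH.
suff ->: tens_class [:: ((k + l) *: u, v)] =
         tens_add (tens_class [:: (k *: u, v)]) (tens_class [:: (l *: u, v)]).
  rewrite -!tens_addA; congr tens_add; rewrite !tens_addA; congr tens_add.
  exact: tens_addC.
by rewrite -tens_class_cat scalerDl; apply/tens_classE/tens_addl.
Qed.

Lemma tens_addN : left_inverse (tens_class [::]) (tens_scaler (-1)) tens_add.
Proof.
move=> s; rewrite -{2}[s]tens_scale1 -tens_scaleDl addNr.
rewrite -[s]tens_classK -tens_class_scale; apply/tens_classE.
elim: (repr s) => [|[u v] s' IH] /=; first exact: tens_refl.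
rewrite -(cat1s _ (tens_scale_seq _ _)) -[[::]]cats0; apply: tens_cat => //.
by rewrite scale0r; apply: tens_zero.
Qed.

HB.instance Definition _ :=
  GRing.isZmodule.Build tensor tens_addA tens_addC tens_add0 tens_addN.

HB.instance Definition _ := GRing.Zmodule_isLmodule.Build K tensor
  tens_scaleA tens_scale1 tens_scaleDr (fun s k l => tens_scaleDl s k l).

Definition tpure (u : U) (v : V) : tensor := tens_class [:: (u, v)].

(* Sweedler-style summation: the sum of f t1 t2 over a chosen decomposition
   t = sum t1 \ox t2.  When f is bilinear the choice is irrelevant and [osum f]
   is the linear map induced by f: see osum_pure and osum_linear. *)
Definition osum (W : nmodType) (f : U -> V -> W) (t : tensor) : W :=
  \sum_(p <- repr t) f p.1 p.2.

End Tensor.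

Notation "U \ox V" := (tensor U%type V%type) : type_scope.
Notation "u \ox v" := (tpure u v) : ring_scope.
Notation "\osum_ ( x , y <- t ) F" := (osum (fun x y => F) t) : ring_scope.

Section TensorTheory.
Variables (K : fieldType) (U V W : lmodType K).

Lemma tens_class_sum (s : seq (U * V)) :
  tens_class s = \sum_(p <- s) (p.1 \ox p.2).
Proof.
elim: s => [|[u v] s IH]; first by rewrite big_nil.
by rewrite big_cons -IH -cat1s tens_class_cat.
Qed.

Lemma tensor_sum (t : U \ox V) : t = \osum_(u, v <- t) u \ox v.
Proof. by rewrite -{1}[t]tens_classK tens_class_sum. Qed.

Lemma tpureDl (v : V) : linear (fun u : U => u \ox v).
Proof.
move=> k u u'; rewrite -[k *: (u \ox v)]tens_class_scale -[RHS]tens_class_cat.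
by apply/tens_classE/tens_addl.
Qed.

Lemma tpureDr (u : U) : linear (fun v : V => u \ox v).
Proof.
move=> k v v'; rewrite -[k *: (u \ox v)]tens_class_scale -[RHS]tens_class_cat.
apply/tens_classE/(tens_trans (tens_addr _ _ _)).
by apply: (tens_cat (s := [:: _])); [apply/tens_sym/tens_scale|apply: tens_refl].
Qed.

Variable f : U -> V -> W.
Hypothesis fl : forall v, linear (f^~ v).
Hypothesis fr : forall u, linear (f u).

Lemma osum_rel s t :
  tens_rel s t -> \sum_(p <- s) f p.1 p.2 = \sum_(p <- t) f p.1 p.2.
Proof.
have f0 v : f 0 v = 0.
  by have := fl v (-1) 0 0; rewrite scaler0 addr0 scaleN1r addNr.
have f0r u : f u 0 = 0.
  by have := fr u (-1) 0 0; rewrite scaler0 addr0 scaleN1r addNr.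
elim=> {s t} [s|s t _|s t r _ -> _|s s' t t' _ ss' _ tt'|s t|u u' v|u v v'|c u v|v] //.
- by rewrite !big_cat ss' tt'.
- by rewrite !big_cat /= addrC.
- by rewrite !big_cons !big_nil !addr0 /= -[u]scale1r fl !scale1r.
- by rewrite !big_cons !big_nil !addr0 /= -[v]scale1r fr !scale1r.
- rewrite !big_cons !big_nil !addr0 /= -[c *: u]addr0 -[c *: v]addr0 fl fr.
  by rewrite f0 f0r.
- by rewrite !big_cons !big_nil /= f0 addr0.
Qed.

Lemma osum_pure u v : osum f (u \ox v) = f u v.
Proof. by rewrite /osum (osum_rel (tens_repr _)) big_seq1. Qed.

Lemma osum_linear : linear (osum f).
Proof.
have osumE s : osum f (tens_class s) = \sum_(p <- s) f p.1 p.2.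
  exact/osum_rel/tens_repr.
have f0 v : f 0 v = 0.
  by have := fl v (-1) 0 0; rewrite scaler0 addr0 scaleN1r addNr.
move=> k s t; rewrite -[s]tens_classK -[t]tens_classK.
rewrite -[k *: _]tens_class_scale -[X in osum f X]tens_class_cat !osumE.
rewrite big_cat big_map scaler_sumr; congr (_ + _).
by apply: eq_bigr => -[u v] _ /=; rewrite -[k *: u]addr0 fl f0 addr0.
Qed.

End TensorTheory.

Section Bialgebras.
Variable K : fieldType.

Definition is_algebra (H : lmodType K) (mul : H -> H -> H) (one : H) : Prop :=
  [/\ forall y, linear (mul^~ y), forall x, linear (mul x),
      associative mul, left_id one mul & right_id one mul].

Definition is_coalgebra (C : lmodType K) (D : C -> C \ox C) (e : C -> K) : Prop :=
  [/\ linear D, scalar e,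
      forall c, \osum_(c1, c2 <- D c) \osum_(d1, d2 <- D c1) (d1 \ox d2 \ox c2)
              = \osum_(c1, c2 <- D c) (c1 \ox D c2),
      forall c, \osum_(c1, c2 <- D c) (e c1 *: c2) = c
    & forall c, \osum_(c1, c2 <- D c) (e c2 *: c1) = c].

Definition tensor_mul (G H : lmodType K) (mulG : G -> G -> G) (mulH : H -> H -> H)
    (s t : G \ox H) : G \ox H :=
  \osum_(s1, s2 <- s) \osum_(t1, t2 <- t) (mulG s1 t1 \ox mulH s2 t2).

Definition is_bialgebra (H : lmodType K) (mul : H -> H -> H) (one : H)
    (D : H -> H \ox H) (e : H -> K) : Prop :=
  [/\ is_algebra mul one, is_coalgebra D e,
      (forall x y, D (mul x y) = tensor_mul mul mul (D x) (D y))
        /\ D one = one \ox one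
    & (forall x y, e (mul x y) = e x * e y) /\ e one = 1].

(* Invertibility of R is not required. *)
Definition is_quasitriangular (H : lmodType K) (mul : H -> H -> H) (one : H)
    (D : H -> H \ox H) (e : H -> K) (R : H \ox H) : Prop :=
  let mul2 := tensor_mul mul mul in
  let mul3 := tensor_mul mul mul2 in
  let R12 := \osum_(r1, r2 <- R) (r1 \ox r2 \ox one) in
  let R13 := \osum_(r1, r2 <- R) (r1 \ox one \ox r2) in
  let R23 := \osum_(r1, r2 <- R) (one \ox r1 \ox r2) in
  [/\ \osum_(r1, r2 <- R) (e r1 *: r2) = one
        /\ \osum_(r1, r2 <- R) (e r2 *: r1) = one,
      \osum_(r1, r2 <- R) \osum_(h1, h2 <- D r1) (h1 \ox h2 \ox r2)
        = mul3 R13 R23,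
      \osum_(r1, r2 <- R) (r1 \ox D r2) = mul3 R13 R12
    & forall h, mul2 R (D h) = mul2 (\osum_(h1, h2 <- D h) (h2 \ox h1)) R].

Definition is_counital_algebra (A : algType K) (e : A -> K) : Prop :=
  (forall x y, e (x * y) = e x * e y) /\ e 1 = 1.

Definition is_unital_coalgebra (A : algType K) (D : A -> A \ox A) (e : A -> K) : Prop :=
  D 1 = 1 \ox 1 /\ e 1 = 1.

End Bialgebras.

Section SmashBiproduct.
Variables (K : fieldType) (A B : algType K).
Variables (DA : A -> A \ox A) (eA : A -> K) (DB : B -> B \ox B) (eB : B -> K).
Variables (sigma : B \ox A -> A \ox B) (tau : A \ox B -> B \ox A).

Definition smash_mul (s t : A \ox B) : A \ox B :=
  \osum_(a, b <- s) \osum_(a', b' <- t) \osum_(a's, bs <- sigma (b \ox a'))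
    ((a * a's) \ox (bs * b')).

Definition smash_one : A \ox B := 1 \ox 1.

Definition smash_comul (t : A \ox B) : (A \ox B) \ox (A \ox B) :=
  \osum_(a, b <- t) \osum_(a1, a2 <- DA a) \osum_(b1, b2 <- DB b)
    \osum_(b1t, a2t <- tau (a2 \ox b1)) ((a1 \ox b1t) \ox (a2t \ox b2)).

Definition smash_counit (t : A \ox B) : K := \osum_(a, b <- t) (eA a * eB b).

Definition is_smash_product : Prop := is_algebra smash_mul smash_one.

Definition is_smash_coproduct : Prop := is_coalgebra smash_comul smash_counit.

Definition is_smash_biproduct_bialgebra : Prop :=
  [/\ is_coalgebra DA eA, is_coalgebra DB eB,
      is_smash_product, is_smash_coproduct
    & is_bialgebra smash_mul smash_one smash_comul smash_counit].

Definition right_conormal : Prop :=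
  forall (a : A) (b : B),
    \osum_(a_s, bs <- sigma (b \ox a)) (eA a_s *: bs) = eA a *: b.

Definition normalized (P Q : algType K) (eP : P -> K) (eQ : Q -> K) (T : P \ox Q) : Prop :=
  \osum_(t1, t2 <- T) (eP t1 *: t2) = 1 /\ \osum_(t1, t2 <- T) (eQ t2 *: t1) = 1.

(* Naming: X1, X2 are the legs of X and X1', X2' those of a further copy of X;
   a suffix s or t records an application of sigma or tau, numbered as sigma_1,
   tau_1, ...; 1_{B tau_i} is written ui and 1_{A tau} is written v, followed by
   the suffixes of later applications; bs, bt2, ... are images of bracketed
   products. *)
Record quasitriangular_data (W : B \ox B) (X : A \ox B) (Y : B \ox A) (Z : A \ox A)
    : Prop := QuasitriangularData {
  C1 : forall a : A,
    \osum_(Z1, Z2 <- Z) \osum_(X1', X2' <- X) \osum_(X1, X2 <- X)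
    \osum_(W1, W2 <- W) \osum_(Y1, Y2 <- Y) \osum_(a1, a2 <- DA a)
    \osum_(u1, Z1t1 <- tau (Z1 \ox 1)) \osum_(u2, Z1t1t2 <- tau (Z1t1 \ox 1))
    \osum_(u3, X1't3 <- tau (X1' \ox 1))
    \osum_(Y2s1, X2's1 <- sigma (X2' \ox Y2))
    \osum_(Y2s1s2, u1s2 <- sigma (u1 \ox Y2s1))
    \osum_(a1s3, WYs3 <- sigma ((W1 * Y1) \ox a1))
    \osum_(a2s4, bs4 <- sigma ((u2 * u3 * X2 * W2) \ox a2))
      ((eB WYs3 * eB (u1s2 * X2's1) * eB bs4) *:
        ((Z1t1t2 * X1't3 * X1 * a1s3) \ox (Z2 * Y2s1s2 * a2s4)))
    = \osum_(Z1, Z2 <- Z) \osum_(a1, a2 <- DA a)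
      \osum_(u, a2t <- tau (a2 \ox 1)) \osum_(Z2s, us <- sigma (u \ox Z2))
        (eB us *: ((a2t * Z1) \ox (a1 * Z2s)));
  C2 : forall a : A,
    \osum_(X1, X2 <- X) \osum_(W1, W2 <- W) \osum_(a_s, W1s <- sigma (W1 \ox a))
      (eB W1s *: ((X1 * a_s) \ox (X2 * W2)))
    = \osum_(X1, X2 <- X) \osum_(u, a_t <- tau (a \ox 1))
        ((a_t * X1) \ox (u * X2));
  C3 : forall a : A,
    \osum_(W1, W2 <- W) \osum_(Y1, Y2 <- Y) \osum_(u, a_t <- tau (a \ox 1))
    \osum_(ats, W2s <- sigma (W2 \ox a_t))
      (eB W2s *: ((W1 * Y1 * u) \ox (Y2 * ats)))
    = \osum_(Y1, Y2 <- Y) (Y1 \ox (a * Y2));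
  C4 : forall b : B,
    \osum_(Z1, Z2 <- Z) (eB b *: (Z1 \ox Z2))
    = \osum_(Z1, Z2 <- Z) \osum_(b1, b2 <- DB b)
      \osum_(b1t, v <- tau (1 \ox b1)) \osum_(Z1s1, b2s1 <- sigma (b2 \ox Z1))
      \osum_(Z2s2, b1ts2 <- sigma (b1t \ox Z2))
        ((eB b1ts2 * eB b2s1) *: ((v * Z1s1) \ox Z2s2));
  C5 : forall b : B,
    \osum_(X1, X2 <- X) (X1 \ox (X2 * b))
    = \osum_(X1, X2 <- X) \osum_(b1, b2 <- DB b)
      \osum_(b1t, v <- tau (1 \ox b1)) \osum_(X1s, b2s <- sigma (b2 \ox X1))
        (eB b2s *: ((v * X1s) \ox (b1t * X2)));
  C6 : forall b : B,
    \osum_(W1, W2 <- W) \osum_(Y1, Y2 <- Y)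
    \osum_(bt, v <- tau (1 \ox b)) \osum_(vs, W2s <- sigma (W2 \ox v))
      (eB W2s *: ((W1 * Y1 * bt) \ox (Y2 * vs)))
    = \osum_(Y1, Y2 <- Y) \osum_(Y2s, bs <- sigma (b \ox Y2))
        ((bs * Y1) \ox Y2s);
  C7 : forall b : B,
    \osum_(W1, W2 <- W) \osum_(b1, b2 <- DB b) ((W1 * b1) \ox (W2 * b2))
    = \osum_(W1, W2 <- W) \osum_(b1, b2 <- DB b) ((b2 * W1) \ox (b1 * W2));
  C8 :
    \osum_(Z1, Z2 <- Z) \osum_(Z11, Z12 <- DA Z1) (Z11 \ox Z12 \ox Z2)
    = \osum_(Z1, Z2 <- Z) \osum_(X1, X2 <- X) \osum_(Z1', Z2' <- Z)
      \osum_(u, Z1t <- tau (Z1 \ox 1)) \osum_(Z2's, bs <- sigma ((u * X2) \ox Z2'))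
        (eB bs *: ((Z1t * X1) \ox Z1' \ox (Z2 * Z2's)));
  C9 :
    \osum_(X1, X2 <- X) \osum_(X11, X12 <- DA X1) (X11 \ox X12 \ox X2)
    = \osum_(X1, X2 <- X) \osum_(X1', X2' <- X) (X1 \ox X1' \ox (X2 * X2'));
  C10 :
    \osum_(Y1, Y2 <- Y) \osum_(Z1, Z2 <- Z) \osum_(X1, X2 <- X)
    \osum_(u2, Z1t2 <- tau (Z1 \ox 1))
    \osum_(Y1t1, ZXt1 <- tau ((Z1t2 * X1) \ox Y1))
    \osum_(Y2s, bs <- sigma ((u2 * X2) \ox Y2))
      (eB bs *: (Y1t1 \ox ZXt1 \ox (Z2 * Y2s)))
    = \osum_(W1, W2 <- W) \osum_(Y1, Y2 <- Y) \osum_(Z1, Z2 <- Z)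
      \osum_(Z2s, W2s <- sigma (W2 \ox Z2))
        (eB W2s *: ((W1 * Y1) \ox Z1 \ox (Y2 * Z2s)));
  C11 :
    \osum_(W1, W2 <- W) \osum_(X1, X2 <- X) \osum_(W1t, X1t <- tau (X1 \ox W1))
      (W1t \ox X1t \ox (X2 * W2))
    = \osum_(W1, W2 <- W) \osum_(X1, X2 <- X) (W1 \ox X1 \ox (W2 * X2));
  C12 :
    \osum_(Y1, Y2 <- Y) \osum_(Y11, Y12 <- DB Y1) (Y11 \ox Y12 \ox Y2)
    = \osum_(W1, W2 <- W) \osum_(Y1, Y2 <- Y) \osum_(Y1', Y2' <- Y)
      \osum_(Y2's, W2s <- sigma (W2 \ox Y2'))
        (eB W2s *: ((W1 * Y1) \ox Y1' \ox (Y2 * Y2's)));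
  C13 :
    \osum_(W1, W2 <- W) \osum_(W11, W12 <- DB W1) (W11 \ox W12 \ox W2)
    = \osum_(W1, W2 <- W) \osum_(W1', W2' <- W) (W1 \ox W1' \ox (W2 * W2'));
  C14 :
    \osum_(Z1, Z2 <- Z) \osum_(Z21, Z22 <- DA Z2) (Z1 \ox Z21 \ox Z22)
    = \osum_(Z1, Z2 <- Z) \osum_(X1, X2 <- X) \osum_(Z1', Z2' <- Z)
      \osum_(Y1, Y2 <- Y) \osum_(u, Z1t <- tau (Z1 \ox 1))
      \osum_(Z1's1, Y1s1 <- sigma (Y1 \ox Z1'))
      \osum_(Y2s2, bs2 <- sigma ((u * X2) \ox Y2))
        ((eB Y1s1 * eB bs2) *: ((Z1t * X1 * Z1's1) \ox Z2' \ox (Z2 * Y2s2)));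
  C15 :
    \osum_(Z1, Z2 <- Z) \osum_(X1, X2 <- X) \osum_(u1, Z1t1 <- tau (Z1 \ox 1))
    \osum_(bt2, Z2t2 <- tau (Z2 \ox (u1 * X2)))
      ((Z1t1 * X1) \ox bt2 \ox Z2t2)
    = \osum_(Z1, Z2 <- Z) \osum_(X1, X2 <- X) \osum_(X1', X2' <- X)
      \osum_(Y1, Y2 <- Y) \osum_(u, Z1t <- tau (Z1 \ox 1))
      \osum_(X1's1, Y1s1 <- sigma (Y1 \ox X1'))
      \osum_(Y2s2, bs2 <- sigma ((u * X2) \ox Y2))
        ((eB Y1s1 * eB bs2) *: ((Z1t * X1 * X1's1) \ox X2' \ox (Z2 * Y2s2)));
  C16 :
    \osum_(X1, X2 <- X) \osum_(X21, X22 <- DB X2) (X1 \ox X21 \ox X22)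
    = \osum_(X1, X2 <- X) \osum_(X1', X2' <- X) \osum_(W1, W2 <- W)
      \osum_(X1's, W1s <- sigma (W1 \ox X1'))
        (eB W1s *: ((X1 * X1's) \ox X2' \ox (X2 * W2)));
  C17 :
    \osum_(Y1, Y2 <- Y) \osum_(Y21, Y22 <- DA Y2) (Y1 \ox Y21 \ox Y22)
    = \osum_(Y1, Y2 <- Y) \osum_(Y1', Y2' <- Y) ((Y1 * Y1') \ox Y2' \ox Y2);
  C18 :
    \osum_(W1, W2 <- W) \osum_(Y1, Y2 <- Y) \osum_(W2t, Y2t <- tau (Y2 \ox W2))
      ((W1 * Y1) \ox W2t \ox Y2t)
    = \osum_(W1, W2 <- W) \osum_(Y1, Y2 <- Y) ((Y1 * W1) \ox W2 \ox Y2);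
  C19 :
    \osum_(W1, W2 <- W) \osum_(W21, W22 <- DB W2) (W1 \ox W21 \ox W22)
    = \osum_(W1, W2 <- W) \osum_(W1', W2' <- W) ((W1 * W1') \ox W2' \ox W2)
}.

Definition normalized_quasitriangular_data
    (W : B \ox B) (X : A \ox B) (Y : B \ox A) (Z : A \ox A) : Prop :=
  [/\ normalized eB eB W, normalized eA eB X, normalized eB eA Y,
      normalized eA eA Z & quasitriangular_data W X Y Z].

Definition alpha (W : B \ox B) (X : A \ox B) (Y : B \ox A) (Z : A \ox A)
    : (A \ox B) \ox (A \ox B) :=
  \osum_(Z1, Z2 <- Z) \osum_(X1', X2' <- X) \osum_(X1, X2 <- X)
  \osum_(W1, W2 <- W) \osum_(Y1, Y2 <- Y)
  \osum_(u1, Z1t1 <- tau (Z1 \ox 1)) \osum_(u2, Z1t1t2 <- tau (Z1t1 \ox 1))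
  \osum_(u3, X1't3 <- tau (X1' \ox 1))
  \osum_(Y2s1, X2's1 <- sigma (X2' \ox Y2))
  \osum_(Y2s1s2, u1s2 <- sigma (u1 \ox Y2s1))
    (eB (u1s2 * X2's1) *:
      (((Z1t1t2 * X1't3 * X1) \ox (W1 * Y1)) \ox
       ((Z2 * Y2s1s2) \ox (u2 * u3 * X2 * W2)))).

Definition is_smash_quasitriangular (R : (A \ox B) \ox (A \ox B)) : Prop :=
  is_quasitriangular smash_mul smash_one smash_comul smash_counit R.

End SmashBiproduct.

(* Main.v *)
Require Import Defs.
From mathcomp Require Import all_boot all_algebra.

(** Write H for the biproduct on A \ox B.  Right conormality of sigma says that
    [projB], a \ox b |-> eA a *: b, is an algebra map from H to B; the counit
    axioms of the smash coproduct make [projB] and [projA], a \ox b |-> eB b *: a,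
    coalgebra maps.  Moreover [projA (mul g h)] depends on h only through
    [projA h], so that H acts on A by [act] and [projA] is H-linear.  Thus A and
    B are quotients of the left H-module coalgebra H, and H is recovered from
    them: h is the sum of projA h1 \ox projB h2, and tau h is the sum of
    projB h1 \ox projA h2.  In these terms sigma and tau leave the scene, and
    everything becomes Sweedler calculus in the bialgebra H and its two quotients.

    A quasitriangular structure R has four images W, X, Y, Z in B \ox B, A \ox B,
    B \ox A and A \ox A.  Splitting each leg of R as projA \ox projB after a
    coproduct, and using that the coproduct of a leg of R is a product of copies
    of R, one finds every partial image of R from these four: the images in
    H \ox B, B \ox H, A \ox H, H \ox A are the elements [RB], [BR], [AR], [RA],
    and R itself is [RR], which is the element alpha ([alpha_RR]).  The nineteen
    identities are then the images of the axioms of R under all the choices of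
    projA or projB on each leg ([comul_components] for the two coproduct axioms,
    [cocomm_components] for almost cocommutativity).  This gives one direction,
    [R_comul_components] and [R_cocomm_components].

    Conversely, given W, X, Y, Z, the elements [RB], ..., [RR] are defined by the
    same formulas and one climbs back, leg by leg.  The coproduct of the first leg
    of RB comes from the identities for X and W; from it and the others one
    obtains the coproducts of the legs of BR, AR and RA, and the two ways of
    writing RR ([osum_RR] and [osum_RR_AR_BR]) give its coproduct axioms
    ([comul_RR_l], [comul_RR_r]).  For almost cocommutativity one needs the
    component identities not only for the generators a \ox 1 and 1 \ox b but for
    every h in H, since coproducts of generators leave the generators.  This is
    why the versions with one leg in A carry an extra element x of A, on which
    act h is evaluated: such identities are stable under products of h
    ([cocommAB], [cocommBA]). *)

Set Implicit Arguments.
Unset Strict Implicit.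
Unset Printing Implicit Defensive.
Import GRing.Theory.
Local Open Scope ring_scope.

(** * Linear maps out of tensor products *)

Section LinearMaps.
Variable K : fieldType.
Implicit Types U V W X : lmodType K.

Definition is_linear U V (f : U -> V) : Prop := linear f.

Definition bilin U V W (f : U -> V -> W) : Prop :=
  (forall y, is_linear (f^~ y)) /\ (forall x, is_linear (f x)).

Definition trilin U V W X (f : U -> V -> W -> X) : Prop :=
  [/\ forall y z, is_linear (fun x => f x y z),
      forall x z, is_linear (fun y => f x y z)
    & forall x y, is_linear (f x y)].

Lemma is_linear_id U : is_linear (fun x : U => x).
Proof. by []. Qed.

Lemma is_linear_comp U V W (f : V -> W) (g : U -> V) :
  is_linear f -> is_linear g -> is_linear (fun x => f (g x)).
Proof. by move=> fl gl k x y; rewrite gl fl. Qed.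

Lemma is_linear_scale_l U V (s : U -> K^o) (v : V) :
  is_linear s -> is_linear (fun x => (s x : K) *: v).
Proof. by move=> sl k x y; rewrite sl scalerDl scalerA. Qed.

Lemma is_linear_scale_r V (k : K) : is_linear (fun v : V => k *: v).
Proof. by move=> l x y; rewrite scalerDr !scalerA mulrC. Qed.

Lemma is_linear_mulK_l U (s : U -> K^o) (k : K) :
  is_linear s -> is_linear (fun x => (s x : K) * k : K^o).
Proof.
by move=> sl l x y; rewrite sl mulrDl; congr (_ + _); symmetry; apply: mulrA.
Qed.

Lemma is_linear_mulK_r U (s : U -> K^o) (k : K) :
  is_linear s -> is_linear (fun x => k * (s x : K) : K^o).
Proof. by move=> sl l x y; rewrite sl mulrDr; congr (_ + _); apply: mulrCA. Qed.

Lemma is_linear_osum_body U V W X (F : X -> U -> V -> W) (t : U \ox V) :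
  (forall u v, is_linear (fun x => F x u v)) ->
  is_linear (fun x => osum (F x) t).
Proof.
move=> Fl k x y; rewrite /osum scaler_sumr -big_split /=.
by apply: eq_bigr => -[u v] _; apply: Fl.
Qed.

Lemma is_linear_osum U V W (f : U -> V -> W) : bilin f -> is_linear (osum f).
Proof. by case=> fl fr; apply: osum_linear. Qed.

Lemma is_linear_tpure_l U V (v : V) : is_linear (fun u : U => u \ox v).
Proof. exact: tpureDl. Qed.

Lemma is_linear_tpure_r U V (u : U) : is_linear (fun v : V => u \ox v).
Proof. exact: tpureDr. Qed.

Lemma is_linear_mul_l (A : algType K) (c : A) : is_linear (fun x : A => x * c).
Proof. by move=> k x y; rewrite mulrDl scalerAl. Qed.

Lemma is_linear_mul_r (A : algType K) (c : A) : is_linear (fun x : A => c * x).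
Proof. by move=> k x y; rewrite mulrDr scalerAr. Qed.

Lemma is_linearZ U V (f : U -> V) k x : is_linear f -> f (k *: x) = k *: f x.
Proof.
move=> fl.
have f0 : f 0 = 0 by have := fl (-1) 0 0; rewrite scaler0 addr0 scaleN1r addNr.
by rewrite -[k *: x]addr0 fl f0 addr0.
Qed.

Lemma eq_osum U V (W : nmodType) (f g : U -> V -> W) (t : U \ox V) :
  (forall x y, f x y = g x y) -> osum f t = osum g t.
Proof. by move=> fg; apply: eq_bigr. Qed.

(** [osum] sums over one fixed decomposition of the tensor, so that sums commute
    without any bilinearity hypothesis. *)
Lemma exchange_osum U V U' V' (W : nmodType) (F : U -> V -> U' -> V' -> W)
    (s : U \ox V) (t : U' \ox V') :
  osum (fun x y => osum (fun z w => F x y z w) t) s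
  = osum (fun z w => osum (fun x y => F x y z w) s) t.
Proof. exact: exchange_big. Qed.

Lemma linear_osum U V W X (L : W -> X) (f : U -> V -> W) (t : U \ox V) :
  is_linear L -> L (osum f t) = osum (fun x y => L (f x y)) t.
Proof.
move=> Ll.
have L0 : L 0 = 0 by have := Ll (-1) 0 0; rewrite scaler0 addr0 scaleN1r addNr.
have LD x y : L (x + y) = L x + L y by rewrite -[x]scale1r Ll !scale1r.
exact: (big_morph L LD L0).
Qed.

Lemma scaler_osum U V W (f : U -> V -> W) (t : U \ox V) (k : K) :
  k *: osum f t = \osum_(x, y <- t) (k *: f x y).
Proof. by rewrite (linear_osum _ _ (is_linear_scale_r k)). Qed.

Lemma osum_tpure U V W (f : U -> V -> W) x y :
  bilin f -> osum f (x \ox y) = f x y.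
Proof. by case=> fl fr; rewrite osum_pure. Qed.

Lemma osum_tpure_id U V (t : U \ox V) : osum (fun x y => x \ox y) t = t.
Proof. by rewrite -tensor_sum. Qed.

Lemma osum_tensor_id U V W (Phi : U \ox V -> W) (t : U \ox V) :
  is_linear Phi -> \osum_(a, b <- t) Phi (a \ox b) = Phi t.
Proof. by move=> Phil; rewrite [t in RHS]tensor_sum linear_osum. Qed.

Lemma osum_bind U V U' V' W (g : U' -> V' -> U \ox V) (f : U -> V -> W) t :
  bilin f -> osum f (osum g t) = osum (fun x y => osum f (g x y)) t.
Proof. by move=> /is_linear_osum/linear_osum ->. Qed.

Lemma bilin_osum U V W U1 V1 U2 V2 (m : U -> V -> W)
    (f : U1 -> V1 -> U) (g : U2 -> V2 -> V) t s : bilin m ->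
  m (osum f t) (osum g s) =
  \osum_(x, y <- t) \osum_(z, w <- s) m (f x y) (g z w).
Proof.
move=> [ml mr]; rewrite (linear_osum (L := fun z => m z _)) //.
by apply: eq_osum => x y; rewrite linear_osum.
Qed.

Lemma tensor_ext U V W (f g : U \ox V -> W) :
  is_linear f -> is_linear g -> (forall u v, f (u \ox v) = g (u \ox v)) ->
  forall t, f t = g t.
Proof.
move=> fl gl fg t; rewrite [t]tensor_sum !linear_osum //.
exact: eq_osum.
Qed.

Lemma tensor_mul_tpure U V (m : U -> U -> U) (n : V -> V -> V) a b c d :
  bilin m -> bilin n -> tensor_mul m n (a \ox b) (c \ox d) = m a c \ox n b d.
Proof.
move=> [ml mr] [nl nr]; rewrite /tensor_mul !osum_tpure //.
  by split=> ?; [apply: (is_linear_comp (is_linear_tpure_l _))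
               | apply: (is_linear_comp (is_linear_tpure_r _))].
by split=> ?; apply: is_linear_osum_body => ? ?;
   [apply: (is_linear_comp (is_linear_tpure_l _))
  | apply: (is_linear_comp (is_linear_tpure_r _))].
Qed.

Lemma bilin_tensor_mul U V (m : U -> U -> U) (n : V -> V -> V) :
  bilin m -> bilin n -> bilin (tensor_mul m n).
Proof.
move=> [ml mr] [nl nr]; rewrite /tensor_mul; split=> t.
  by apply: is_linear_osum; split=> ?; apply: is_linear_osum_body => ? ?;
   [apply: (is_linear_comp (is_linear_tpure_l _))
  | apply: (is_linear_comp (is_linear_tpure_r _))].
by apply: is_linear_osum_body => ? ?; apply: is_linear_osum; split=> ?;
   [apply: (is_linear_comp (is_linear_tpure_l _))
  | apply: (is_linear_comp (is_linear_tpure_r _))].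
Qed.

End LinearMaps.

(** * Tactics for Sweedler sums *)

Create HintDb lin discriminated.
#[export] Hint Extern 0 (is_linear _) => exact (@is_linear_scale_r _ _ _) : lin.
#[export] Hint Extern 0 (is_linear _) => exact (@is_linear_tpure_l _ _ _ _) : lin.
#[export] Hint Extern 0 (is_linear _) => exact (@is_linear_tpure_r _ _ _ _) : lin.
#[export] Hint Extern 0 (is_linear _) => exact (@is_linear_mul_l _ _ _) : lin.
#[export] Hint Extern 0 (is_linear _) => exact (@is_linear_mul_r _ _ _) : lin.

Ltac lin_base :=
  match goal with
  | H : bilin ?F |- is_linear (fun z => ?F z ?a) => exact (proj1 H a)
  | H : bilin ?F |- is_linear (fun z => ?F ?a z) => exact (proj2 H a)
  | H : bilin ?F |- is_linear (?F ?a) => exact (proj2 H a)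
  | H : trilin ?F |- is_linear (fun z => ?F z ?a ?b) =>
      exact (let: And3 h _ _ := H in h a b)
  | H : trilin ?F |- is_linear (fun z => ?F ?a z ?b) =>
      exact (let: And3 _ h _ := H in h a b)
  | H : trilin ?F |- is_linear (fun z => ?F ?a ?b z) =>
      exact (let: And3 _ _ h := H in h a b)
  | H : trilin ?F |- is_linear (?F ?a ?b) =>
      exact (let: And3 _ _ h := H in h a b)
  | |- _ => assumption
  | |- _ => solve [auto with lin nocore]
  end.

(** Proves linearity by recursion on the expression: the variable has to occur
    in exactly one argument of each operation met on the way down. *)
Ltac lin :=
  cbv beta;
  lazymatch goal with
  | |- forall _, _ => intro; lin
  | |- bilin _ => split; lin
  | |- trilin _ => split; lin
  | |- is_linear (fun x => x) => exact (@is_linear_id _ _)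
  | |- is_linear (osum _) => refine (is_linear_osum _); lin
  | |- is_linear (fun x => osum (@?F x) (@?g x)) =>
      lazymatch g with
      | fun _ => ?t => refine (@is_linear_osum_body _ _ _ _ _ F t _); lin
      | _ => lazymatch F with fun _ => ?G =>
          refine (is_linear_comp (f := osum G) (g := g) _ _);
          [refine (is_linear_osum _); lin | lin] end
      end
  | |- is_linear (fun x => GRing.scale (@?s x) (@?g x)) =>
      lazymatch g with
      | fun _ => ?v => refine (@is_linear_scale_l _ _ _ s v _); lin
      | _ => lin_app
      end
  | |- _ => first [ lin_base | lin_app | lin_mulK ]
  end
with lin_mulK :=
  lazymatch goal with
  | |- is_linear (fun x => GRing.mul (@?s x) (@?g x)) =>
      lazymatch g with
      | fun _ => ?v => refine (@is_linear_mulK_l _ _ s v _); lin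
      | _ => lazymatch s with
             fun _ => ?v => refine (@is_linear_mulK_r _ _ g v _); lin end
      end
  end
with lin_app :=
  lazymatch goal with
  | |- is_linear (fun x => ?f (@?g x) (@?c x) (@?d x)) =>
      lazymatch constr:((g, c, d)) with
      | (_, fun _ => ?c0, fun _ => ?d0) =>
        refine (is_linear_comp (f := fun z => f z c0 d0) (g := g) _ _);
        [lin_base | lin]
      | (fun _ => ?g0, _, fun _ => ?d0) =>
        refine (is_linear_comp (f := fun z => f g0 z d0) (g := c) _ _);
        [lin_base | lin]
      | (fun _ => ?g0, fun _ => ?c0, _) =>
        refine (is_linear_comp (f := fun z => f g0 c0 z) (g := d) _ _);
        [lin_base | lin]
      end
  | |- is_linear (fun x => ?f (@?g x) (@?c x)) =>
      lazymatch constr:((g, c)) with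
      | (_, fun _ => ?c0) =>
        refine (is_linear_comp (f := fun z => f z c0) (g := g) _ _);
        [lin_base | lin]
      | (fun _ => ?g0, _) =>
        refine (is_linear_comp (f := fun z => f g0 z) (g := c) _ _);
        [lin_base | lin]
      end
  | |- @is_linear ?K ?U ?V (fun x => ?f (@?g x)) =>
      refine (@is_linear_comp K U _ V f g _ _); [lin_base | lin]
  end.

(** Identities between Sweedler sums are stated for an arbitrary multilinear
    function Phi of the summed legs, so that they apply inside any larger sum.
    A step of calculation consists in rewriting with such an identity below some
    of the summation signs and then reordering the sums. *)
Ltac at_depth n tac :=
  lazymatch n with
  | O => tac
  | S ?k => refine (eq_osum _ _); intros ? ?; cbv beta; at_depth k tac
  end.

Ltac some_depth tac :=
  first [ tac 0%nat | tac 1%nat | tac 2%nat | tac 3%nat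
        | tac 4%nat | tac 5%nat | tac 6%nat | tac 7%nat ].

Ltac bring n :=
  lazymatch n with
  | O => reflexivity
  | S ?k => refine (etrans _ _);
            [ refine (eq_osum _ _); intros ? ?; cbv beta; bring k
            | refine (exchange_osum _ _ _) ]
  end.

Ltac same_tensor t s :=
  first [ constr_eq t s
        | lazymatch constr:((t, s)) with (?f ?x, ?f ?y) => unify x y end ].

(** Proves an equality of two iterated sums that differ in the order of
    summation, closing the equality of the summands with [leaf]; backtracking
    tells apart several sums over the same tensor. *)
Ltac perm leaf :=
  lazymatch goal with
  | |- osum _ _ = osum _ _ =>
     some_depth ltac:(fun n =>
       refine (etrans _ (esym _)); [ | bring n]; cbv beta;
       lazymatch goal with
       | |- osum _ ?t = osum _ ?s =>
           same_tensor t s; refine (eq_osum _ _); intros ? ?; cbv beta; perm leaf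
       end)
  | |- _ => solve [leaf]
  end.

Ltac sweedler tac leaf :=
  cbv beta;
  some_depth ltac:(fun n =>
    refine (etrans _ _); [at_depth n tac | cbv beta]; perm leaf).

Ltac sw_assoc := first [reflexivity | rewrite ?mulrA; reflexivity].
Tactic Notation "sw" uconstr(E) :=
  sweedler ltac:(apply E; lin) ltac:(sw_assoc).
Tactic Notation "swr" uconstr(E) :=
  sweedler ltac:(symmetry; apply E; lin) ltac:(sw_assoc).
Tactic Notation "reorder" tactic3(t) := cbv beta; perm ltac:(t).

(** When the legs occur as p r and p' b, higher-order unification does not find
    the function Phi of an identity; the next three tactics build it by
    abstracting these terms. *)
Ltac proj_step pl pr lem :=
  lazymatch goal with |- @osum ?K ?U ?V ?W ?F ?T = _ =>
    let G := constr:(fun (r__ : U) (b__ : V) => ltac:(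
       let t := eval cbv beta in (F r__ b__) in
       let l := eval cbv beta in (pl r__) in
       let m := eval cbv beta in (pr b__) in
       let t' := eval pattern l, m in t in
       lazymatch t' with ?g _ _ => exact g end)) in
    lazymatch G with fun _ _ => ?Phi =>
      first [ refine (lem _ Phi _); lin | refine (lem _ Phi _ _); lin
            | refine (lem _ Phi _ _ _); lin ] end
  end.

Ltac comulr_step p0 p1 p2 lem :=
  lazymatch goal with
  |- @osum ?K ?U ?V ?W (fun a r => @osum _ ?U' ?V' _ (@?F a r) _) ?T = _ =>
    let G := constr:(fun (a__ : U) (r__ : V) (r1__ : U') (r2__ : V') => ltac:(
       let t := eval cbv beta in (F a__ r__ r1__ r2__) in
       let x := eval cbv beta in (p0 a__) in
       let l := eval cbv beta in (p1 r1__) in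
       let m := eval cbv beta in (p2 r2__) in
       let t' := eval pattern x, l, m in t in
       lazymatch t' with ?g _ _ _ => exact g end)) in
    lazymatch G with fun _ _ _ _ => ?Phi => refine (lem _ Phi _); lin end
  end.

Ltac comull_step p1 p2 p0 lem :=
  lazymatch goal with
  |- @osum ?K ?U ?V ?W (fun r a => @osum _ ?U' ?V' _ (@?F r a) _) ?T = _ =>
    let G := constr:(fun (r__ : U) (a__ : V) (r1__ : U') (r2__ : V') => ltac:(
       let t := eval cbv beta in (F r__ a__ r1__ r2__) in
       let x := eval cbv beta in (p0 a__) in
       let l := eval cbv beta in (p1 r1__) in
       let m := eval cbv beta in (p2 r2__) in
       let t' := eval pattern l, m, x in t in
       lazymatch t' with ?g _ _ _ => exact g end)) in
    lazymatch G with fun _ _ _ _ => ?Phi => refine (lem _ Phi _); lin end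
  end.

Ltac pull_scale k :=
  lazymatch goal with |- ?L = _ =>
    lazymatch L with context [@GRing.scale ?R ?V k ?x] =>
      lazymatch eval pattern (@GRing.scale R V k x) in L with ?F _ =>
        refine (etrans (@is_linearZ _ _ _ F k x _) _); [lin | cbv beta]
      end end end.

Ltac pull_sum t :=
  lazymatch goal with |- ?L = _ =>
    lazymatch L with context [@osum ?K ?U ?V ?W ?f t] =>
      lazymatch eval pattern (@osum K U V W f t) in L with ?F _ =>
        refine (etrans (@linear_osum _ _ _ _ _ F f t _) _); [lin | cbv beta]
      end end end.

(** * Coalgebras and normalized tensors in Sweedler notation *)

Section SweedlerForms.
Variable K : fieldType.
Implicit Types U V W X : lmodType K.

Lemma osum_bind2 U V W U1 V1 U2 V2 (Phi : U -> V -> W)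
    (f : U1 -> V1 -> U2 -> V2 -> U) (g : U1 -> V1 -> U2 -> V2 -> V)
    (t : U1 \ox V1) (s : U1 -> V1 -> U2 \ox V2) :
  bilin Phi ->
  osum Phi (\osum_(x, y <- t) \osum_(z, w <- s x y) (f x y z w \ox g x y z w)) =
  \osum_(x, y <- t) \osum_(z, w <- s x y) Phi (f x y z w) (g x y z w).
Proof.
move=> Phil; do 2 (rewrite osum_bind //; apply: eq_osum => ? ?).
by rewrite osum_tpure.
Qed.

Lemma osum_bind3 U V W X U1 V1 U2 V2 (Phi : U -> V -> W -> X)
    (f : U1 -> V1 -> U2 -> V2 -> U) (g : U1 -> V1 -> U2 -> V2 -> V)
    (h : U1 -> V1 -> U2 -> V2 -> W)
    (t : U1 \ox V1) (s : U1 -> V1 -> U2 \ox V2) :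
  trilin Phi ->
  osum (fun u vw => osum (Phi u) vw)
    (\osum_(x, y <- t) \osum_(z, w <- s x y)
       (f x y z w \ox g x y z w \ox h x y z w)) =
  \osum_(x, y <- t) \osum_(z, w <- s x y)
     Phi (f x y z w) (g x y z w) (h x y z w).
Proof.
move=> Phil; rewrite osum_bind2; last by lin.
by do 2 (apply: eq_osum => ? ?); rewrite osum_tpure //; lin.
Qed.

Lemma coassocE U V (D : U -> U \ox U) (Phi : U -> U -> U -> V) :
  is_linear D ->
  (forall c, \osum_(c1, c2 <- D c) \osum_(d1, d2 <- D c1) (d1 \ox d2 \ox c2)
           = \osum_(c1, c2 <- D c) (c1 \ox D c2)) ->
  trilin Phi -> forall c,
  \osum_(c1, c2 <- D c) \osum_(d1, d2 <- D c1) Phi d1 d2 c2 =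
  \osum_(c1, c2 <- D c) \osum_(d1, d2 <- D c2) Phi c1 d1 d2.
Proof.
move=> Dl DP Phil c.
pose L := osum (fun x t => osum (fun y z => Phi x y z) t).
have Ll : is_linear L by apply: is_linear_osum; lin.
have /(congr1 L) := DP c.
rewrite !(linear_osum (L := L)) // => E.
transitivity (\osum_(c1, c2 <- D c) L (\osum_(d1, d2 <- D c1) d1 \ox d2 \ox c2)).
  apply: eq_osum => c1 c2; rewrite linear_osum //; apply: eq_osum => d1 d2.
  by rewrite /L !osum_tpure //; lin.
by rewrite E; apply: eq_osum => c1 c2; rewrite /L osum_tpure //; lin.
Qed.

Lemma norm_l (U V : algType K) (e : U -> K) (e' : V -> K) (T : U \ox V)
    (V' : lmodType K)
    (f : V -> V') :
  normalized e e' T -> is_linear f -> \osum_(x, y <- T) e x *: f y = f 1.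
Proof.
case=> <- _ fl; rewrite linear_osum //.
by apply: eq_osum => x y; rewrite is_linearZ.
Qed.

Lemma norm_r (U V : algType K) (e : U -> K) (e' : V -> K) (T : U \ox V)
    (V' : lmodType K)
    (f : U -> V') :
  normalized e e' T -> is_linear f -> \osum_(x, y <- T) e' y *: f x = f 1.
Proof.
case=> _ <- fl; rewrite linear_osum //.
by apply: eq_osum => x y; rewrite is_linearZ.
Qed.

End SweedlerForms.

(** * The biproduct bialgebra and its projections *)

Section Smash.
Variables (K : fieldType) (A B : algType K).
Variables (DA : A -> A \ox A) (eA : A -> K) (DB : B -> B \ox B) (eB : B -> K).
Variables (sigma : {linear (B \ox A)%type -> (A \ox B)%type})
          (tau : {linear (A \ox B)%type -> (B \ox A)%type}).
Hypothesis biproduct : is_smash_biproduct_bialgebra DA eA DB eB sigma tau.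
Hypothesis eA_counital : is_counital_algebra eA.
Hypothesis eB_counital : is_counital_algebra eB.
Hypothesis A_unital : is_unital_coalgebra DA eA.
Hypothesis B_unital : is_unital_coalgebra DB eB.
Hypothesis conormal : right_conormal eA sigma.

Local Notation H := (A \ox B)%type.

Definition mul (g h : H) : H := smash_mul sigma g h.
Definition one : H := smash_one A B.
Definition comul (h : H) : H \ox H := smash_comul DA DB tau h.
Definition counit (h : H) : K := smash_counit eA eB h.
(** The coalgebra quotient of H that forgets B; it is not multiplicative in
    general, see [projA_mul]. *)
Definition projA (h : H) : A := \osum_(a, b <- h) (eB b *: a).
Definition projB (h : H) : B := \osum_(a, b <- h) (eA a *: b).
(** The action of H on its quotient A; x \ox 1 lifts x. *)
Definition act (g : H) (x : A) : A := projA (mul g (x \ox 1)).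

Let coalgA : is_coalgebra DA eA. Proof. by case: biproduct. Qed.
Let coalgB : is_coalgebra DB eB. Proof. by case: biproduct. Qed.
Let algH : is_algebra mul one. Proof. by case: biproduct. Qed.
Let coalgH : is_coalgebra comul counit. Proof. by case: biproduct. Qed.

Lemma is_linear_DA : is_linear DA. Proof. by case: coalgA. Qed.
Lemma is_linear_DB : is_linear DB. Proof. by case: coalgB. Qed.
Lemma is_linear_eA : is_linear (eA : A -> K^o). Proof. by case: coalgA. Qed.
Lemma is_linear_eB : is_linear (eB : B -> K^o). Proof. by case: coalgB. Qed.
Lemma is_linear_sigma : is_linear sigma. Proof. exact: linearP. Qed.
Lemma is_linear_tau : is_linear tau. Proof. exact: linearP. Qed.
Lemma is_linear_comul : is_linear comul. Proof. by case: coalgH. Qed.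
Lemma is_linear_counit : is_linear (counit : H -> K^o). Proof. by case: coalgH. Qed.
Lemma bilin_mul : bilin mul. Proof. by case: algH. Qed.

Hint Extern 0 (is_linear _) => exact is_linear_DA : lin.
Hint Extern 0 (is_linear _) => exact is_linear_DB : lin.
Hint Extern 0 (is_linear _) => exact is_linear_eA : lin.
Hint Extern 0 (is_linear _) => exact is_linear_eB : lin.
Hint Extern 0 (is_linear _) => exact is_linear_sigma : lin.
Hint Extern 0 (is_linear _) => exact is_linear_tau : lin.
Hint Extern 0 (is_linear _) => exact is_linear_comul : lin.
Hint Extern 0 (is_linear _) => exact is_linear_counit : lin.
Hint Extern 0 (is_linear _) => exact (proj1 bilin_mul _) : lin.
Hint Extern 0 (is_linear _) => exact (proj2 bilin_mul _) : lin.

Lemma is_linear_projA : is_linear projA.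
Proof. by apply: is_linear_osum; lin. Qed.

Lemma is_linear_projB : is_linear projB.
Proof. by apply: is_linear_osum; lin. Qed.

Hint Extern 0 (is_linear _) => exact is_linear_projA : lin.
Hint Extern 0 (is_linear _) => exact is_linear_projB : lin.

Lemma bilin_act : bilin act.
Proof. by rewrite /act; lin. Qed.

Hint Extern 0 (is_linear _) => exact (proj1 bilin_act _) : lin.
Hint Extern 0 (is_linear _) => exact (proj2 bilin_act _) : lin.

Lemma eAM x y : eA (x * y) = eA x * eA y. Proof. by case: eA_counital. Qed.
Lemma eBM x y : eB (x * y) = eB x * eB y. Proof. by case: eB_counital. Qed.
Lemma eA1 : eA 1 = 1. Proof. by case: eA_counital. Qed.
Lemma eB1 : eB 1 = 1. Proof. by case: eB_counital. Qed.
Lemma DA1 : DA 1 = 1 \ox 1. Proof. by case: A_unital. Qed.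
Lemma DB1 : DB 1 = 1 \ox 1. Proof. by case: B_unital. Qed.

Lemma projA_tpure a b : projA (a \ox b) = eB b *: a.
Proof. by rewrite /projA osum_tpure //; lin. Qed.

Lemma projB_tpure a b : projB (a \ox b) = eA a *: b.
Proof. by rewrite /projB osum_tpure //; lin. Qed.

Lemma mul_tpure a b a' b' :
  mul (a \ox b) (a' \ox b') =
  \osum_(a's, bs <- sigma (b \ox a')) ((a * a's) \ox (bs * b')).
Proof. by rewrite /mul /smash_mul !osum_tpure //; lin. Qed.

Lemma comul_tpure a b :
  comul (a \ox b) =
  \osum_(a1, a2 <- DA a) \osum_(b1, b2 <- DB b)
    \osum_(b1t, a2t <- tau (a2 \ox b1)) ((a1 \ox b1t) \ox (a2t \ox b2)).
Proof. by rewrite /comul /smash_comul osum_tpure //; lin. Qed.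

Lemma osum_comul_tpure (V : lmodType K) (Phi : H -> H -> V) :
  bilin Phi -> forall a b,
  \osum_(h1, h2 <- comul (a \ox b)) Phi h1 h2 =
  \osum_(a1, a2 <- DA a) \osum_(b1, b2 <- DB b)
    \osum_(b1t, a2t <- tau (a2 \ox b1)) Phi (a1 \ox b1t) (a2t \ox b2).
Proof.
move=> Phil a b; rewrite comul_tpure.
do 3 (rewrite osum_bind //; apply: eq_osum => ? ?).
by rewrite osum_tpure.
Qed.

Lemma mulHA f g h : mul f (mul g h) = mul (mul f g) h.
Proof. by case: algH => _ _ /(_ f g h). Qed.
Lemma mul1H h : mul one h = h. Proof. by case: algH. Qed.
Lemma mulH1 h : mul h one = h. Proof. by case: algH. Qed.

Lemma coassocB (V : lmodType K) (Phi : B -> B -> B -> V) : trilin Phi -> forall b,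
  \osum_(b1, b2 <- DB b) \osum_(x, y <- DB b1) Phi x y b2 =
  \osum_(b1, b2 <- DB b) \osum_(x, y <- DB b2) Phi b1 x y.
Proof. by apply: coassocE; case: coalgB. Qed.

Lemma coassocH (V : lmodType K) (Phi : H -> H -> H -> V) : trilin Phi -> forall h,
  \osum_(h1, h2 <- comul h) \osum_(x, y <- comul h1) Phi x y h2 =
  \osum_(h1, h2 <- comul h) \osum_(x, y <- comul h2) Phi h1 x y.
Proof. by apply: coassocE; case: coalgH. Qed.

Lemma counitAl (V : lmodType K) (f : A -> V) : is_linear f -> forall a,
  \osum_(a1, a2 <- DA a) eA a1 *: f a2 = f a.
Proof.
move=> fl a; case: coalgA => _ _ _ E _.
rewrite -[a in RHS]E (linear_osum (L := f)) //; by apply: eq_osum => x y; rewrite is_linearZ.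
Qed.

Lemma counitAr (V : lmodType K) (f : A -> V) : is_linear f -> forall a,
  \osum_(a1, a2 <- DA a) eA a2 *: f a1 = f a.
Proof.
move=> fl a; case: coalgA => _ _ _ _ E.
rewrite -[a in RHS]E (linear_osum (L := f)) //; by apply: eq_osum => x y; rewrite is_linearZ.
Qed.

Lemma counitBl (V : lmodType K) (f : B -> V) : is_linear f -> forall b,
  \osum_(b1, b2 <- DB b) eB b1 *: f b2 = f b.
Proof.
move=> fl b; case: coalgB => _ _ _ E _.
rewrite -[b in RHS]E (linear_osum (L := f)) //; by apply: eq_osum => x y; rewrite is_linearZ.
Qed.

Lemma counitBr (V : lmodType K) (f : B -> V) : is_linear f -> forall b,
  \osum_(b1, b2 <- DB b) eB b2 *: f b1 = f b.
Proof.
move=> fl b; case: coalgB => _ _ _ _ E.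
rewrite -[b in RHS]E (linear_osum (L := f)) //; by apply: eq_osum => x y; rewrite is_linearZ.
Qed.

Lemma sigma_1l a : sigma (1 \ox a) = a \ox 1.
Proof.
rewrite -[RHS]mul1H mul_tpure [LHS]tensor_sum.
by apply: eq_osum => x y; rewrite mul1r mulr1.
Qed.

Lemma sigma_1r b : sigma (b \ox 1) = 1 \ox b.
Proof.
rewrite -[RHS]mulH1 mul_tpure [LHS]tensor_sum.
by apply: eq_osum => x y; rewrite mul1r mulr1.
Qed.

Lemma counit_tpure a b : counit (a \ox b) = eA a * eB b.
Proof.
rewrite /counit /smash_counit (@osum_tpure _ _ _ K^o (fun a b => eA a * eB b)) //.
by lin.
Qed.

Lemma comul_mul (V : lmodType K) (Phi : H -> H -> V) : bilin Phi -> forall g h,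
  \osum_(x, y <- comul (mul g h)) Phi x y =
  \osum_(g1, g2 <- comul g) \osum_(h1, h2 <- comul h) Phi (mul g1 h1) (mul g2 h2).
Proof.
move=> Phil g h.
have -> : comul (mul g h) = tensor_mul mul mul (comul g) (comul h).
  by case: biproduct => _ _ _ _ [_ _ [E _] _]; apply: E.
rewrite /tensor_mul; do 2 (rewrite osum_bind //; apply: eq_osum => ? ?).
by rewrite osum_tpure.
Qed.

Lemma counit_mul g h : counit (mul g h) = counit g * counit h.
Proof. by case: biproduct => _ _ _ _ [_ _ _ [E _]]; apply: E. Qed.

Lemma projA_one : projA one = 1.
Proof. by rewrite projA_tpure eB1 scale1r. Qed.

Lemma projB_one : projB one = 1.
Proof. by rewrite projB_tpure eA1 scale1r. Qed.

Lemma act_tpure a b x :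
  act (a \ox b) x = \osum_(xs, bs <- sigma (b \ox x)) (eB bs *: (a * xs)).
Proof.
rewrite /act mul_tpure linear_osum; last by lin.
by apply: eq_osum => xs bs; rewrite mulr1 projA_tpure.
Qed.

Lemma act_tpure1 a x : act (a \ox 1) x = a * x.
Proof. by rewrite act_tpure sigma_1l osum_tpure ?eB1 ?scale1r //; lin. Qed.

Lemma act_1 g : act g 1 = projA g.
Proof. by rewrite /act -/one mulH1. Qed.

(** The counit of B is multiplicative, so that the factor b' of
    (a \ox b)(a' \ox b') contributes only eB b'.  Hence [projA] is H-linear. *)
Lemma projA_mul g h : projA (mul g h) = act g (projA h).
Proof.
move: h; apply: tensor_ext; [lin|lin|] => a' b'.
move: g; apply: tensor_ext; [lin|lin|] => a b.
rewrite projA_tpure mul_tpure is_linearZ; last by lin.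
rewrite act_tpure (linear_osum (L := projA)); last by lin.
rewrite linear_osum; last by lin.
by apply: eq_osum => xs bs; rewrite projA_tpure eBM scalerA mulrC.
Qed.

Lemma act_one x : act one x = x.
Proof. by rewrite act_tpure1 mul1r. Qed.

Lemma act_mul g h x : act (mul g h) x = act g (act h x).
Proof. by rewrite {1}/act -mulHA projA_mul. Qed.

(** Right conormality enters here: it collapses the sum of
    eA (a * a's) *: (bs * b') over sigma to eA a *: eA a' *: (b * b'). *)
Lemma projB_mul g h : projB (mul g h) = projB g * projB h.
Proof.
move: h; apply: tensor_ext; [lin|lin|] => a' b'.
move: g; apply: tensor_ext; [lin|lin|] => a b.
rewrite !projB_tpure mul_tpure (linear_osum (L := projB)); last by lin.
transitivity (eA a *: ((eA a' *: b) * b')); last by rewrite -!(scalerAl, scalerAr).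
rewrite -(conormal a' b) (linear_osum (L := fun z => eA a *: (z * b'))); last by lin.
by apply: eq_osum => xs bs; rewrite projB_tpure eAM -scalerA scalerAl.
Qed.

Lemma counitHl (V : lmodType K) (f : H -> V) : is_linear f -> forall h,
  \osum_(h1, h2 <- comul h) counit h1 *: f h2 = f h.
Proof.
move=> fl h; case: coalgH => _ _ _ E _.
rewrite -[h in RHS]E (linear_osum (L := f)) //.
by apply: eq_osum => x y; rewrite is_linearZ.
Qed.

Lemma counitHr (V : lmodType K) (f : H -> V) : is_linear f -> forall h,
  \osum_(h1, h2 <- comul h) counit h2 *: f h1 = f h.
Proof.
move=> fl h; case: coalgH => _ _ _ _ E.
rewrite -[h in RHS]E (linear_osum (L := f)) //.
by apply: eq_osum => x y; rewrite is_linearZ.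
Qed.

(** Half of the counit axiom of the smash coproduct, read through [projA].
    With [tau_eA] it makes tau conormal on both sides. *)
Lemma tau_eB (V : lmodType K) (f : A -> V) : is_linear f -> forall a b,
  \osum_(bt, at' <- tau (a \ox b)) eB bt *: f at' = eB b *: f a.
Proof.
move=> fl a b.
transitivity (\osum_(a1, a2 <- DA a) eA a1 *: \osum_(b1, b2 <- DB b)
   eB b2 *: \osum_(bt, at' <- tau (a2 \ox b1)) eB bt *: f at').
  symmetry; refine (etrans _ _); [apply: counitAl; lin | cbv beta].
  by apply: counitBr; lin.
rewrite -[RHS]is_linearZ // -projA_tpure -[RHS](@counitHl _ (fun h => f (projA h))); last by lin.
rewrite osum_comul_tpure; last by lin.
apply: eq_osum => a1 a2; rewrite linear_osum; last by lin.
apply: eq_osum => b1 b2; rewrite !linear_osum; try by lin.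
apply: eq_osum => b1t a2t; rewrite counit_tpure projA_tpure (is_linearZ (f := f)) // !scalerA.
by congr (_ *: _); rewrite -!mulrA [eB b2 * _]mulrC.
Qed.

Lemma tau_eA (V : lmodType K) (f : B -> V) : is_linear f -> forall a b,
  \osum_(bt, at' <- tau (a \ox b)) eA at' *: f bt = eA a *: f b.
Proof.
move=> fl a b.
transitivity (\osum_(a1, a2 <- DA a) eA a1 *: \osum_(b1, b2 <- DB b)
   eB b2 *: \osum_(bt, at' <- tau (a2 \ox b1)) eA at' *: f bt).
  symmetry; refine (etrans _ _); [apply: counitAl; lin | cbv beta].
  by apply: counitBr; lin.
rewrite -[RHS]is_linearZ // -projB_tpure -[RHS](@counitHr _ (fun h => f (projB h))); last by lin.
rewrite osum_comul_tpure; last by lin.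
apply: eq_osum => a1 a2; rewrite linear_osum; last by lin.
apply: eq_osum => b1 b2; rewrite !linear_osum; try by lin.
apply: eq_osum => b1t a2t; rewrite counit_tpure projB_tpure (is_linearZ (f := f)) // !scalerA.
by congr (_ *: _); rewrite [RHS]mulrC [eA a2t * _]mulrC mulrA.
Qed.

(** In projA h1 \ox projA h2 the inner leg that lies in B meets eB, which
    removes tau by [tau_eB]. *)
Lemma comul_projA (V : lmodType K) (Phi : A -> A -> V) : bilin Phi -> forall h,
  \osum_(x, y <- DA (projA h)) Phi x y =
  \osum_(h1, h2 <- comul h) Phi (projA h1) (projA h2).
Proof.
move=> Phil; apply: tensor_ext; [lin|lin|] => a b.
rewrite projA_tpure; pull_scale (eB b); pull_sum (DA a).
rewrite osum_comul_tpure; last by lin.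
apply: eq_osum => a1 a2; symmetry.
transitivity (\osum_(b1, b2 <- DB b) eB b2 *: \osum_(bt, at' <- tau (a2 \ox b1)) eB bt *: Phi a1 at').
  apply: eq_osum => b1 b2; rewrite linear_osum; last by lin.
  apply: eq_osum => bt at'; rewrite !projA_tpure.
  rewrite (is_linearZ (f := Phi _)); last by lin.
  by rewrite (is_linearZ (f := Phi^~ _)); last by lin.
refine (etrans _ _); [apply: counitBr; lin | cbv beta].
by rewrite tau_eB //; lin.
Qed.

Lemma comul_projB (V : lmodType K) (Phi : B -> B -> V) : bilin Phi -> forall h,
  \osum_(x, y <- DB (projB h)) Phi x y =
  \osum_(h1, h2 <- comul h) Phi (projB h1) (projB h2).
Proof.
move=> Phil; apply: tensor_ext; [lin|lin|] => a b.
rewrite projB_tpure; pull_scale (eA a).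
rewrite osum_comul_tpure; last by lin.
symmetry.
transitivity (\osum_(a1, a2 <- DA a) eA a1 *: \osum_(b1, b2 <- DB b) \osum_(bt, at' <- tau (a2 \ox b1)) eA at' *: Phi bt b2).
  apply: eq_osum => a1 a2; rewrite linear_osum; last by lin.
  apply: eq_osum => b1 b2; rewrite linear_osum; last by lin.
  apply: eq_osum => bt at'; rewrite !projB_tpure.
  rewrite (is_linearZ (f := Phi _)); last by lin.
  by rewrite (is_linearZ (f := Phi^~ _)) 1?scalerA 1?mulrC -?scalerA; last by lin.
refine (etrans _ _); [apply: counitAl; lin | cbv beta].
rewrite linear_osum; last by lin.
by apply: eq_osum => b1 b2; rewrite (@tau_eA _ (fun b => Phi b b2)) //; lin.
Qed.

(** The two inner legs, which tau mixes, are exactly those to which the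
    counits are applied.  So every element of H can be rebuilt from A and B. *)
Lemma comul_AB (V : lmodType K) (Phi : A -> B -> V) : bilin Phi -> forall h,
  \osum_(h1, h2 <- comul h) Phi (projA h1) (projB h2) = \osum_(a, b <- h) Phi a b.
Proof.
move=> Phil; apply: tensor_ext; [lin|lin|] => a b.
rewrite osum_tpure // osum_comul_tpure; last by lin.
rewrite -[RHS](@counitBl _ (Phi a)); last by lin.
rewrite exchange_osum; apply: eq_osum => b1 b2.
rewrite -(is_linearZ (f := Phi^~ b2)); last by lin.
rewrite -[RHS](@counitAr _ (fun a => Phi (eB b1 *: a) b2)); last by lin.
apply: eq_osum => a1 a2.
transitivity (\osum_(bt, at' <- tau (a2 \ox b1)) eA at' *: Phi (eB bt *: a1) b2).
  apply: eq_osum => bt at'; rewrite projA_tpure projB_tpure.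
  by rewrite (is_linearZ (f := Phi _)); last by lin.
by rewrite (@tau_eA _ (fun b => Phi (eB b *: a1) b2)) //; lin.
Qed.

Lemma comul_AB_id (V : lmodType K) (f : H -> V) : is_linear f -> forall h,
  \osum_(h1, h2 <- comul h) f (projA h1 \ox projB h2) = f h.
Proof.
move=> fl h; rewrite (@comul_AB _ (fun a b => f (a \ox b))); last by lin.
exact: osum_tensor_id.
Qed.

(** With the projections in the other order the outer legs are killed and
    tau remains.  Read from right to left this trades tau for the coproduct
    of H. *)
Lemma comul_BA (V : lmodType K) (Phi : B -> A -> V) : bilin Phi -> forall h,
  \osum_(h1, h2 <- comul h) Phi (projB h1) (projA h2) = \osum_(b, a <- tau h) Phi b a.
Proof.
move=> Phil; apply: tensor_ext; [lin|lin|] => a b.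
rewrite osum_comul_tpure; last by lin.
transitivity (\osum_(a1, a2 <- DA a) eA a1 *: \osum_(b1, b2 <- DB b) eB b2 *:
   \osum_(bt, at' <- tau (a2 \ox b1)) Phi bt at').
  apply: eq_osum => a1 a2; rewrite linear_osum; last by lin.
  apply: eq_osum => b1 b2; rewrite !linear_osum; try by lin.
  apply: eq_osum => bt at'; rewrite projA_tpure projB_tpure.
  rewrite (is_linearZ (f := Phi _)); last by lin.
  by rewrite (is_linearZ (f := Phi^~ _)) 1?scalerA 1?mulrC -?scalerA; last by lin.
refine (etrans _ _); [apply: counitAl; lin | cbv beta].
by refine (etrans _ _); [apply: counitBr; lin | cbv beta].
Qed.

(** Rebuild the product by [comul_AB] from its coproduct, which is
    multiplicative. *)
Lemma mul_tpure_act g a b :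
  mul g (a \ox b) = \osum_(g1, g2 <- comul g) (act g1 a \ox (projB g2 * b)).
Proof.
rewrite -[LHS]osum_tpure_id -comul_AB; last by lin.
rewrite comul_mul; last by lin.
apply: eq_osum => g1 g2.
transitivity (\osum_(h1, h2 <- comul (a \ox b)) (act g1 (projA h1) \ox (projB g2 * projB h2))).
  by apply: eq_osum => h1 h2; rewrite projA_mul projB_mul.
rewrite (@comul_AB _ (fun x y => act g1 x \ox (projB g2 * y))); last by lin.
by rewrite osum_tpure //; lin.
Qed.

(** b |-> a \ox b is right B-colinear, although the elements 1 \ox b need not
    form a subcoalgebra of H. *)
Lemma comul_tpure_B (V : lmodType K) (Phi : H -> B -> V) : bilin Phi -> forall a b,
  \osum_(h1, h2 <- comul (a \ox b)) Phi h1 (projB h2) =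
  \osum_(b1, b2 <- DB b) Phi (a \ox b1) b2.
Proof.
move=> Phil a b; rewrite osum_comul_tpure; last by lin.
rewrite exchange_osum; apply: eq_osum => b1 b2.
rewrite -[RHS](@counitAr _ (fun a => Phi (a \ox b1) b2)); last by lin.
apply: eq_osum => a1 a2.
rewrite -[RHS](@tau_eA _ (fun b => Phi (a1 \ox b) b2)); last by lin.
apply: eq_osum => bt at'; rewrite projB_tpure.
by rewrite (is_linearZ (f := Phi _)); last by lin.
Qed.

Lemma comul_tpure_A (V : lmodType K) (Phi : A -> H -> V) : bilin Phi -> forall a b,
  \osum_(h1, h2 <- comul (a \ox b)) Phi (projA h1) h2 =
  \osum_(a1, a2 <- DA a) Phi a1 (a2 \ox b).
Proof.
move=> Phil a b; rewrite osum_comul_tpure; last by lin.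
apply: eq_osum => a1 a2.
rewrite -[RHS](@counitBl _ (fun b => Phi a1 (a2 \ox b))); last by lin.
apply: eq_osum => b1 b2.
rewrite -[RHS](@tau_eB _ (fun a => Phi a1 (a \ox b2))); last by lin.
apply: eq_osum => bt at'; rewrite projA_tpure.
by rewrite (is_linearZ (f := Phi^~ _)); last by lin.
Qed.

(** [projA] is H-linear and a coalgebra map, so A is an H-module
    coalgebra. *)
Lemma comul_act (V : lmodType K) (Phi : A -> A -> V) : bilin Phi -> forall g x,
  \osum_(y, z <- DA (act g x)) Phi y z =
  \osum_(g1, g2 <- comul g) \osum_(x1, x2 <- DA x) Phi (act g1 x1) (act g2 x2).
Proof.
move=> Phil g x; rewrite comul_projA // comul_mul; last by lin.
apply: eq_osum => g1 g2.
transitivity (\osum_(h1, h2 <- comul (x \ox 1)) Phi (act g1 (projA h1)) (act g2 (projA h2))).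
  by apply: eq_osum => h1 h2; rewrite !projA_mul.
rewrite -(@comul_projA _ (fun y z => Phi (act g1 y) (act g2 z))); last by lin.
by rewrite projA_tpure eB1 scale1r.
Qed.

(** B inherits the compatibility of product and coproduct from H, of which
    it is a quotient. *)
Lemma comulB_mul (V : lmodType K) (Phi : B -> B -> V) : bilin Phi -> forall b c,
  \osum_(y, z <- DB (b * c)) Phi y z =
  \osum_(b1, b2 <- DB b) \osum_(c1, c2 <- DB c) Phi (b1 * c1) (b2 * c2).
Proof.
move=> Phil b c.
have E x : x = projB (1 \ox x) by rewrite projB_tpure eA1 scale1r.
rewrite {1}[b]E {1}[c]E -projB_mul comul_projB // comul_mul; last by lin.
rewrite [b in RHS]E comul_projB; last by lin.
apply: eq_osum => b1 b2; rewrite [c in RHS]E comul_projB; last by lin.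
by apply: eq_osum => c1 c2; rewrite !projB_mul.
Qed.

(** Rebuilds the second leg from its projections.  By coassociativity the cut
    separates projB of the last leg from everything else. *)
Lemma comul_expand_r (V : lmodType K) (Phi : H -> H -> V) : bilin Phi -> forall h,
  \osum_(h1, h2 <- comul h) Phi h1 h2 =
  \osum_(h1, h2 <- comul h) \osum_(x, y <- comul h1) Phi x (projA y \ox projB h2).
Proof.
move=> Phil h; rewrite (@coassocH _ (fun x y z => Phi x (projA y \ox projB z))); last by lin.
by apply: eq_osum => h1 h2; rewrite (@comul_AB_id _ (Phi h1)) //; lin.
Qed.

(** Rebuilds the first leg; now projA of the first leg is set apart. *)
Lemma comul_expand_l (V : lmodType K) (Phi : H -> H -> V) : bilin Phi -> forall h,
  \osum_(h1, h2 <- comul h) Phi h1 h2 =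
  \osum_(h1, h2 <- comul h) \osum_(x, y <- comul h2) Phi (projA h1 \ox projB x) y.
Proof.
move=> Phil h; rewrite -(@coassocH _ (fun x y z => Phi (projA x \ox projB y) z)); last by lin.
by apply: eq_osum => h1 h2; rewrite (@comul_AB_id _ (Phi^~ h2)) //; lin.
Qed.

Lemma tau_mul (V : lmodType K) (Phi : B -> A -> V) : bilin Phi -> forall g h,
  \osum_(b, a <- tau (mul g h)) Phi b a =
  \osum_(g1, g2 <- comul g) \osum_(b, a <- tau h) Phi (projB g1 * b) (act g2 a).
Proof.
move=> Phil g h; rewrite -comul_BA // comul_mul; last by lin.
apply: eq_osum => g1 g2; rewrite -(@comul_BA _ (fun b a => Phi (projB g1 * b) (act g2 a))); last by lin.
by apply: eq_osum => h1 h2; rewrite projA_mul projB_mul.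
Qed.

Lemma mul_tpure_1l a b b' : mul (a \ox b) (1 \ox b') = a \ox (b * b').
Proof. by rewrite mul_tpure sigma_1r osum_tpure ?mulr1 //; lin. Qed.

Lemma mul_tpure_1r a a' b : mul (a \ox 1) (a' \ox b) = (a * a') \ox b.
Proof. by rewrite mul_tpure sigma_1l osum_tpure ?mul1r //; lin. Qed.

Lemma comul_tpure_BH (V : lmodType K) (Phi : B -> H -> V) : bilin Phi -> forall a b,
  \osum_(h1, h2 <- comul (a \ox b)) Phi (projB h1) h2 =
  \osum_(b1, b2 <- DB b) \osum_(bt, at' <- tau (a \ox b1)) Phi bt (at' \ox b2).
Proof.
move=> Phil a b; rewrite osum_comul_tpure; last by lin.
rewrite exchange_osum; apply: eq_osum => b1 b2.
rewrite -[RHS](@counitAl _ (fun a => \osum_(bt, at' <- tau (a \ox b1)) Phi bt (at' \ox b2))); last by lin.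
apply: eq_osum => a1 a2; rewrite linear_osum; last by lin.
apply: eq_osum => bt at'; rewrite projB_tpure.
by rewrite (is_linearZ (f := Phi^~ _)); last by lin.
Qed.

(** Since sigma (b \ox a) is the product of 1 \ox b and a \ox 1, it is the
    commutation rule of an ordinary smash product by the module algebra A. *)
Lemma sigma_act (V : lmodType K) (Phi : A -> B -> V) : bilin Phi -> forall a b,
  \osum_(a', b' <- sigma (b \ox a)) Phi a' b' =
  \osum_(b1, b2 <- DB b) Phi (act (1 \ox b1) a) b2.
Proof.
move=> Phil a b.
have -> : sigma (b \ox a) = mul (1 \ox b) (a \ox 1).
  rewrite mul_tpure [LHS]tensor_sum; apply: eq_osum => x y.
  by rewrite mul1r mulr1.
rewrite mul_tpure_act osum_bind //.
transitivity (\osum_(h1, h2 <- comul (1 \ox b)) Phi (act h1 a) (projB h2)).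
  by apply: eq_osum => x y; rewrite osum_tpure // mulr1.
by rewrite (@comul_tpure_B _ (fun h b => Phi (act h a) b)) //; lin.
Qed.

Lemma mul_expand (V : lmodType K) (f : H -> V) : is_linear f -> forall g h,
  f (mul g h) = \osum_(g1, g2 <- comul g) \osum_(h1, h2 <- comul h)
     f (act g1 (projA h1) \ox (projB g2 * projB h2)).
Proof.
move=> fl g h; rewrite -[LHS](comul_AB_id fl) comul_mul; last by lin.
apply: eq_osum => g1 g2; apply: eq_osum => h1 h2.
by rewrite projA_mul projB_mul.
Qed.

Local Opaque mul comul counit projA projB act one.

Ltac sw_assoc ::= first [reflexivity | rewrite -?act_mul ?mulrA ?mulHA; reflexivity].

(** Expands a product with a pure tensor on the right by [mul_tpure_act]. *)
Ltac expand_mul :=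
  lazymatch goal with |- ?L = _ =>
    lazymatch L with context [mul ?g (?a \ox ?b)] =>
      rewrite (mul_tpure_act g a b); pull_sum (comul g); reflexivity end end.

Ltac sw_mul := sweedler ltac:(idtac; expand_mul) ltac:(sw_assoc).

Ltac sw_proj pl pr lem := sweedler ltac:(idtac; proj_step pl pr lem) ltac:(sw_assoc).
Ltac sw_comulr p0 p1 p2 lem := sweedler ltac:(idtac; comulr_step p0 p1 p2 lem) ltac:(sw_assoc).
Ltac sw_comull p1 p2 p0 lem := sweedler ltac:(idtac; comull_step p1 p2 p0 lem) ltac:(sw_assoc).
Ltac sw_tpure_B := sw_proj (fun h : H => h) projB @comul_tpure_B.
Ltac sw_tpure_A := sw_proj projA (fun h : H => h) @comul_tpure_A.
Ltac sw_BA := sw_proj projB projA @comul_BA.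

(** Expands an arbitrary product by [mul_expand]. *)
Ltac expand_full :=
  lazymatch goal with |- ?L = _ =>
    lazymatch L with context [mul ?g ?h] =>
      lazymatch eval pattern (mul g h) in L with ?F _ =>
        refine (@mul_expand _ F _ g h); lin end end end.
Ltac sw_full := sweedler ltac:(idtac; expand_full) ltac:(sw_assoc).

Lemma generators_ind (V : lmodType K) (E F : H -> V) :
  is_linear E -> is_linear F -> (forall a b, E (mul (a \ox 1) (1 \ox b)) = F (mul (a \ox 1) (1 \ox b))) ->
  forall h, E h = F h.
Proof.
move=> El Fl EF; apply: tensor_ext => // a b.
by have := EF a b; rewrite mul_tpure_1l mul1r.
Qed.

Lemma eA_projA h : eA (projA h) = counit h.
Proof.
move: h; apply: (@tensor_ext _ _ _ K^o (fun h => eA (projA h))); [lin|lin|] => a b.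
rewrite projA_tpure counit_tpure mulrC.
by rewrite (is_linearZ (f := eA : A -> K^o)) //; lin.
Qed.

Lemma eB_projB h : eB (projB h) = counit h.
Proof.
move: h; apply: (@tensor_ext _ _ _ K^o (fun h => eB (projB h))); [lin|lin|] => a b.
rewrite projB_tpure counit_tpure.
by rewrite (is_linearZ (f := eB : B -> K^o)) //; lin.
Qed.

Lemma eA_act g x : eA (act g x) = counit g * eA x.
Proof.
by rewrite -[x in LHS](_ : projA (x \ox 1) = _) -?projA_mul ?eA_projA ?counit_mul ?counit_tpure
   ?projA_tpure ?eB1 ?scale1r ?mulr1.
Qed.

(** * Quasitriangular structures as Sweedler identities *)

Let mul2 := tensor_mul mul mul.
Let mul3 := tensor_mul mul mul2.

Let bilin_mul2 : bilin mul2. Proof. exact: bilin_tensor_mul bilin_mul bilin_mul. Qed.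
Let bilin_mul3 : bilin mul3. Proof. exact: bilin_tensor_mul bilin_mul bilin_mul2. Qed.
Let mul2E a b c d : mul2 (a \ox b) (c \ox d) = mul a c \ox mul b d.
Proof. exact: tensor_mul_tpure bilin_mul bilin_mul. Qed.
Let mul3E a b c d : mul3 (a \ox b) (c \ox d) = mul a c \ox mul2 b d.
Proof. exact: tensor_mul_tpure bilin_mul bilin_mul2. Qed.

Definition quasitriangular_sums (R : H \ox H) : Prop :=
  [/\ \osum_(r, s <- R) (counit r *: s) = one /\ \osum_(r, s <- R) (counit s *: r) = one,
      \osum_(r, s <- R) \osum_(r1, r2 <- comul r) (r1 \ox r2 \ox s) =
      \osum_(r, s <- R) \osum_(r', s' <- R) (r \ox r' \ox mul s s'),
      \osum_(r, s <- R) \osum_(s1, s2 <- comul s) (r \ox s1 \ox s2) =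
      \osum_(r, s <- R) \osum_(r', s' <- R) (mul r r' \ox s' \ox s)
    & forall h,
      \osum_(r, s <- R) \osum_(h1, h2 <- comul h) (mul r h1 \ox mul s h2) =
      \osum_(h1, h2 <- comul h) \osum_(r, s <- R) (mul h2 r \ox mul h1 s)].

(** Computes the products of H \ox H and H \ox H \ox H leg by leg. *)
Lemma quasitriangularE (R : H \ox H) :
  is_smash_quasitriangular DA eA DB eB sigma tau R <-> quasitriangular_sums R.
Proof.
rewrite /is_smash_quasitriangular /is_quasitriangular /quasitriangular_sums.
rewrite -/mul -/comul -/counit -/one -/mul2 -/mul3.
have E1 : mul3 (\osum_(r1, r2 <- R) (r1 \ox one \ox r2)) (\osum_(r1, r2 <- R) (one \ox r1 \ox r2))
  = \osum_(r, s <- R) \osum_(r', s' <- R) (r \ox r' \ox mul s s').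
  rewrite bilin_osum //; apply: eq_osum => r s; apply: eq_osum => r' s'.
  by rewrite mul3E mul2E !mul1H !mulH1.
have E2 : mul3 (\osum_(r1, r2 <- R) (r1 \ox one \ox r2)) (\osum_(r1, r2 <- R) (r1 \ox r2 \ox one))
  = \osum_(r, s <- R) \osum_(r', s' <- R) (mul r r' \ox s' \ox s).
  rewrite bilin_osum //; apply: eq_osum => r s; apply: eq_osum => r' s'.
  by rewrite mul3E mul2E !mul1H !mulH1.
have E3 : \osum_(r, s <- R) (r \ox comul s) = \osum_(r, s <- R) \osum_(s1, s2 <- comul s) (r \ox s1 \ox s2).
  apply: eq_osum => r s.
  by rewrite -[in LHS](osum_tpure_id (comul s)) linear_osum //; apply: is_linear_tpure_r.
have E4 h : mul2 R (comul h) = \osum_(r, s <- R) \osum_(h1, h2 <- comul h) (mul r h1 \ox mul s h2).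
  rewrite -[in LHS](osum_tpure_id (comul h)) -[in LHS](osum_tpure_id R) bilin_osum //.
  by apply: eq_osum => r s; apply: eq_osum => h1 h2; rewrite mul2E.
have E5 h : mul2 (\osum_(h1, h2 <- comul h) (h2 \ox h1)) R =
   \osum_(h1, h2 <- comul h) \osum_(r, s <- R) (mul h2 r \ox mul h1 s).
  rewrite -[in LHS](osum_tpure_id R) bilin_osum //.
  by apply: eq_osum => r s; apply: eq_osum => h1 h2; rewrite mul2E.
rewrite E1 E2 E3; split=> -[n1 n2 n3 n4]; split=> // h; first by rewrite -E4 n4 E5.
by rewrite E4 n4 -E5.
Qed.

(** * Rebuilding a quasitriangular structure from its four components *)

Section Components.
Variables (W : B \ox B) (X : A \ox B) (Y : B \ox A) (Z : A \ox A).

(** The letters of the next five names say where the two legs live, R standing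
    for H.  If W, X, Y, Z are the components of a quasitriangular structure R,
    these elements are the images of R in H \ox B, B \ox H, A \ox H, H \ox A and
    R itself, see [osum_RB_R] to [osum_RR_R]; the formulas come from splitting
    the leg in H as projA \ox projB and applying a coproduct axiom. *)
Definition RB : H \ox B :=
  \osum_(x, y <- X) \osum_(v, w <- W) ((x \ox v) \ox (y * w)).

Definition BR : B \ox H :=
  \osum_(v, w <- W) \osum_(y, x <- Y) ((v * y) \ox (x \ox w)).

Definition AR : A \ox H :=
  \osum_(r, b <- RB) \osum_(z, z' <- Z) (act r z \ox (z' \ox b)).

Definition RA : H \ox A :=
  \osum_(a, r <- AR) \osum_(y, x <- Y) ((a \ox y) \ox act r x).

Definition RR : H \ox H :=
  \osum_(r, b <- RB) \osum_(s, a <- RA) (mul r s \ox (a \ox b)).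

Lemma osum_RB (V : lmodType K) (Phi : H -> B -> V) : bilin Phi ->
  \osum_(r, b <- RB) Phi r b = \osum_(x, y <- X) \osum_(v, w <- W) Phi (x \ox v) (y * w).
Proof.
move=> Phil; rewrite /RB; do 2 (rewrite osum_bind //; apply: eq_osum => ? ?).
by rewrite osum_tpure.
Qed.

Lemma osum_BR (V : lmodType K) (Phi : B -> H -> V) : bilin Phi ->
  \osum_(b, r <- BR) Phi b r = \osum_(v, w <- W) \osum_(y, x <- Y) Phi (v * y) (x \ox w).
Proof.
move=> Phil; rewrite /BR; do 2 (rewrite osum_bind //; apply: eq_osum => ? ?).
by rewrite osum_tpure.
Qed.

Lemma osum_AR (V : lmodType K) (Phi : A -> H -> V) : bilin Phi ->
  \osum_(a, r <- AR) Phi a r =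
  \osum_(r, b <- RB) \osum_(z, z' <- Z) Phi (act r z) (z' \ox b).
Proof.
move=> Phil; rewrite /AR; do 2 (rewrite osum_bind //; apply: eq_osum => ? ?).
by rewrite osum_tpure.
Qed.

Lemma osum_RA (V : lmodType K) (Phi : H -> A -> V) : bilin Phi ->
  \osum_(r, a <- RA) Phi r a =
  \osum_(a, r <- AR) \osum_(y, x <- Y) Phi (a \ox y) (act r x).
Proof.
move=> Phil; rewrite /RA; do 2 (rewrite osum_bind //; apply: eq_osum => ? ?).
by rewrite osum_tpure.
Qed.

Lemma osum_RR (V : lmodType K) (Phi : H -> H -> V) : bilin Phi ->
  \osum_(r, s <- RR) Phi r s =
  \osum_(r, b <- RB) \osum_(s, a <- RA) Phi (mul r s) (a \ox b).
Proof.
move=> Phil; rewrite /RR; do 2 (rewrite osum_bind //; apply: eq_osum => ? ?).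
by rewrite osum_tpure.
Qed.

(** The images of the two coproduct axioms, one for each choice of [projA] or
    [projB] on the three legs.  When the leg that is split is sent first to B and
    then to A, its coproduct becomes tau by [comul_BA]. *)
Record comul_components : Prop := ComulComponents {
  comulX_l : forall (V : lmodType K) (Phi : A -> A -> B -> V), trilin Phi ->
    \osum_(x, y <- X) \osum_(x1, x2 <- DA x) Phi x1 x2 y =
    \osum_(x, y <- X) \osum_(x', y' <- X) Phi x x' (y * y');
  comulW_l : forall (V : lmodType K) (Phi : B -> B -> B -> V), trilin Phi ->
    \osum_(x, y <- W) \osum_(x1, x2 <- DB x) Phi x1 x2 y =
    \osum_(x, y <- W) \osum_(x', y' <- W) Phi x x' (y * y');
  tauXW : forall (V : lmodType K) (Phi : B -> A -> B -> V), trilin Phi ->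
    \osum_(x, y <- X) \osum_(v, w <- W) \osum_(vt, xt <- tau (x \ox v)) Phi vt xt (y * w) =
    \osum_(v, w <- W) \osum_(x, y <- X) Phi v x (w * y);
  comulZ_l : forall (V : lmodType K) (Phi : A -> A -> A -> V), trilin Phi ->
    \osum_(x, y <- Z) \osum_(x1, x2 <- DA x) Phi x1 x2 y =
    \osum_(a, r <- AR) \osum_(x, y <- Z) Phi a x (act r y);
  comulY_l : forall (V : lmodType K) (Phi : B -> B -> A -> V), trilin Phi ->
    \osum_(x, y <- Y) \osum_(x1, x2 <- DB x) Phi x1 x2 y =
    \osum_(b, r <- BR) \osum_(x, y <- Y) Phi b x (act r y);
  tauRA : forall (V : lmodType K) (Phi : B -> A -> A -> V), trilin Phi ->
    \osum_(r, a <- RA) \osum_(b, x <- tau r) Phi b x a =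
    \osum_(b, r <- BR) \osum_(x, y <- Z) Phi b x (act r y);
  comulX_r : forall (V : lmodType K) (Phi : A -> B -> B -> V), trilin Phi ->
    \osum_(x, y <- X) \osum_(y1, y2 <- DB y) Phi x y1 y2 =
    \osum_(r, b <- RB) \osum_(x, y <- X) Phi (act r x) y b;
  comulW_r : forall (V : lmodType K) (Phi : B -> B -> B -> V), trilin Phi ->
    \osum_(x, y <- W) \osum_(y1, y2 <- DB y) Phi x y1 y2 =
    \osum_(x, y <- W) \osum_(x', y' <- W) Phi (x * x') y' y;
  tauBR : forall (V : lmodType K) (Phi : B -> B -> A -> V), trilin Phi ->
    \osum_(v, w <- W) \osum_(y, x <- Y) \osum_(wt, xt <- tau (x \ox w)) Phi (v * y) wt xt =
    \osum_(y, x <- Y) \osum_(v, w <- W) Phi (y * v) w x;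
  comulZ_r : forall (V : lmodType K) (Phi : A -> A -> A -> V), trilin Phi ->
    \osum_(x, y <- Z) \osum_(y1, y2 <- DA y) Phi x y1 y2 =
    \osum_(r, a <- RA) \osum_(x, y <- Z) Phi (act r x) y a;
  comulY_r : forall (V : lmodType K) (Phi : B -> A -> A -> V), trilin Phi ->
    \osum_(x, y <- Y) \osum_(y1, y2 <- DA y) Phi x y1 y2 =
    \osum_(x, y <- Y) \osum_(x', y' <- Y) Phi (x * x') y' y;
  tauAR : forall (V : lmodType K) (Phi : A -> B -> A -> V), trilin Phi ->
    \osum_(a, r <- AR) \osum_(b, x <- tau r) Phi a b x =
    \osum_(r, a <- RA) \osum_(x, y <- X) Phi (act r x) y a
}.

Hypothesis normW : normalized eB eB W.
Hypothesis normX : normalized eA eB X.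
Hypothesis normY : normalized eB eA Y.
Hypothesis normZ : normalized eA eA Z.
Hypothesis comps : comul_components.

(** The coproduct of x \ox v puts tau between a leg of x and a leg of v.  Once
    the identities for X and W have doubled both tensors, [tauXW] removes tau and
    leaves two copies of RB side by side. *)
Lemma comul_RB_l (V : lmodType K) (Phi : H -> H -> B -> V) : trilin Phi ->
  \osum_(r, b <- RB) \osum_(r1, r2 <- comul r) Phi r1 r2 b =
  \osum_(r, b <- RB) \osum_(r', b' <- RB) Phi r r' (b * b').
Proof.
move=> Phil; rewrite osum_RB; last by lin.
transitivity (\osum_(x, y <- X) \osum_(x1, x2 <- DA x) \osum_(v, w <- W) \osum_(v1, v2 <- DB v)
    \osum_(v1t, x2t <- tau (x2 \ox v1)) Phi (x1 \ox v1t) (x2t \ox v2) (y * w)).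
  by sw osum_comul_tpure.
transitivity (\osum_(v, w <- W) \osum_(v1, v2 <- DB v) \osum_(x, y <- X) \osum_(x', y' <- X)
    \osum_(v1t, x2t <- tau (x' \ox v1)) Phi (x \ox v1t) (x2t \ox v2) (y * y' * w)).
  by sw (comulX_l comps).
transitivity (\osum_(x, y <- X) \osum_(v', w' <- W)  \osum_(x', y' <- X) \osum_(v, w <- W)
    \osum_(v1t, x2t <- tau (x' \ox v)) Phi (x \ox v1t) (x2t \ox v') (y * (y' * w) * w')).
  by sw (comulW_l comps).
transitivity (\osum_(x, y <- X) \osum_(v, w <- W) \osum_(x', y' <- X) \osum_(v', w' <- W)
     Phi (x \ox v) (x' \ox v') (y * w * (y' * w'))).
  transitivity (\osum_(x, y <- X) \osum_(v', w' <- W) \osum_(v, w <- W) \osum_(x', y' <- X)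
     Phi (x \ox v) (x' \ox v') (y * (w * y') * w')); last by reorder sw_assoc.
  apply: eq_osum => x y; apply: eq_osum => v' w'.
  by rewrite -(tauXW comps (Phi := fun b a c => Phi (x \ox b) (a \ox v') (y * c * w'))) //; lin.
rewrite osum_RB; last by lin.
by symmetry; sw osum_RB.
Qed.

(** X disappears because it is normalized, and W is left. *)
Lemma RB_projB (V : lmodType K) (Phi : B -> B -> V) : bilin Phi ->
  \osum_(r, b <- RB) Phi (projB r) b = \osum_(v, w <- W) Phi v w.
Proof.
move=> Phil; rewrite osum_RB; last by lin.
rewrite exchange_osum; apply: eq_osum => v w.
rewrite -[w in RHS]mul1r -[RHS](@norm_l _ _ _ _ _ _ _ (fun y => Phi v (y * w)) normX); last by lin.
by apply: eq_osum => x y; rewrite projB_tpure; pull_scale (eA x).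
Qed.

(** The product of H on the right-hand side is unfolded with
    [mul_tpure_act], where [comul_RB_l] computes the coproduct that it contains. *)
Lemma comul_RB_r (V : lmodType K) (Phi : H -> B -> B -> V) : trilin Phi ->
  \osum_(r, b <- RB) \osum_(b1, b2 <- DB b) Phi r b1 b2 =
  \osum_(r, b <- RB) \osum_(r', b' <- RB) Phi (mul r r') b' b.
Proof.
move=> Phil; rewrite osum_RB; last by lin.
transitivity (\osum_(x, y <- X) \osum_(y1, y2 <- DB y) \osum_(v, w <- W) \osum_(w1, w2 <- DB w)
   Phi (x \ox v) (y1 * w1) (y2 * w2)).
  by sw comulB_mul.
transitivity (\osum_(r, b <- RB) \osum_(x, y <- X) \osum_(v, w <- W) \osum_(w1, w2 <- DB w)
   Phi (act r x \ox v) (y * w1) (b * w2)).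
  by sw (comulX_r comps).
transitivity (\osum_(r, b <- RB) \osum_(x, y <- X) \osum_(v, w <- W) \osum_(v', w' <- W)
   Phi (act r x \ox (v * v')) (y * w') (b * w)).
  by sw (comulW_r comps).
symmetry.
transitivity (\osum_(r, b <- RB) \osum_(x, y <- X) \osum_(v, w <- W) Phi (mul r (x \ox v)) (y * w) b).
  by sw osum_RB.
transitivity (\osum_(r, b <- RB) \osum_(r1, r2 <- comul r) \osum_(x, y <- X) \osum_(v, w <- W)
   Phi (act r1 x \ox projB r2 * v) (y * w) b).
  by sw_mul.
transitivity (\osum_(r, b <- RB) \osum_(r', b' <- RB) \osum_(x, y <- X) \osum_(v, w <- W)
   Phi (act r x \ox projB r' * v) (y * w) (b * b')).
  by sw comul_RB_l.
by sweedler ltac:(idtac; proj_step projB (fun b : B => b) @RB_projB) ltac:(sw_assoc).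
Qed.

(** * The two coproduct axioms *)

Ltac sw_RB_projB := sw_proj projB (fun b : B => b) @RB_projB.

(** Of the second leg x \ox w only w is split, so the identity for W
    suffices. *)
Lemma BR_comul_B (V : lmodType K) (Phi : B -> H -> B -> V) : trilin Phi ->
  \osum_(b, r <- BR) \osum_(r1, r2 <- comul r) Phi b r1 (projB r2) =
  \osum_(v, w <- W) \osum_(b, r <- BR) Phi (v * b) r w.
Proof.
move=> Phil; rewrite osum_BR; last by lin.
transitivity (\osum_(v, w <- W) \osum_(w1, w2 <- DB w) \osum_(y, x <- Y) Phi (v * y) (x \ox w1) w2).
  by sw_tpure_B.
transitivity (\osum_(v, w <- W) \osum_(v', w' <- W) \osum_(y, x <- Y) Phi (v * v' * y) (x \ox w') w).
  by sw (comulW_r comps).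
by symmetry; sw osum_BR.
Qed.

Ltac sw_BR_comul_B := sw_comulr (fun b : B => b) (fun h : H => h) projB @BR_comul_B.

Lemma comul_BR_l (V : lmodType K) (Phi : B -> B -> H -> V) : trilin Phi ->
  \osum_(b, r <- BR) \osum_(b1, b2 <- DB b) Phi b1 b2 r =
  \osum_(b, r <- BR) \osum_(b', r' <- BR) Phi b b' (mul r r').
Proof.
move=> Phil; rewrite osum_BR; last by lin.
transitivity (\osum_(v, w <- W) \osum_(v1, v2 <- DB v) \osum_(y, x <- Y) \osum_(y1, y2 <- DB y)
    Phi (v1 * y1) (v2 * y2) (x \ox w)).
  by sw comulB_mul.
transitivity (\osum_(v, w <- W) \osum_(v', w' <- W) \osum_(y, x <- Y) \osum_(y1, y2 <- DB y)
    Phi (v * y1) (v' * y2) (x \ox w * w')).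
  by sw (comulW_l comps).
transitivity (\osum_(v, w <- W) \osum_(v', w' <- W) \osum_(b, r <- BR) \osum_(y, x <- Y)
    Phi (v * b) (v' * y) (act r x \ox w * w')).
  by sw (comulY_l comps).
symmetry.
transitivity (\osum_(b, r <- BR) \osum_(v, w <- W) \osum_(y, x <- Y)
    Phi b (v * y) (mul r (x \ox w))).
  by sw osum_BR.
transitivity (\osum_(b, r <- BR) \osum_(r1, r2 <- comul r) \osum_(v, w <- W) \osum_(y, x <- Y)
    Phi b (v * y) (act r1 x \ox projB r2 * w)).
  by sw_mul.
by sw_BR_comul_B.
Qed.

Lemma AR_comul_B (V : lmodType K) (Phi : A -> H -> B -> V) : trilin Phi ->
  \osum_(a, r <- AR) \osum_(r1, r2 <- comul r) Phi a r1 (projB r2) =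
  \osum_(r, b <- RB) \osum_(a, s <- AR) Phi (act r a) s b.
Proof.
move=> Phil; rewrite osum_AR; last by lin.
transitivity (\osum_(r, b <- RB) \osum_(b1, b2 <- DB b) \osum_(z, z' <- Z) Phi (act r z) (z' \ox b1) b2).
  by sw_tpure_B.
transitivity (\osum_(r, b <- RB) \osum_(r', b' <- RB) \osum_(z, z' <- Z) Phi (act (mul r r') z) (z' \ox b') b).
  by sw comul_RB_r.
by symmetry; sw osum_AR.
Qed.

Ltac sw_AR_comul_B := sw_comulr (fun a : A => a) (fun h : H => h) projB @AR_comul_B.

(** A is an H-module coalgebra, so the coproduct of act r z splits r and z; the
    former is [comul_RB_l], the latter the identity for Z. *)
Lemma comul_AR_l (V : lmodType K) (Phi : A -> A -> H -> V) : trilin Phi ->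
  \osum_(a, r <- AR) \osum_(a1, a2 <- DA a) Phi a1 a2 r =
  \osum_(a, r <- AR) \osum_(a', r' <- AR) Phi a a' (mul r r').
Proof.
move=> Phil; rewrite osum_AR; last by lin.
transitivity (\osum_(r, b <- RB) \osum_(r1, r2 <- comul r) \osum_(z, z' <- Z) \osum_(z1, z2 <- DA z)
    Phi (act r1 z1) (act r2 z2) (z' \ox b)).
  by sw comul_act.
transitivity (\osum_(r, b <- RB) \osum_(r', b' <- RB) \osum_(z, z' <- Z) \osum_(z1, z2 <- DA z)
    Phi (act r z1) (act r' z2) (z' \ox b * b')).
  by sw comul_RB_l.
transitivity (\osum_(r, b <- RB) \osum_(r', b' <- RB) \osum_(a, s <- AR) \osum_(z, z' <- Z)
    Phi (act r a) (act r' z) (act s z' \ox b * b')).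
  by sw (comulZ_l comps).
symmetry.
transitivity (\osum_(a, s <- AR) \osum_(r, b <- RB) \osum_(z, z' <- Z) Phi a (act r z) (mul s (z' \ox b))).
  by sw osum_AR.
transitivity (\osum_(a, s <- AR) \osum_(s1, s2 <- comul s) \osum_(r, b <- RB) \osum_(z, z' <- Z)
    Phi a (act r z) (act s1 z' \ox projB s2 * b)).
  by sw_mul.
by sw_AR_comul_B.
Qed.

(** All factors of RR sorted by the four legs A, B, A, B. *)
Lemma osum_RR_split (V : lmodType K) (Phi : H -> H -> V) : bilin Phi ->
  \osum_(r, s <- RR) Phi r s =
  \osum_(r, b <- RB) \osum_(v, w <- W) \osum_(a, s <- AR) \osum_(y, x <- Y)
    Phi (act r a \ox v * y) (act s x \ox b * w).
Proof.
move=> Phil; rewrite osum_RR; last by lin.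
transitivity (\osum_(r, b <- RB) \osum_(a, s <- AR) \osum_(y, x <- Y) Phi (mul r (a \ox y)) (act s x \ox b)).
  by sw osum_RA.
transitivity (\osum_(r, b <- RB) \osum_(r1, r2 <- comul r) \osum_(a, s <- AR) \osum_(y, x <- Y)
    Phi (act r1 a \ox projB r2 * y) (act s x \ox b)).
  by sw_mul.
transitivity (\osum_(r, b <- RB) \osum_(r', b' <- RB) \osum_(a, s <- AR) \osum_(y, x <- Y)
    Phi (act r a \ox projB r' * y) (act s x \ox b * b')).
  by sw comul_RB_l.
by sw_RB_projB.
Qed.

(** A second description of RR.  The definition splits the second leg into its
    parts in A and B, this one splits the first leg, and each is suited to the
    coproduct axiom of the leg that it splits. *)
Lemma osum_RR_AR_BR (V : lmodType K) (Phi : H -> H -> V) : bilin Phi ->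
  \osum_(r, s <- RR) Phi r s = \osum_(a, r <- AR) \osum_(b, s <- BR) Phi (a \ox b) (mul r s).
Proof.
move=> Phil; rewrite osum_RR_split //.
symmetry.
transitivity (\osum_(a, s <- AR) \osum_(v, w <- W) \osum_(y, x <- Y) Phi (a \ox v * y) (mul s (x \ox w))).
  by sw osum_BR.
transitivity (\osum_(a, s <- AR) \osum_(s1, s2 <- comul s) \osum_(v, w <- W) \osum_(y, x <- Y)
    Phi (a \ox v * y) (act s1 x \ox projB s2 * w)).
  by sw_mul.
by sw_AR_comul_B.
Qed.

(** The first coproduct axiom with the first two legs in B and A: the coproduct
    turns into tau, which exchanges the order of AR and BR. *)
Lemma tau_RR (V : lmodType K) (Phi : B -> A -> H -> V) : trilin Phi ->
  \osum_(r, s <- RR) \osum_(b, a <- tau r) Phi b a s =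
  \osum_(a, r <- AR) \osum_(b, s <- BR) Phi b a (mul s r).
Proof.
move=> Phil; rewrite osum_RR; last by lin.
transitivity (\osum_(r, b <- RB) \osum_(r1, r2 <- comul r) \osum_(s, a <- RA) \osum_(y, x <- tau s)
    Phi (projB r1 * y) (act r2 x) (a \ox b)).
  by sw tau_mul.
transitivity (\osum_(r, b <- RB) \osum_(r', b' <- RB) \osum_(s, a <- RA) \osum_(y, x <- tau s)
    Phi (projB r * y) (act r' x) (a \ox b * b')).
  by sw comul_RB_l.
transitivity (\osum_(r, b <- RB) \osum_(r', b' <- RB) \osum_(c, s <- BR) \osum_(z, z' <- Z)
    Phi (projB r * c) (act r' z) (act s z' \ox b * b')).
  by sw (tauRA comps).
transitivity (\osum_(v, w <- W) \osum_(r', b' <- RB) \osum_(c, s <- BR) \osum_(z, z' <- Z)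
    Phi (v * c) (act r' z) (act s z' \ox w * b')).
  by sw_RB_projB.
symmetry.
transitivity (\osum_(c, s <- BR) \osum_(r, b <- RB) \osum_(z, z' <- Z) Phi c (act r z) (mul s (z' \ox b))).
  by sw osum_AR.
transitivity (\osum_(c, s <- BR) \osum_(s1, s2 <- comul s) \osum_(r, b <- RB) \osum_(z, z' <- Z)
    Phi c (act r z) (act s1 z' \ox projB s2 * b)).
  by sw_mul.
by sw_BR_comul_B.
Qed.

Lemma comul_RR_l (V : lmodType K) (Phi : H -> H -> H -> V) : trilin Phi ->
  \osum_(r, s <- RR) \osum_(r1, r2 <- comul r) Phi r1 r2 s =
  \osum_(r, s <- RR) \osum_(r', s' <- RR) Phi r r' (mul s s').
Proof.
move=> Phil; rewrite osum_RR_AR_BR; last by lin.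
transitivity (\osum_(a, r <- AR) \osum_(a1, a2 <- DA a) \osum_(b, s <- BR) \osum_(b1, b2 <- DB b)
    \osum_(b1t, a2t <- tau (a2 \ox b1)) Phi (a1 \ox b1t) (a2t \ox b2) (mul r s)).
  by sw osum_comul_tpure.
transitivity (\osum_(a, r <- AR) \osum_(a', r' <- AR) \osum_(b, s <- BR) \osum_(b1, b2 <- DB b)
    \osum_(b1t, a2t <- tau (a' \ox b1)) Phi (a \ox b1t) (a2t \ox b2) (mul (mul r r') s)).
  by sw comul_AR_l.
transitivity (\osum_(a, r <- AR) \osum_(a', r' <- AR) \osum_(b, s <- BR) \osum_(b', s' <- BR)
    \osum_(bt, at' <- tau (a' \ox b)) Phi (a \ox bt) (at' \ox b') (mul r (mul (mul r' s) s'))).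
  by sw comul_BR_l.
transitivity (\osum_(a, r <- AR) \osum_(b', s' <- BR) \osum_(a', r' <- AR) \osum_(b, s <- BR)
     Phi (a \ox b) (a' \ox b') (mul r (mul (mul s r') s'))).
  transitivity (\osum_(a, r <- AR) \osum_(b', s' <- BR) \osum_(a', r' <- AR) \osum_(b, s <- BR)
    \osum_(bt, at' <- tau (a' \ox b)) Phi (a \ox bt) (at' \ox b') (mul r (mul (mul r' s) s'))).
    by reorder sw_assoc.
  apply: eq_osum => a r; apply: eq_osum => b' s'.
  (* The inner pair of AR and BR is RR with tau applied to its first leg. *)
  rewrite -(@tau_RR _ (fun b x t => Phi (a \ox b) (x \ox b') (mul r (mul t s')))); last by lin.
  by rewrite osum_RR_AR_BR //; lin.
(* Each of the two copies of RR on the right has to be opened. *)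
symmetry; rewrite osum_RR_AR_BR; last by lin.
by sw osum_RR_AR_BR.
Qed.

(** The first leg of RA is a \ox y and only y is split; the identity for Y
    makes RR appear through [osum_RR_AR_BR]. *)
Lemma RA_comul_B (V : lmodType K) (Phi : H -> B -> A -> V) : trilin Phi ->
  \osum_(r, a <- RA) \osum_(r1, r2 <- comul r) Phi r1 (projB r2) a =
  \osum_(r, s <- RR) \osum_(y, x <- Y) Phi r y (act s x).
Proof.
move=> Phil; rewrite osum_RA; last by lin.
transitivity (\osum_(a, r <- AR) \osum_(y, x <- Y) \osum_(y1, y2 <- DB y) Phi (a \ox y1) y2 (act r x)).
  by sw_tpure_B.
transitivity (\osum_(a, r <- AR) \osum_(b, s <- BR) \osum_(y, x <- Y) Phi (a \ox b) y (act r (act s x))).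
  by sw (comulY_l comps).
by symmetry; sw osum_RR_AR_BR.
Qed.

Ltac sw_RA_comul_B := sw_comull (fun h : H => h) projB (fun a : A => a) @RA_comul_B.

(** The first part of the second leg lies in B and its remainder is rebuilt by
    [comul_expand_r], so that the identity for tau on AR applies. *)
Lemma AR_comul_Bl (V : lmodType K) (Phi : A -> B -> H -> V) : trilin Phi ->
  \osum_(a, r <- AR) \osum_(r1, r2 <- comul r) Phi a (projB r1) r2 =
  \osum_(r, s <- RR) \osum_(x, y <- X) Phi (act r x) y s.
Proof.
move=> Phil.
transitivity (\osum_(a, r <- AR) \osum_(r1, r2 <- comul r) \osum_(x, y <- comul r1)
    Phi a (projB x) (projA y \ox projB r2)).
  by sw comul_expand_r.
transitivity (\osum_(r, b <- RB) \osum_(a, s <- AR) \osum_(x, y <- comul s)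
    Phi (act r a) (projB x) (projA y \ox b)).
  by sw_AR_comul_B.
transitivity (\osum_(r, b <- RB) \osum_(a, s <- AR) \osum_(y, x <- tau s) Phi (act r a) y (x \ox b)).
  by sw_BA.
transitivity (\osum_(r, b <- RB) \osum_(s, a <- RA) \osum_(x, y <- X) Phi (act r (act s x)) y (a \ox b)).
  by sw (tauAR comps).
by symmetry; sw osum_RR.
Qed.

Ltac sw_AR_comul_Bl := sw_comulr (fun a : A => a) projB (fun h : H => h) @AR_comul_Bl.

(** The counterpart of [tau_RR] for the second leg; it exchanges RA and RB. *)
Lemma RR_tau (V : lmodType K) (Phi : H -> B -> A -> V) : trilin Phi ->
  \osum_(r, s <- RR) \osum_(b, a <- tau s) Phi r b a =
  \osum_(r, a <- RA) \osum_(r', b <- RB) Phi (mul r r') b a.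
Proof.
move=> Phil; rewrite osum_RR_AR_BR; last by lin.
transitivity (\osum_(a, r <- AR) \osum_(r1, r2 <- comul r) \osum_(b, s <- BR) \osum_(y, x <- tau s)
    Phi (a \ox b) (projB r1 * y) (act r2 x)).
  by sw tau_mul.
transitivity (\osum_(a, r <- AR) \osum_(r1, r2 <- comul r) \osum_(y, x <- Y) \osum_(v, w <- W)
    Phi (a \ox y * v) (projB r1 * w) (act r2 x)).
  apply: eq_osum => a r; apply: eq_osum => r1 r2.
  rewrite -(tauBR comps (Phi := fun b c x => Phi (a \ox b) (projB r1 * c) (act r2 x))); last by lin.
  by rewrite osum_BR //; lin.
transitivity (\osum_(r, s <- RR) \osum_(x, z <- X) \osum_(y, x' <- Y) \osum_(v, w <- W)
    Phi (act r x \ox y * v) (z * w) (act s x')).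
  by sw_AR_comul_Bl.
symmetry.
transitivity (\osum_(r, a <- RA) \osum_(x, z <- X) \osum_(v, w <- W) Phi (mul r (x \ox v)) (z * w) a).
  by sw osum_RB.
transitivity (\osum_(r, a <- RA) \osum_(r1, r2 <- comul r) \osum_(x, z <- X) \osum_(v, w <- W)
   Phi (act r1 x \ox projB r2 * v) (z * w) a).
  by sw_mul.
by sw_RA_comul_B.
Qed.

(** The second leg is z' \ox b; tau acts on a part of z' and on b, which after
    the identity for Z is tau on the second leg of RR. *)
Lemma AR_comul_A (V : lmodType K) (Phi : A -> H -> A -> V) : trilin Phi ->
  \osum_(a, r <- AR) \osum_(r1, r2 <- comul r) Phi a r1 (projA r2) =
  \osum_(r, x <- RA) \osum_(a, s <- AR) Phi (act r a) s x.
Proof.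
move=> Phil.
transitivity (\osum_(a, r <- AR) \osum_(r1, r2 <- comul r) \osum_(x, y <- comul r2)
    Phi a (projA r1 \ox projB x) (projA y)).
  by sw comul_expand_l.
transitivity (\osum_(a, r <- AR) \osum_(r1, r2 <- comul r) \osum_(y, x <- tau r2)
    Phi a (projA r1 \ox y) x).
  by sw_BA.
rewrite osum_AR; last by lin.
transitivity (\osum_(r, b <- RB) \osum_(z, z' <- Z) \osum_(z1, z2 <- DA z')
    \osum_(y, x <- tau (z2 \ox b)) Phi (act r z) (z1 \ox y) x).
  by sw_tpure_A.
transitivity (\osum_(r, b <- RB) \osum_(s, a <- RA) \osum_(z, z' <- Z)
    \osum_(y, x <- tau (a \ox b)) Phi (act r (act s z)) (z' \ox y) x).
  by sw (comulZ_r comps).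
(* RB and RA with the product acting on z make up RR. *)
transitivity (\osum_(z, z' <- Z) \osum_(r, s <- RR) \osum_(y, x <- tau s) Phi (act r z) (z' \ox y) x).
  by symmetry; sw osum_RR.
transitivity (\osum_(z, z' <- Z) \osum_(r, a <- RA) \osum_(r', b <- RB) Phi (act (mul r r') z) (z' \ox b) a).
  by sw RR_tau.
by symmetry; sw osum_AR.
Qed.

Ltac sw_AR_comul_A := sw_comulr (fun a : A => a) (fun h : H => h) projA @AR_comul_A.

(** The last leg is rebuilt from its projections to A and B, which are given by
    [AR_comul_A] and [AR_comul_B]. *)
Lemma comul_AR_r (V : lmodType K) (Phi : A -> H -> H -> V) : trilin Phi ->
  \osum_(a, r <- AR) \osum_(r1, r2 <- comul r) Phi a r1 r2 =
  \osum_(r, s <- RR) \osum_(a, t <- AR) Phi (act r a) t s.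
Proof.
move=> Phil.
transitivity (\osum_(a, r <- AR) \osum_(r1, r2 <- comul r) \osum_(x, y <- comul r1)
    Phi a x (projA y \ox projB r2)).
  by sw comul_expand_r.
transitivity (\osum_(r, b <- RB) \osum_(a, s <- AR) \osum_(s1, s2 <- comul s)
    Phi (act r a) s1 (projA s2 \ox b)).
  by sw_AR_comul_B.
transitivity (\osum_(r, b <- RB) \osum_(s, x <- RA) \osum_(a, t <- AR) Phi (act r (act s a)) t (x \ox b)).
  by sw_AR_comul_A.
by symmetry; sw osum_RR.
Qed.

Lemma comul_RA_r (V : lmodType K) (Phi : H -> A -> A -> V) : trilin Phi ->
  \osum_(r, a <- RA) \osum_(a1, a2 <- DA a) Phi r a1 a2 =
  \osum_(r, a <- RA) \osum_(r', a' <- RA) Phi (mul r r') a' a.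
Proof.
move=> Phil; rewrite osum_RA; last by lin.
transitivity (\osum_(a, r <- AR) \osum_(r1, r2 <- comul r) \osum_(y, x <- Y) \osum_(x1, x2 <- DA x)
   Phi (a \ox y) (act r1 x1) (act r2 x2)).
  by sw comul_act.
transitivity (\osum_(a, r <- AR) \osum_(r1, r2 <- comul r) \osum_(y, x <- Y) \osum_(y', x' <- Y)
   Phi (a \ox y * y') (act r1 x') (act r2 x)).
  by sw (comulY_r comps).
transitivity (\osum_(r, s <- RR) \osum_(a, t <- AR) \osum_(y, x <- Y) \osum_(y', x' <- Y)
   Phi (act r a \ox y * y') (act t x') (act s x)).
  by sw comul_AR_r.
symmetry.
transitivity (\osum_(r, c <- RA) \osum_(a, s <- AR) \osum_(y, x <- Y) Phi (mul r (a \ox y)) (act s x) c).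
  by sw osum_RA.
transitivity (\osum_(r, c <- RA) \osum_(r1, r2 <- comul r) \osum_(a, s <- AR) \osum_(y, x <- Y)
    Phi (act r1 a \ox projB r2 * y) (act s x) c).
  by sw_mul.
by sw_RA_comul_B.
Qed.

Lemma comul_RR_r (V : lmodType K) (Phi : H -> H -> H -> V) : trilin Phi ->
  \osum_(r, s <- RR) \osum_(s1, s2 <- comul s) Phi r s1 s2 =
  \osum_(r, s <- RR) \osum_(r', s' <- RR) Phi (mul r r') s' s.
Proof.
move=> Phil; rewrite osum_RR; last by lin.
transitivity (\osum_(r, b <- RB) \osum_(b1, b2 <- DB b) \osum_(s, a <- RA) \osum_(a1, a2 <- DA a)
    \osum_(b1t, a2t <- tau (a2 \ox b1)) Phi (mul r s) (a1 \ox b1t) (a2t \ox b2)).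
  by sw osum_comul_tpure.
transitivity (\osum_(r, b <- RB) \osum_(r', b' <- RB) \osum_(s, a <- RA) \osum_(a1, a2 <- DA a)
    \osum_(b1t, a2t <- tau (a2 \ox b')) Phi (mul (mul r r') s) (a1 \ox b1t) (a2t \ox b)).
  by sw comul_RB_r.
transitivity (\osum_(r, b <- RB) \osum_(s', a' <- RA) \osum_(r', b' <- RB) \osum_(s, a <- RA)
    \osum_(bt, at' <- tau (a \ox b')) Phi (mul r (mul (mul r' s) s')) (a' \ox bt) (at' \ox b)).
  by sw comul_RA_r.
transitivity (\osum_(r, b <- RB) \osum_(s', a' <- RA) \osum_(s, a <- RA) \osum_(r', b' <- RB)
    Phi (mul r (mul (mul s r') s')) (a' \ox b') (a \ox b)).
  apply: eq_osum => r b; apply: eq_osum => s' a'.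
  rewrite -(@RR_tau _ (fun t y x => Phi (mul r (mul t s')) (a' \ox y) (x \ox b))); last by lin.
  by rewrite osum_RR //; lin.
symmetry; rewrite osum_RR; last by lin.
by sw osum_RR.
Qed.

(** * Counits *)

(** In the next lemmas a counit is applied to one leg, whose factors vanish one
    after the other because W, X, Y and Z are normalized. *)
Lemma RB_eB (V : lmodType K) (f : H -> V) : is_linear f ->
  \osum_(r, b <- RB) eB b *: f r = f one.
Proof.
move=> fl; rewrite osum_RB; last by lin.
transitivity (\osum_(x, y <- X) eB y *: \osum_(v, w <- W) eB w *: f (x \ox v)).
  apply: eq_osum => x y; rewrite scaler_osum; apply: eq_osum => v w.
  by rewrite eBM scalerA.
rewrite (@norm_r _ _ _ _ _ _ _ (fun x => \osum_(v, w <- W) eB w *: f (x \ox v)) normX); last by lin.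
by rewrite (@norm_r _ _ _ _ _ _ _ (fun v => f (1 \ox v)) normW); last by lin.
Qed.

Lemma RB_counit (V : lmodType K) (f : B -> V) : is_linear f ->
  \osum_(r, b <- RB) counit r *: f b = f 1.
Proof.
move=> fl; rewrite osum_RB; last by lin.
transitivity (\osum_(x, y <- X) eA x *: \osum_(v, w <- W) eB v *: f (y * w)).
  apply: eq_osum => x y; rewrite scaler_osum; apply: eq_osum => v w.
  by rewrite counit_tpure scalerA.
rewrite (@norm_l _ _ _ _ _ _ _ (fun y => \osum_(v, w <- W) eB v *: f (y * w)) normX); last by lin.
by rewrite (@norm_l _ _ _ _ _ _ _ (fun w => f (1 * w)) normW) ?mulr1; last by lin.
Qed.

Lemma BR_eB (V : lmodType K) (f : H -> V) : is_linear f ->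
  \osum_(b, r <- BR) eB b *: f r = f one.
Proof.
move=> fl; rewrite osum_BR; last by lin.
transitivity (\osum_(v, w <- W) eB v *: \osum_(y, x <- Y) eB y *: f (x \ox w)).
  apply: eq_osum => x y; rewrite scaler_osum; apply: eq_osum => v w.
  by rewrite eBM scalerA.
rewrite (@norm_l _ _ _ _ _ _ _ (fun w => \osum_(y, x <- Y) eB y *: f (x \ox w)) normW); last by lin.
by rewrite (@norm_l _ _ _ _ _ _ _ (fun x => f (x \ox 1)) normY); last by lin.
Qed.

Lemma AR_eA (V : lmodType K) (f : H -> V) : is_linear f ->
  \osum_(a, r <- AR) eA a *: f r = f one.
Proof.
move=> fl; rewrite osum_AR; last by lin.
transitivity (\osum_(r, b <- RB) counit r *: \osum_(z, z' <- Z) eA z *: f (z' \ox b)).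
  apply: eq_osum => r b; rewrite scaler_osum; apply: eq_osum => z z'.
  by rewrite eA_act scalerA.
rewrite (@RB_counit _ (fun b => \osum_(z, z' <- Z) eA z *: f (z' \ox b))); last by lin.
by rewrite (@norm_l _ _ _ _ _ _ _ (fun x => f (x \ox 1)) normZ); last by lin.
Qed.

Lemma AR_counit (V : lmodType K) (f : A -> V) : is_linear f ->
  \osum_(a, r <- AR) counit r *: f a = f 1.
Proof.
move=> fl; rewrite osum_AR; last by lin.
transitivity (\osum_(r, b <- RB) eB b *: \osum_(z, z' <- Z) eA z' *: f (act r z)).
  apply: eq_osum => r b; rewrite scaler_osum; apply: eq_osum => z z'.
  by rewrite counit_tpure scalerA mulrC.
rewrite (@RB_eB _ (fun r => \osum_(z, z' <- Z) eA z' *: f (act r z))); last by lin.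
by rewrite (@norm_r _ _ _ _ _ _ _ (fun x => f (act one x)) normZ) ?act_one; last by lin.
Qed.

Lemma RA_eA (V : lmodType K) (f : H -> V) : is_linear f ->
  \osum_(r, a <- RA) eA a *: f r = f one.
Proof.
move=> fl; rewrite osum_RA; last by lin.
transitivity (\osum_(a, r <- AR) counit r *: \osum_(y, x <- Y) eA x *: f (a \ox y)).
  apply: eq_osum => r b; rewrite scaler_osum; apply: eq_osum => z z'.
  by rewrite eA_act scalerA.
rewrite (@AR_counit _ (fun a => \osum_(y, x <- Y) eA x *: f (a \ox y))); last by lin.
by rewrite (@norm_r _ _ _ _ _ _ _ (fun x => f (1 \ox x)) normY); last by lin.
Qed.

Lemma RR_counit_l : \osum_(r, s <- RR) (counit r *: s) = one.
Proof.
rewrite osum_RR_AR_BR; last by lin.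
transitivity (\osum_(a, r <- AR) eA a *: \osum_(b, s <- BR) eB b *: mul r s).
  apply: eq_osum => a r; rewrite scaler_osum; apply: eq_osum => b s.
  by rewrite counit_tpure scalerA.
rewrite (@AR_eA _ (fun r => \osum_(b, s <- BR) eB b *: mul r s)); last by lin.
by rewrite (@BR_eB _ (fun s => mul one s)) ?mul1H; last by lin.
Qed.

Lemma RR_counit_r : \osum_(r, s <- RR) (counit s *: r) = one.
Proof.
rewrite osum_RR; last by lin.
transitivity (\osum_(r, b <- RB) eB b *: \osum_(s, a <- RA) eA a *: mul r s).
  apply: eq_osum => r b; rewrite scaler_osum; apply: eq_osum => s a.
  by rewrite counit_tpure scalerA mulrC.
rewrite (@RB_eB _ (fun r => \osum_(s, a <- RA) eA a *: mul r s)); last by lin.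
by rewrite (@RA_eA _ (fun s => mul one s)) ?mul1H; last by lin.
Qed.

Lemma RR_projB (V : lmodType K) (Phi : H -> B -> V) : bilin Phi ->
  \osum_(r, s <- RR) Phi r (projB s) = \osum_(r, b <- RB) Phi r b.
Proof.
move=> Phil; rewrite osum_RR; last by lin.
apply: eq_osum => r b; rewrite -[r in RHS]mulH1.
rewrite -[RHS](@RA_eA _ (fun s => Phi (mul r s) b)); last by lin.
by apply: eq_osum => s a; rewrite projB_tpure; pull_scale (eA a).
Qed.

Lemma RR_projBl (V : lmodType K) (Phi : B -> H -> V) : bilin Phi ->
  \osum_(r, s <- RR) Phi (projB r) s = \osum_(b, s <- BR) Phi b s.
Proof.
move=> Phil; rewrite osum_RR_AR_BR; last by lin.
rewrite exchange_osum; apply: eq_osum => b s; rewrite -[s in RHS]mul1H.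
rewrite -[RHS](@AR_eA _ (fun r => Phi b (mul r s))); last by lin.
by apply: eq_osum => a r; rewrite projB_tpure; pull_scale (eA a).
Qed.

(** * Almost cocommutativity *)

(** Almost cocommutativity for h = a \ox 1 (suffix A) and h = 1 \ox b (suffix
    B), with the two legs sent to the quotients named in capitals. *)
Record cocomm_components : Prop := CocommComponents {
  cocommAA_A : forall (V : lmodType K) (Phi : A -> A -> V), bilin Phi -> forall a,
    \osum_(r, s <- RR) \osum_(a1, a2 <- DA a) Phi (act r a1) (act s a2) =
    \osum_(h1, h2 <- comul (a \ox 1)) \osum_(z, z' <- Z) Phi (act h2 z) (act h1 z');
  cocommAB_A : forall (V : lmodType K) (Phi : A -> B -> V), bilin Phi -> forall a,
    \osum_(r, b <- RB) Phi (act r a) b =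
    \osum_(h1, h2 <- comul (a \ox 1)) \osum_(x, y <- X) Phi (act h2 x) (projB h1 * y);
  cocommBA_A : forall (V : lmodType K) (Phi : B -> A -> V), bilin Phi -> forall a,
    \osum_(b, r <- BR) \osum_(u, at' <- tau (a \ox 1)) Phi (b * u) (act r at') =
    \osum_(y, x <- Y) Phi y (a * x);
  cocommAA_B : forall (V : lmodType K) (Phi : A -> A -> V), bilin Phi -> forall b,
    eB b *: (\osum_(z, z' <- Z) Phi z z') =
    \osum_(h1, h2 <- comul (1 \ox b)) \osum_(z, z' <- Z) Phi (act h2 z) (act h1 z');
  cocommAB_B : forall (V : lmodType K) (Phi : A -> B -> V), bilin Phi -> forall b,
    \osum_(x, y <- X) Phi x (y * b) =
    \osum_(h1, h2 <- comul (1 \ox b)) \osum_(x, y <- X) Phi (act h2 x) (projB h1 * y);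
  cocommBA_B : forall (V : lmodType K) (Phi : B -> A -> V), bilin Phi -> forall b,
    \osum_(c, r <- BR) \osum_(bt, v <- tau (1 \ox b)) Phi (c * bt) (act r v) =
    \osum_(y, x <- Y) \osum_(b1, b2 <- DB b) Phi (b2 * y) (act (1 \ox b1) x);
  cocommBB_B : forall (V : lmodType K) (Phi : B -> B -> V), bilin Phi -> forall b,
    \osum_(v, w <- W) \osum_(b1, b2 <- DB b) Phi (v * b1) (w * b2) =
    \osum_(v, w <- W) \osum_(b1, b2 <- DB b) Phi (b2 * v) (b1 * w)
}.

Hypothesis cocomm : cocomm_components.

(** The left-hand side depends on h only through projA h, and 1 \ox b
    contributes its counit on both sides; so the generators suffice although no
    extra argument is carried. *)
Lemma cocommAA (V : lmodType K) (Phi : A -> A -> V) : bilin Phi -> forall h,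
  \osum_(r, s <- RR) \osum_(h1, h2 <- comul h) Phi (act r (projA h1)) (act s (projA h2)) =
  \osum_(h1, h2 <- comul h) \osum_(z, z' <- Z) Phi (act h2 z) (act h1 z').
Proof.
move=> Phil; apply: generators_ind; [lin|lin|] => a b.
transitivity (\osum_(r, s <- RR) \osum_(a1, a2 <- DA (eB b *: a)) Phi (act r a1) (act s a2)).
  apply: eq_osum => r s; rewrite mul_tpure_1l mul1r -projA_tpure.
  by rewrite (@comul_projA _ (fun x y => Phi (act r x) (act s y))) //; lin.
rewrite (cocommAA_A cocomm) //; symmetry.
transitivity (\osum_(h1, h2 <- comul (a \ox 1)) \osum_(g1, g2 <- comul (1 \ox b)) \osum_(z, z' <- Z)
   Phi (act h2 (act g2 z)) (act h1 (act g1 z'))).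
  by sweedler ltac:(apply comul_mul; lin) ltac:(rewrite !act_mul; reflexivity).
have -> : (eB b *: a) \ox (1 : B) = eB b *: (a \ox 1) by rewrite (is_linearZ (f := fun a => a \ox 1)) //; lin.
symmetry; pull_scale (eB b); rewrite scaler_osum; symmetry.
apply: eq_osum => h1 h2.
by rewrite -(cocommAA_B cocomm (Phi := fun z z' => Phi (act h2 z) (act h1 z'))) //; lin.
Qed.

Lemma cocommBB (V : lmodType K) (Phi : B -> B -> V) : bilin Phi -> forall h,
  \osum_(v, w <- W) \osum_(h1, h2 <- comul h) Phi (v * projB h1) (w * projB h2) =
  \osum_(v, w <- W) \osum_(h1, h2 <- comul h) Phi (projB h2 * v) (projB h1 * w).
Proof.
move=> Phil h.
transitivity (\osum_(v, w <- W) \osum_(b1, b2 <- DB (projB h)) Phi (v * b1) (w * b2)).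
  by symmetry; sw comul_projB.
rewrite (cocommBB_B cocomm) //.
by sw comul_projB.
Qed.

(** act (a \ox 1) z = a * z, so the argument z is absorbed by the identity
    for a * z. *)
Lemma cocommAB_gen_A (V : lmodType K) (Phi : A -> B -> V) : bilin Phi -> forall z a,
  \osum_(r, b <- RB) \osum_(h1, h2 <- comul (a \ox 1)) Phi (act r (act h1 z)) (b * projB h2) =
  \osum_(h1, h2 <- comul (a \ox 1)) \osum_(r, b <- RB) Phi (act h2 (act r z)) (projB h1 * b).
Proof.
move=> Phil z a.
transitivity (\osum_(r, b <- RB) \osum_(b1, b2 <- DB 1) Phi (act r (act (a \ox b1) z)) (b * b2)).
  by sw_tpure_B.
transitivity (\osum_(r, b <- RB) Phi (act r (a * z)) b).
  apply: eq_osum => r b; rewrite DB1 osum_tpure ?mulr1 ?act_tpure1 //; lin.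
rewrite (cocommAB_A cocomm) // -mul_tpure_1r.
transitivity (\osum_(g1, g2 <- comul (a \ox 1)) \osum_(h1, h2 <- comul (z \ox 1))
   \osum_(x, y <- X) Phi (act g2 (act h2 x)) (projB g1 * (projB h1 * y))).
  by sweedler ltac:(apply comul_mul; lin) ltac:(rewrite act_mul projB_mul mulrA; reflexivity).
apply: eq_osum => g1 g2.
by rewrite -(cocommAB_A cocomm (Phi := fun a b => Phi (act g2 a) (projB g1 * b))) //; lin.
Qed.

(** Here z stays outside: RB is opened and 1 \ox b is moved across W by its
    cocommutativity and across X by the identity for X. *)
Lemma cocommAB_gen_B (V : lmodType K) (Phi : A -> B -> V) : bilin Phi -> forall z b,
  \osum_(r, c <- RB) \osum_(h1, h2 <- comul (1 \ox b)) Phi (act r (act h1 z)) (c * projB h2) =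
  \osum_(h1, h2 <- comul (1 \ox b)) \osum_(r, c <- RB) Phi (act h2 (act r z)) (projB h1 * c).
Proof.
move=> Phil z b.
rewrite osum_RB; last by lin.
transitivity (\osum_(x, y <- X) \osum_(v, w <- W) \osum_(b1, b2 <- DB b)
    Phi (act (x \ox v) (act (1 \ox b1) z)) (y * w * b2)).
  by sw_tpure_B.
transitivity (\osum_(x, y <- X) \osum_(v, w <- W) \osum_(b1, b2 <- DB b)
    Phi (act (x \ox b2 * v) z) (y * (b1 * w))).
  apply: eq_osum => x y.
  rewrite -(cocommBB_B cocomm (Phi := fun c d => Phi (act (x \ox c) z) (y * d))); last by lin.
  by reorder ltac:(rewrite -act_mul mul_tpure_1l mulrA; reflexivity).
transitivity (\osum_(b1, b2 <- DB b) \osum_(h1, h2 <- comul (1 \ox b1)) \osum_(v, w <- W)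
   \osum_(x, y <- X) Phi (act (act h2 x \ox b2 * v) z) (projB h1 * y * w)).
  transitivity (\osum_(b1, b2 <- DB b) \osum_(v, w <- W) \osum_(x, y <- X) Phi (act (x \ox b2 * v) z) (y * b1 * w)).
    by reorder sw_assoc.
  apply: eq_osum => b1 b2; rewrite exchange_osum.
  rewrite [LHS](cocommAB_B cocomm (Phi := fun x y => \osum_(v, w <- W) Phi (act (x \ox b2 * v) z) (y * w))); last by lin.
  by reorder sw_assoc.
symmetry.
transitivity (\osum_(h1, h2 <- comul (1 \ox b)) \osum_(x, y <- X) \osum_(v, w <- W)
   Phi (act (mul h2 (x \ox v)) z) (projB h1 * (y * w))).
  by sw osum_RB.
transitivity (\osum_(h1, h2 <- comul (1 \ox b)) \osum_(g1, g2 <- comul h2) \osum_(x, y <- X) \osum_(v, w <- W)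
   Phi (act (act g1 x \ox projB g2 * v) z) (projB h1 * (y * w))).
  by sw_mul.
transitivity (\osum_(h1, h2 <- comul (1 \ox b)) \osum_(g1, g2 <- comul h1) \osum_(x, y <- X) \osum_(v, w <- W)
   Phi (act (act g2 x \ox projB h2 * v) z) (projB g1 * (y * w))).
  by swr coassocH.
by sw_tpure_B.
Qed.

(** The argument x is what makes the identity multiplicative in h: in the
    first factor it may be replaced by act h1 x. *)
Lemma cocommAB (V : lmodType K) (Phi : A -> B -> V) : bilin Phi -> forall x h,
  \osum_(r, b <- RB) \osum_(h1, h2 <- comul h) Phi (act r (act h1 x)) (b * projB h2) =
  \osum_(h1, h2 <- comul h) \osum_(r, b <- RB) Phi (act h2 (act r x)) (projB h1 * b).
Proof.
move=> Phil x; apply: generators_ind; [lin|lin|] => a b.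
transitivity (\osum_(h1, h2 <- comul (1 \ox b)) \osum_(r, c <- RB) \osum_(g1, g2 <- comul (a \ox 1))
   Phi (act r (act g1 (act h1 x))) (c * projB g2 * projB h2)).
  by sweedler ltac:(apply comul_mul; lin) ltac:(rewrite act_mul projB_mul mulrA; reflexivity).
transitivity (\osum_(g1, g2 <- comul (a \ox 1)) \osum_(r, c <- RB) \osum_(h1, h2 <- comul (1 \ox b))
   Phi (act g2 (act r (act h1 x))) (projB g1 * (c * projB h2))).
  rewrite [RHS](_ : _ = \osum_(h1, h2 <- comul (1 \ox b)) \osum_(g1, g2 <- comul (a \ox 1)) \osum_(r, c <- RB)
   Phi (act g2 (act r (act h1 x))) (projB g1 * (c * projB h2))); last by reorder sw_assoc.
  apply: eq_osum => h1 h2.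
  rewrite (@cocommAB_gen_A _ (fun a c => Phi a (c * projB h2))); last by lin.
  by reorder sw_assoc.
symmetry.
transitivity (\osum_(g1, g2 <- comul (a \ox 1)) \osum_(h1, h2 <- comul (1 \ox b)) \osum_(r, c <- RB)
   Phi (act g2 (act h2 (act r x))) (projB g1 * (projB h1 * c))).
  by sweedler ltac:(apply comul_mul; lin) ltac:(rewrite act_mul projB_mul mulrA; reflexivity).
apply: eq_osum => g1 g2.
by rewrite -(@cocommAB_gen_B _ (fun a c => Phi (act g2 a) (projB g1 * c))) //; lin.
Qed.

(** The argument z cannot be absorbed on this side.  Instead the second leg of
    BR is split by [BR_comul_B], which leaves z behind a factor w of W. *)
Lemma cocommBA_gen_A (V : lmodType K) (Phi : B -> A -> V) : bilin Phi -> forall z a,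
  \osum_(b, r <- BR) \osum_(h1, h2 <- comul (a \ox 1)) Phi (b * projB h1) (act r (act h2 z)) =
  \osum_(h1, h2 <- comul (a \ox 1)) \osum_(b, r <- BR) Phi (projB h2 * b) (act h1 (act r z)).
Proof.
move=> Phil z a.
transitivity (\osum_(b, r <- BR) \osum_(b1, b2 <- DB 1) \osum_(u, at' <- tau (a \ox b1))
   Phi (b * u) (act r (act (at' \ox b2) z))).
  by sw_proj projB (fun h : H => h) @comul_tpure_BH.
transitivity (\osum_(b, r <- BR) \osum_(u, at' <- tau (a \ox 1)) Phi (b * u) (act (mul r (at' \ox 1)) z)).
  apply: eq_osum => b r; rewrite DB1 osum_tpure; last by lin.
  by apply: eq_osum => u at'; rewrite act_mul.
transitivity (\osum_(b, r <- BR) \osum_(r1, r2 <- comul r) \osum_(u, at' <- tau (a \ox 1))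
   Phi (b * u) (act (act r1 at' \ox projB r2) z)).
  by sweedler ltac:(idtac; expand_mul) ltac:(rewrite mulr1; reflexivity).
transitivity (\osum_(v, w <- W) \osum_(b, r <- BR) \osum_(u, at' <- tau (a \ox 1))
   Phi (v * (b * u)) (act (act r at' \ox w) z)).
  by sw_BR_comul_B.
transitivity (\osum_(v, w <- W) \osum_(y, x <- Y) Phi (v * y) (act (a * x \ox w) z)).
  apply: eq_osum => v w.
  by rewrite (cocommBA_A cocomm (Phi := fun b x => Phi (v * b) (act (x \ox w) z))) //; lin.
symmetry; rewrite exchange_osum.
transitivity (\osum_(b, r <- BR) \osum_(b1, b2 <- DB 1) Phi (b2 * b) (act (a \ox b1) (act r z))).
  by sw_tpure_B.
rewrite osum_BR; last by lin.
apply: eq_osum => v w; apply: eq_osum => y x.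
by rewrite DB1 osum_tpure ?mul1r -?act_mul ?mul_tpure_1r //; lin.
Qed.

(** As for a \ox 1, except that the part of 1 \ox b that acts on z is moved
    across W by the cocommutativity of W. *)
Lemma cocommBA_gen_B (V : lmodType K) (Phi : B -> A -> V) : bilin Phi -> forall z b,
  \osum_(c, r <- BR) \osum_(h1, h2 <- comul (1 \ox b)) Phi (c * projB h1) (act r (act h2 z)) =
  \osum_(h1, h2 <- comul (1 \ox b)) \osum_(c, r <- BR) Phi (projB h2 * c) (act h1 (act r z)).
Proof.
move=> Phil z b.
transitivity (\osum_(c, r <- BR) \osum_(b1, b2 <- DB b) \osum_(bt, v <- tau (1 \ox b1))
   Phi (c * bt) (act r (act (v \ox b2) z))).
  by sw_proj projB (fun h : H => h) @comul_tpure_BH.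
transitivity (\osum_(c, r <- BR) \osum_(b1, b2 <- DB b) \osum_(bt, v <- tau (1 \ox b1))
   Phi (c * bt) (act (mul r (v \ox 1)) (act (1 \ox b2) z))).
  by reorder ltac:(rewrite -!act_mul -mulHA mul_tpure_1r mulr1; reflexivity).
transitivity (\osum_(c, r <- BR) \osum_(r1, r2 <- comul r) \osum_(b1, b2 <- DB b) \osum_(bt, v <- tau (1 \ox b1))
   Phi (c * bt) (act (act r1 v \ox projB r2) (act (1 \ox b2) z))).
  by sweedler ltac:(idtac; expand_mul) ltac:(rewrite mulr1; reflexivity).
transitivity (\osum_(v, w <- W) \osum_(b1, b2 <- DB b) \osum_(c, r <- BR) \osum_(bt, v' <- tau (1 \ox b1))
   Phi (v * (c * bt)) (act (act r v' \ox w) (act (1 \ox b2) z))).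
  by sw_BR_comul_B.
transitivity (\osum_(v, w <- W) \osum_(b1, b2 <- DB b) \osum_(y, x <- Y) \osum_(b11, b12 <- DB b1)
   Phi (v * (b12 * y)) (act (act (1 \ox b11) x \ox w * b2) z)).
  apply: eq_osum => v w; apply: eq_osum => b1 b2.
  rewrite (cocommBA_B cocomm (Phi := fun b x => Phi (v * b) (act (x \ox w) (act (1 \ox b2) z)))); last by lin.
  by reorder ltac:(rewrite -act_mul mul_tpure_1l; reflexivity).
transitivity (\osum_(b1, b2 <- DB b) \osum_(y, x <- Y) \osum_(v, w <- W) \osum_(b21, b22 <- DB b2)
   Phi (v * b21 * y) (act (act (1 \ox b1) x \ox w * b22) z)).
  transitivity (\osum_(b1, b2 <- DB b) \osum_(b11, b12 <- DB b1) \osum_(y, x <- Y) \osum_(v, w <- W)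
   Phi (v * b12 * y) (act (act (1 \ox b11) x \ox w * b2) z)); first by reorder sw_assoc.
  by sw coassocB.
transitivity (\osum_(b1, b2 <- DB b) \osum_(y, x <- Y) \osum_(v, w <- W) \osum_(b21, b22 <- DB b2)
   Phi (b22 * v * y) (act (act (1 \ox b1) x \ox b21 * w) z)).
  apply: eq_osum => b1 b2; apply: eq_osum => y x.
  by rewrite (cocommBB_B cocomm (Phi := fun v w => Phi (v * y) (act (act (1 \ox b1) x \ox w) z))) //; lin.
symmetry.
transitivity (\osum_(b1, b2 <- DB b) \osum_(c, r <- BR) Phi (b2 * c) (act (1 \ox b1) (act r z))).
  by sw_tpure_B.
transitivity (\osum_(b1, b2 <- DB b) \osum_(v, w <- W) \osum_(y, x <- Y)
    Phi (b2 * (v * y)) (act (mul (1 \ox b1) (x \ox w)) z)).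
  by sw osum_BR.
transitivity (\osum_(b1, b2 <- DB b) \osum_(h1, h2 <- comul (1 \ox b1)) \osum_(v, w <- W) \osum_(y, x <- Y)
    Phi (b2 * (v * y)) (act (act h1 x \ox projB h2 * w) z)).
  by sw_mul.
transitivity (\osum_(b1, b2 <- DB b) \osum_(b11, b12 <- DB b1) \osum_(v, w <- W) \osum_(y, x <- Y)
    Phi (b2 * (v * y)) (act (act (1 \ox b11) x \ox b12 * w) z)).
  by sw_tpure_B.
by sw coassocB.
Qed.

Lemma cocommBA (V : lmodType K) (Phi : B -> A -> V) : bilin Phi -> forall x h,
  \osum_(b, r <- BR) \osum_(h1, h2 <- comul h) Phi (b * projB h1) (act r (act h2 x)) =
  \osum_(h1, h2 <- comul h) \osum_(b, r <- BR) Phi (projB h2 * b) (act h1 (act r x)).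
Proof.
move=> Phil x; apply: generators_ind; [lin|lin|] => a b.
transitivity (\osum_(h1, h2 <- comul (1 \ox b)) \osum_(c, r <- BR) \osum_(g1, g2 <- comul (a \ox 1))
   Phi (c * projB g1 * projB h1) (act r (act g2 (act h2 x)))).
  by sweedler ltac:(apply comul_mul; lin) ltac:(rewrite act_mul projB_mul mulrA; reflexivity).
transitivity (\osum_(g1, g2 <- comul (a \ox 1)) \osum_(c, r <- BR) \osum_(h1, h2 <- comul (1 \ox b))
   Phi (projB g2 * (c * projB h1)) (act g1 (act r (act h2 x)))).
  rewrite [RHS](_ : _ = \osum_(h1, h2 <- comul (1 \ox b)) \osum_(g1, g2 <- comul (a \ox 1)) \osum_(c, r <- BR)
   Phi (projB g2 * (c * projB h1)) (act g1 (act r (act h2 x)))); last by reorder sw_assoc.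
  apply: eq_osum => h1 h2.
  rewrite (@cocommBA_gen_A _ (fun c a => Phi (c * projB h1) a)); last by lin.
  by reorder sw_assoc.
symmetry.
transitivity (\osum_(g1, g2 <- comul (a \ox 1)) \osum_(h1, h2 <- comul (1 \ox b)) \osum_(c, r <- BR)
   Phi (projB g2 * (projB h2 * c)) (act g1 (act h1 (act r x)))).
  by sweedler ltac:(apply comul_mul; lin) ltac:(rewrite act_mul projB_mul mulrA; reflexivity).
apply: eq_osum => g1 g2.
by rewrite -(@cocommBA_gen_B _ (fun c a => Phi (projB g2 * c) (act g1 a))) //; lin.
Qed.

(** The leg in H is expanded into A and B.  The three parts of h then cross
    the copies of R one after the other, by [cocommAA] and by [cocommAB] with
    argument the element z of A that the first crossing produced. *)
Lemma cocommAH (V : lmodType K) (Phi : A -> H -> V) : bilin Phi -> forall h,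
  \osum_(r, s <- RR) \osum_(h1, h2 <- comul h) Phi (act r (projA h1)) (mul s h2) =
  \osum_(h1, h2 <- comul h) \osum_(a, r <- AR) Phi (act h2 a) (mul h1 r).
Proof.
move=> Phil h.
transitivity (\osum_(r, s <- RR) \osum_(s1, s2 <- comul s) \osum_(h1, h2 <- comul h) \osum_(x, y <- comul h2)
   Phi (act r (projA h1)) (act s1 (projA x) \ox projB s2 * projB y)).
  by sw_full.
transitivity (\osum_(r, s <- RR) \osum_(r', s' <- RR) \osum_(h1, h2 <- comul h) \osum_(x, y <- comul h2)
   Phi (act r (act r' (projA h1))) (act s' (projA x) \ox projB s * projB y)).
  by sw comul_RR_r.
transitivity (\osum_(r, s <- RR) \osum_(h1, h2 <- comul h) \osum_(r', s' <- RR) \osum_(x, y <- comul h1)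
   Phi (act r (act r' (projA x))) (act s' (projA y) \ox projB s * projB h2)).
  by swr coassocH.
transitivity (\osum_(r, s <- RR) \osum_(h1, h2 <- comul h) \osum_(x, y <- comul h1) \osum_(z, z' <- Z)
   Phi (act r (act y z)) (act x z' \ox projB s * projB h2)).
  apply: eq_osum => r s; apply: eq_osum => h1 h2.
  by rewrite (@cocommAA _ (fun x y => Phi (act r x) (y \ox projB s * projB h2))) //; lin.
transitivity (\osum_(r, b <- RB) \osum_(h1, h2 <- comul h) \osum_(x, y <- comul h1) \osum_(z, z' <- Z)
   Phi (act r (act y z)) (act x z' \ox b * projB h2)).
  by sw_proj (fun h : H => h) projB @RR_projB.
transitivity (\osum_(h1, h2 <- comul h) \osum_(z, z' <- Z) \osum_(r, b <- RB) \osum_(x, y <- comul h2)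
   Phi (act r (act x z)) (act h1 z' \ox b * projB y)).
  by sw coassocH.
transitivity (\osum_(h1, h2 <- comul h) \osum_(z, z' <- Z) \osum_(x, y <- comul h2) \osum_(r, b <- RB)
   Phi (act y (act r z)) (act h1 z' \ox projB x * b)).
  apply: eq_osum => h1 h2; apply: eq_osum => z z'.
  by rewrite (@cocommAB _ (fun x b => Phi x (act h1 z' \ox b))) //; lin.
symmetry.
transitivity (\osum_(h1, h2 <- comul h) \osum_(r, b <- RB) \osum_(z, z' <- Z)
   Phi (act h2 (act r z)) (mul h1 (z' \ox b))).
  by sw osum_AR.
transitivity (\osum_(h1, h2 <- comul h) \osum_(x, y <- comul h1) \osum_(r, b <- RB) \osum_(z, z' <- Z)
   Phi (act h2 (act r z)) (act x z' \ox projB y * b)).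
  by sw_mul.
by sw coassocH.
Qed.

(** As [cocommAH], with [cocommBA] and [cocommBB]. *)
Lemma cocommBH (V : lmodType K) (Phi : B -> H -> V) : bilin Phi -> forall h,
  \osum_(b, r <- BR) \osum_(h1, h2 <- comul h) Phi (b * projB h1) (mul r h2) =
  \osum_(h1, h2 <- comul h) \osum_(b, r <- BR) Phi (projB h2 * b) (mul h1 r).
Proof.
move=> Phil h.
transitivity (\osum_(b, r <- BR) \osum_(r1, r2 <- comul r) \osum_(h1, h2 <- comul h) \osum_(x, y <- comul h2)
   Phi (b * projB h1) (act r1 (act x 1) \ox projB r2 * projB y)).
  by sweedler ltac:(idtac; expand_full) ltac:(rewrite act_1; reflexivity).
transitivity (\osum_(v, w <- W) \osum_(b, r <- BR) \osum_(h1, h2 <- comul h) \osum_(x, y <- comul h2)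
   Phi (v * b * projB h1) (act r (act x 1) \ox w * projB y)).
  by sw_BR_comul_B.
transitivity (\osum_(v, w <- W) \osum_(h1, h2 <- comul h) \osum_(b, r <- BR) \osum_(x, y <- comul h1)
   Phi (v * (b * projB x)) (act r (act y 1) \ox w * projB h2)).
  by swr coassocH.
transitivity (\osum_(v, w <- W) \osum_(h1, h2 <- comul h) \osum_(x, y <- comul h1) \osum_(b, r <- BR)
   Phi (v * (projB y * b)) (act x (act r 1) \ox w * projB h2)).
  apply: eq_osum => v w; apply: eq_osum => h1 h2.
  by rewrite (@cocommBA _ (fun b x => Phi (v * b) (x \ox w * projB h2))) //; lin.
transitivity (\osum_(h1, h2 <- comul h) \osum_(b, r <- BR) \osum_(v, w <- W) \osum_(x, y <- comul h2)
   Phi (v * projB x * b) (act h1 (act r 1) \ox w * projB y)).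
  by sw coassocH.
transitivity (\osum_(h1, h2 <- comul h) \osum_(b, r <- BR) \osum_(v, w <- W) \osum_(x, y <- comul h2)
   Phi (projB y * v * b) (act h1 (act r 1) \ox projB x * w)).
  apply: eq_osum => h1 h2; apply: eq_osum => b r.
  by rewrite (@cocommBB _ (fun v w => Phi (v * b) (act h1 (act r 1) \ox w))) //; lin.
symmetry.
transitivity (\osum_(h1, h2 <- comul h) \osum_(x, y <- comul h1) \osum_(b, r <- BR) \osum_(r1, r2 <- comul r)
   Phi (projB h2 * b) (act x (act r1 1) \ox projB y * projB r2)).
  by sweedler ltac:(idtac; expand_full) ltac:(rewrite act_1; reflexivity).
transitivity (\osum_(h1, h2 <- comul h) \osum_(x, y <- comul h1) \osum_(v, w <- W) \osum_(b, r <- BR)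
   Phi (projB h2 * (v * b)) (act x (act r 1) \ox projB y * w)).
  by sw_BR_comul_B.
by sw coassocH.
Qed.

(** Now the first leg is expanded into A and B, and the parts of h cross by
    [cocommBH] and [cocommAH]. *)
Lemma cocommHH (V : lmodType K) (Phi : H -> H -> V) : bilin Phi -> forall h,
  \osum_(r, s <- RR) \osum_(h1, h2 <- comul h) Phi (mul r h1) (mul s h2) =
  \osum_(h1, h2 <- comul h) \osum_(r, s <- RR) Phi (mul h2 r) (mul h1 s).
Proof.
move=> Phil h.
transitivity (\osum_(r, s <- RR) \osum_(r1, r2 <- comul r) \osum_(h1, h2 <- comul h) \osum_(x, y <- comul h1)
   Phi (act r1 (projA x) \ox projB r2 * projB y) (mul s h2)).
  by sw_full.
transitivity (\osum_(r, s <- RR) \osum_(r', s' <- RR) \osum_(h1, h2 <- comul h) \osum_(x, y <- comul h1)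
   Phi (act r (projA x) \ox projB r' * projB y) (mul s (mul s' h2))).
  by sw comul_RR_l.
transitivity (\osum_(r, s <- RR) \osum_(b, t <- BR) \osum_(h1, h2 <- comul h) \osum_(x, y <- comul h1)
   Phi (act r (projA x) \ox b * projB y) (mul s (mul t h2))).
  by sw_proj projB (fun h : H => h) @RR_projBl.
transitivity (\osum_(r, s <- RR) \osum_(h1, h2 <- comul h) \osum_(b, t <- BR) \osum_(x, y <- comul h2)
   Phi (act r (projA h1) \ox b * projB x) (mul s (mul t y))).
  by sw coassocH.
transitivity (\osum_(r, s <- RR) \osum_(h1, h2 <- comul h) \osum_(x, y <- comul h2) \osum_(b, t <- BR)
   Phi (act r (projA h1) \ox projB y * b) (mul s (mul x t))).
  apply: eq_osum => r s; apply: eq_osum => h1 h2.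
  by rewrite (@cocommBH _ (fun b t => Phi (act r (projA h1) \ox b) (mul s t))) //; lin.
transitivity (\osum_(h1, h2 <- comul h) \osum_(b, t <- BR) \osum_(r, s <- RR) \osum_(x, y <- comul h1)
   Phi (act r (projA x) \ox projB h2 * b) (mul (mul s y) t)).
  by swr coassocH.
transitivity (\osum_(h1, h2 <- comul h) \osum_(b, t <- BR) \osum_(x, y <- comul h1) \osum_(a, r <- AR)
   Phi (act y a \ox projB h2 * b) (mul (mul x r) t)).
  apply: eq_osum => h1 h2; apply: eq_osum => b t.
  by rewrite (@cocommAH _ (fun a s => Phi (a \ox projB h2 * b) (mul s t))) //; lin.
symmetry.
transitivity (\osum_(h1, h2 <- comul h) \osum_(a, r <- AR) \osum_(b, t <- BR)
   Phi (mul h2 (a \ox b)) (mul h1 (mul r t))).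
  by sw osum_RR_AR_BR.
transitivity (\osum_(h1, h2 <- comul h) \osum_(x, y <- comul h2) \osum_(a, r <- AR) \osum_(b, t <- BR)
   Phi (act x a \ox projB y * b) (mul h1 (mul r t))).
  by sw_mul.
by swr coassocH.
Qed.

Lemma RR_quasitriangular : is_smash_quasitriangular DA eA DB eB sigma tau RR.
Proof.
apply/quasitriangularE; split.
- by split; [apply: RR_counit_l | apply: RR_counit_r].
- by rewrite (@comul_RR_l _ (fun x y z => x \ox y \ox z)) //; lin.
- by rewrite (@comul_RR_r _ (fun x y z => x \ox y \ox z)) //; lin.
- by move=> h; rewrite (@cocommHH _ (fun x y => x \ox y)) //; lin.
Qed.

End Components.

(** * The components of a quasitriangular structure *)

Section Projections.
Variable R : H \ox H.
Hypothesis qtR : quasitriangular_sums R.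

Lemma R_comul_l (V : lmodType K) (Phi : H -> H -> H -> V) : trilin Phi ->
  \osum_(r, s <- R) \osum_(r1, r2 <- comul r) Phi r1 r2 s =
  \osum_(r, s <- R) \osum_(r', s' <- R) Phi r r' (mul s s').
Proof. by move=> Phil; case: qtR => _ E _ _; move/(congr1 (osum (fun u vw => osum (Phi u) vw))): E; rewrite !osum_bind3. Qed.

Lemma R_comul_r (V : lmodType K) (Phi : H -> H -> H -> V) : trilin Phi ->
  \osum_(r, s <- R) \osum_(s1, s2 <- comul s) Phi r s1 s2 =
  \osum_(r, s <- R) \osum_(r', s' <- R) Phi (mul r r') s' s.
Proof. by move=> Phil; case: qtR => _ _ E _; move/(congr1 (osum (fun u vw => osum (Phi u) vw))): E; rewrite !osum_bind3. Qed.

Lemma R_comm (V : lmodType K) (Phi : H -> H -> V) : bilin Phi -> forall h,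
  \osum_(r, s <- R) \osum_(h1, h2 <- comul h) Phi (mul r h1) (mul s h2) =
  \osum_(h1, h2 <- comul h) \osum_(r, s <- R) Phi (mul h2 r) (mul h1 s).
Proof. by move=> Phil h; case: qtR => _ _ _ /(_ h) E; move/(congr1 (osum Phi)): E; rewrite !osum_bind2. Qed.

Let W : B \ox B := \osum_(r, s <- R) (projB r \ox projB s).
Let X : A \ox B := \osum_(r, s <- R) (projA r \ox projB s).
Let Y : B \ox A := \osum_(r, s <- R) (projB r \ox projA s).
Let Z : A \ox A := \osum_(r, s <- R) (projA r \ox projA s).

Let osum_W (V : lmodType K) (Phi : B -> B -> V) : bilin Phi ->
  \osum_(v, w <- W) Phi v w = \osum_(r, s <- R) Phi (projB r) (projB s).
Proof.
by move=> Phil; rewrite /W osum_bind //; apply: eq_osum => r s; rewrite osum_tpure.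
Qed.

Let osum_X (V : lmodType K) (Phi : A -> B -> V) : bilin Phi ->
  \osum_(v, w <- X) Phi v w = \osum_(r, s <- R) Phi (projA r) (projB s).
Proof.
by move=> Phil; rewrite /X osum_bind //; apply: eq_osum => r s; rewrite osum_tpure.
Qed.

Let osum_Y (V : lmodType K) (Phi : B -> A -> V) : bilin Phi ->
  \osum_(v, w <- Y) Phi v w = \osum_(r, s <- R) Phi (projB r) (projA s).
Proof.
by move=> Phil; rewrite /Y osum_bind //; apply: eq_osum => r s; rewrite osum_tpure.
Qed.

Let osum_Z (V : lmodType K) (Phi : A -> A -> V) : bilin Phi ->
  \osum_(v, w <- Z) Phi v w = \osum_(r, s <- R) Phi (projA r) (projA s).
Proof.
by move=> Phil; rewrite /Z osum_bind //; apply: eq_osum => r s; rewrite osum_tpure.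
Qed.

Ltac leaf := rewrite ?projA_mul ?projB_mul ?act_mul ?mulrA; reflexivity.

(** The first leg of R is rebuilt from its projections, and the coproduct
    axiom turns the two parts into two copies of R.  The next four lemmas follow
    the same pattern. *)
Lemma osum_RB_R (V : lmodType K) (Phi : H -> B -> V) : bilin Phi ->
  \osum_(r, b <- RB W X) Phi r b = \osum_(r, s <- R) Phi r (projB s).
Proof.
move=> Phil; symmetry.
transitivity (\osum_(r, s <- R) \osum_(r1, r2 <- comul r) Phi (projA r1 \ox projB r2) (projB s)).
  by apply: eq_osum => r s; rewrite (@comul_AB_id _ (fun r => Phi r (projB s))) //; lin.
transitivity (\osum_(r, s <- R) \osum_(r', s' <- R)
    Phi (projA r \ox projB r') (projB s * projB s')).
  by sweedler ltac:(apply R_comul_l; lin) ltac:(leaf).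
rewrite osum_RB; last by lin.
rewrite osum_X; last by lin.
by symmetry; sw osum_W.
Qed.

Lemma osum_BR_R (V : lmodType K) (Phi : B -> H -> V) : bilin Phi ->
  \osum_(b, r <- BR W Y) Phi b r = \osum_(r, s <- R) Phi (projB r) s.
Proof.
move=> Phil; symmetry.
transitivity (\osum_(r, s <- R) \osum_(s1, s2 <- comul s) Phi (projB r) (projA s1 \ox projB s2)).
  by apply: eq_osum => r s; rewrite (@comul_AB_id _ (Phi (projB r))) //; lin.
transitivity (\osum_(r, s <- R) \osum_(r', s' <- R)
    Phi (projB r * projB r') (projA s' \ox projB s)).
  by sweedler ltac:(apply R_comul_r; lin) ltac:(leaf).
rewrite osum_BR; last by lin.
rewrite osum_W; last by lin.
by symmetry; sw osum_Y.
Qed.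

Lemma osum_AR_R (V : lmodType K) (Phi : A -> H -> V) : bilin Phi ->
  \osum_(a, r <- AR W X Z) Phi a r = \osum_(r, s <- R) Phi (projA r) s.
Proof.
move=> Phil; symmetry.
transitivity (\osum_(r, s <- R) \osum_(s1, s2 <- comul s) Phi (projA r) (projA s1 \ox projB s2)).
  by apply: eq_osum => r s; rewrite (@comul_AB_id _ (Phi (projA r))) //; lin.
transitivity (\osum_(r, s <- R) \osum_(r', s' <- R)
    Phi (act r (projA r')) (projA s' \ox projB s)).
  by sweedler ltac:(apply R_comul_r; lin) ltac:(leaf).
rewrite osum_AR; last by lin.
rewrite osum_RB_R; last by lin.
by symmetry; sw osum_Z.
Qed.

Lemma osum_RA_R (V : lmodType K) (Phi : H -> A -> V) : bilin Phi ->
  \osum_(r, a <- RA W X Y Z) Phi r a = \osum_(r, s <- R) Phi r (projA s).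
Proof.
move=> Phil; symmetry.
transitivity (\osum_(r, s <- R) \osum_(r1, r2 <- comul r) Phi (projA r1 \ox projB r2) (projA s)).
  by apply: eq_osum => r s; rewrite (@comul_AB_id _ (fun r => Phi r (projA s))) //; lin.
transitivity (\osum_(r, s <- R) \osum_(r', s' <- R)
    Phi (projA r \ox projB r') (act s (projA s'))).
  by sweedler ltac:(apply R_comul_l; lin) ltac:(leaf).
rewrite osum_RA; last by lin.
rewrite osum_AR_R; last by lin.
by symmetry; sw osum_Y.
Qed.

Lemma osum_RR_R (V : lmodType K) (Phi : H -> H -> V) : bilin Phi ->
  \osum_(r, s <- RR W X Y Z) Phi r s = \osum_(r, s <- R) Phi r s.
Proof.
move=> Phil; symmetry.
transitivity (\osum_(r, s <- R) \osum_(s1, s2 <- comul s) Phi r (projA s1 \ox projB s2)).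
  by apply: eq_osum => r s; rewrite (@comul_AB_id _ (Phi r)) //; lin.
transitivity (\osum_(r, s <- R) \osum_(r', s' <- R) Phi (mul r r') (projA s' \ox projB s)).
  by sw R_comul_r.
rewrite osum_RR; last by lin.
rewrite osum_RB_R; last by lin.
by symmetry; sw osum_RA_R.
Qed.

Lemma RR_R : RR W X Y Z = R.
Proof. by rewrite -[LHS]osum_tpure_id osum_RR_R ?osum_tpure_id //; lin. Qed.

Lemma R_normalized : [/\ normalized eB eB W, normalized eA eB X,
  normalized eB eA Y & normalized eA eA Z].
Proof.
case: qtR => -[l r] _ _ _.
have El (V : lmodType K) (f : H -> V) : is_linear f -> \osum_(r, s <- R) counit r *: f s = f one.
  move=> fl; rewrite -l linear_osum //; apply: eq_osum => x y; by rewrite is_linearZ.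
have Er (V : lmodType K) (f : H -> V) : is_linear f -> \osum_(r, s <- R) counit s *: f r = f one.
  move=> fl; rewrite -r linear_osum //; apply: eq_osum => x y; by rewrite is_linearZ.
split; split; rewrite ?(osum_W, osum_X, osum_Y, osum_Z); try by lin.
- by rewrite -projB_one -El; [apply: eq_osum => x y; rewrite eB_projB | lin].
- by rewrite -projB_one -Er; [apply: eq_osum => x y; rewrite eB_projB | lin].
- by rewrite -projB_one -El; [apply: eq_osum => x y; rewrite eA_projA | lin].
- by rewrite -projA_one -Er; [apply: eq_osum => x y; rewrite eB_projB | lin].
- by rewrite -projA_one -El; [apply: eq_osum => x y; rewrite eB_projB | lin].
- by rewrite -projB_one -Er; [apply: eq_osum => x y; rewrite eA_projA | lin].
- by rewrite -projA_one -El; [apply: eq_osum => x y; rewrite eA_projA | lin].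
- by rewrite -projA_one -Er; [apply: eq_osum => x y; rewrite eA_projA | lin].
Qed.

Lemma R_comul_components : comul_components W X Y Z.
Proof.
split=> V Phi Phil.
- rewrite osum_X; last by lin.
  transitivity (\osum_(r, s <- R) \osum_(r1, r2 <- comul r) Phi (projA r1) (projA r2) (projB s)).
    by sw comul_projA.
  transitivity (\osum_(r, s <- R) \osum_(r', s' <- R) Phi (projA r) (projA r') (projB s * projB s')).
    by sweedler ltac:(apply R_comul_l; lin) ltac:(leaf).
  rewrite osum_X; last by lin.
  by symmetry; sw osum_X.
- rewrite osum_W; last by lin.
  transitivity (\osum_(r, s <- R) \osum_(r1, r2 <- comul r) Phi (projB r1) (projB r2) (projB s)).
    by sw comul_projB.
  transitivity (\osum_(r, s <- R) \osum_(r', s' <- R) Phi (projB r) (projB r') (projB s * projB s')).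
    by sweedler ltac:(apply R_comul_l; lin) ltac:(leaf).
  rewrite osum_W; last by lin.
  by symmetry; sw osum_W.
- transitivity (\osum_(r, b <- RB W X) \osum_(vt, xt <- tau r) Phi vt xt b).
    by rewrite osum_RB //; lin.
  rewrite osum_RB_R; last by lin.
  transitivity (\osum_(r, s <- R) \osum_(r1, r2 <- comul r) Phi (projB r1) (projA r2) (projB s)).
    apply: eq_osum => r s; rewrite (@comul_BA _ (fun x y => Phi x y (projB s))) //; lin.
  transitivity (\osum_(r, s <- R) \osum_(r', s' <- R) Phi (projB r) (projA r') (projB s * projB s')).
    by sweedler ltac:(apply R_comul_l; lin) ltac:(leaf).
  rewrite osum_W; last by lin.
  by symmetry; sw osum_X.
- rewrite osum_Z; last by lin.
  transitivity (\osum_(r, s <- R) \osum_(r1, r2 <- comul r) Phi (projA r1) (projA r2) (projA s)).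
    by sw comul_projA.
  transitivity (\osum_(r, s <- R) \osum_(r', s' <- R) Phi (projA r) (projA r') (act s (projA s'))).
    by sweedler ltac:(apply R_comul_l; lin) ltac:(leaf).
  rewrite osum_AR_R; last by lin.
  by symmetry; sw osum_Z.
- rewrite osum_Y; last by lin.
  transitivity (\osum_(r, s <- R) \osum_(r1, r2 <- comul r) Phi (projB r1) (projB r2) (projA s)).
    by sw comul_projB.
  transitivity (\osum_(r, s <- R) \osum_(r', s' <- R) Phi (projB r) (projB r') (act s (projA s'))).
    by sweedler ltac:(apply R_comul_l; lin) ltac:(leaf).
  rewrite osum_BR_R; last by lin.
  by symmetry; sw osum_Y.
- rewrite osum_RA_R; last by lin.
  transitivity (\osum_(r, s <- R) \osum_(r1, r2 <- comul r) Phi (projB r1) (projA r2) (projA s)).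
    apply: eq_osum => r s; rewrite (@comul_BA _ (fun x y => Phi x y (projA s))) //; lin.
  transitivity (\osum_(r, s <- R) \osum_(r', s' <- R) Phi (projB r) (projA r') (act s (projA s'))).
    by sweedler ltac:(apply R_comul_l; lin) ltac:(leaf).
  rewrite osum_BR_R; last by lin.
  by symmetry; sw osum_Z.
- rewrite osum_X; last by lin.
  transitivity (\osum_(r, s <- R) \osum_(s1, s2 <- comul s) Phi (projA r) (projB s1) (projB s2)).
    by sw comul_projB.
  transitivity (\osum_(r, s <- R) \osum_(r', s' <- R) Phi (act r (projA r')) (projB s') (projB s)).
    by sweedler ltac:(apply R_comul_r; lin) ltac:(leaf).
  rewrite osum_RB_R; last by lin.
  by symmetry; sw osum_X.
- rewrite osum_W; last by lin.
  transitivity (\osum_(r, s <- R) \osum_(s1, s2 <- comul s) Phi (projB r) (projB s1) (projB s2)).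
    by sw comul_projB.
  transitivity (\osum_(r, s <- R) \osum_(r', s' <- R) Phi (projB r * projB r') (projB s') (projB s)).
    by sweedler ltac:(apply R_comul_r; lin) ltac:(leaf).
  rewrite osum_W; last by lin.
  by symmetry; sw osum_W.
- transitivity (\osum_(b, r <- BR W Y) \osum_(vt, xt <- tau r) Phi b vt xt).
    by rewrite osum_BR //; lin.
  rewrite osum_BR_R; last by lin.
  transitivity (\osum_(r, s <- R) \osum_(s1, s2 <- comul s) Phi (projB r) (projB s1) (projA s2)).
    apply: eq_osum => r s; rewrite (@comul_BA _ (Phi (projB r))) //; lin.
  transitivity (\osum_(r, s <- R) \osum_(r', s' <- R) Phi (projB r * projB r') (projB s') (projA s)).
    by sweedler ltac:(apply R_comul_r; lin) ltac:(leaf).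
  rewrite osum_Y; last by lin.
  by symmetry; sw osum_W.
- rewrite osum_Z; last by lin.
  transitivity (\osum_(r, s <- R) \osum_(s1, s2 <- comul s) Phi (projA r) (projA s1) (projA s2)).
    by sw comul_projA.
  transitivity (\osum_(r, s <- R) \osum_(r', s' <- R) Phi (act r (projA r')) (projA s') (projA s)).
    by sweedler ltac:(apply R_comul_r; lin) ltac:(leaf).
  rewrite osum_RA_R; last by lin.
  by symmetry; sw osum_Z.
- rewrite osum_Y; last by lin.
  transitivity (\osum_(r, s <- R) \osum_(s1, s2 <- comul s) Phi (projB r) (projA s1) (projA s2)).
    by sw comul_projA.
  transitivity (\osum_(r, s <- R) \osum_(r', s' <- R) Phi (projB r * projB r') (projA s') (projA s)).
    by sweedler ltac:(apply R_comul_r; lin) ltac:(leaf).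
  rewrite osum_Y; last by lin.
  by symmetry; sw osum_Y.
- rewrite osum_AR_R; last by lin.
  transitivity (\osum_(r, s <- R) \osum_(s1, s2 <- comul s) Phi (projA r) (projB s1) (projA s2)).
    apply: eq_osum => r s; rewrite (@comul_BA _ (Phi (projA r))) //; lin.
  transitivity (\osum_(r, s <- R) \osum_(r', s' <- R) Phi (act r (projA r')) (projB s') (projA s)).
    by sweedler ltac:(apply R_comul_r; lin) ltac:(leaf).
  rewrite osum_RA_R; last by lin.
  by symmetry; sw osum_X.
Qed.

Lemma R_cocomm_components : cocomm_components W X Y Z.
Proof.
split=> V Phi Phil.
- move=> a; rewrite osum_RR_R; last by lin.
  transitivity (\osum_(r, s <- R) \osum_(h1, h2 <- comul (a \ox 1)) Phi (projA (mul r h1)) (projA (mul s h2))).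
    rewrite -[a in LHS](_ : projA (a \ox 1) = a); last by rewrite projA_tpure eB1 scale1r.
    by sweedler ltac:(apply comul_projA; lin) ltac:(rewrite !projA_mul; reflexivity).
  rewrite (R_comm (Phi := fun x y => Phi (projA x) (projA y))); last by lin.
  by symmetry; sweedler ltac:(apply osum_Z; lin) ltac:(rewrite !projA_mul; reflexivity).
- move=> a; rewrite osum_RB_R; last by lin.
  symmetry.
  transitivity (\osum_(h1, h2 <- comul (a \ox 1)) \osum_(r, s <- R) Phi (projA (mul h2 r)) (projB (mul h1 s))).
    by sweedler ltac:(apply osum_X; lin) ltac:(rewrite projA_mul projB_mul; reflexivity).
  rewrite -(R_comm (Phi := fun x y => Phi (projA x) (projB y))); last by lin.
  apply: eq_osum => r s.
  transitivity (\osum_(h1, h2 <- comul (a \ox 1)) Phi (act r (projA h1)) (projB s * projB h2)).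
    by reorder ltac:(leaf).
  rewrite (@comul_tpure_B _ (fun h b => Phi (act r (projA h)) (projB s * b))); last by lin.
  by rewrite DB1 osum_tpure ?mulr1 ?projA_tpure ?eB1 ?scale1r //; lin.
- move=> a; rewrite osum_BR_R; last by lin.
  transitivity (\osum_(r, s <- R) \osum_(h1, h2 <- comul (a \ox 1)) Phi (projB (mul r h1)) (projA (mul s h2))).
    apply: eq_osum => r s.
    rewrite -(@comul_BA _ (fun u x => Phi (projB r * u) (act s x))); last by lin.
    by reorder ltac:(leaf).
  rewrite (R_comm (Phi := fun x y => Phi (projB x) (projA y))); last by lin.
  rewrite osum_Y; last by lin.
  rewrite exchange_osum; apply: eq_osum => r s.
  transitivity (\osum_(h1, h2 <- comul (a \ox 1)) Phi (projB h2 * projB r) (act h1 (projA s))).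
    by reorder ltac:(leaf).
  rewrite (@comul_tpure_B _ (fun h b => Phi (b * projB r) (act h (projA s)))); last by lin.
  by rewrite DB1 osum_tpure ?mul1r ?act_tpure1 //; lin.
- move=> b; symmetry.
  transitivity (\osum_(h1, h2 <- comul (1 \ox b)) \osum_(r, s <- R) Phi (projA (mul h2 r)) (projA (mul h1 s))).
    by sweedler ltac:(apply osum_Z; lin) ltac:(rewrite !projA_mul; reflexivity).
  rewrite -(R_comm (Phi := fun x y => Phi (projA x) (projA y))); last by lin.
  rewrite osum_Z // scaler_osum; apply: eq_osum => r s.
  transitivity (\osum_(h1, h2 <- comul (1 \ox b)) Phi (act r (projA h1)) (act s (projA h2))).
    by reorder ltac:(leaf).
  rewrite -(@comul_projA _ (fun x y => Phi (act r x) (act s y))); last by lin.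
  rewrite projA_tpure; pull_scale (eB b); congr (_ *: _).
  by rewrite DA1 osum_tpure ?act_1 //; lin.
- move=> b; symmetry.
  transitivity (\osum_(h1, h2 <- comul (1 \ox b)) \osum_(r, s <- R) Phi (projA (mul h2 r)) (projB (mul h1 s))).
    by sweedler ltac:(apply osum_X; lin) ltac:(rewrite projA_mul projB_mul; reflexivity).
  rewrite -(R_comm (Phi := fun x y => Phi (projA x) (projB y))); last by lin.
  rewrite osum_X; last by lin.
  apply: eq_osum => r s.
  transitivity (\osum_(h1, h2 <- comul (1 \ox b)) Phi (act r (projA h1)) (projB s * projB h2)).
    by reorder ltac:(leaf).
  rewrite (@comul_tpure_B _ (fun h b => Phi (act r (projA h)) (projB s * b))); last by lin.
  rewrite -[RHS](@counitBl _ (fun b => Phi (projA r) (projB s * b))); last by lin.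
  by apply: eq_osum => b1 b2; rewrite projA_tpure; pull_scale (eB b1); rewrite act_1.
- move=> b; rewrite osum_BR_R; last by lin.
  transitivity (\osum_(r, s <- R) \osum_(h1, h2 <- comul (1 \ox b)) Phi (projB (mul r h1)) (projA (mul s h2))).
    apply: eq_osum => r s.
    rewrite -(@comul_BA _ (fun u x => Phi (projB r * u) (act s x))); last by lin.
    by reorder ltac:(leaf).
  rewrite (R_comm (Phi := fun x y => Phi (projB x) (projA y))); last by lin.
  rewrite osum_Y; last by lin.
  rewrite exchange_osum; apply: eq_osum => r s.
  transitivity (\osum_(h1, h2 <- comul (1 \ox b)) Phi (projB h2 * projB r) (act h1 (projA s))).
    by reorder ltac:(leaf).
  by rewrite (@comul_tpure_B _ (fun h b => Phi (b * projB r) (act h (projA s)))); last by lin.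
- move=> b.
  have Eb : projB (1 \ox b) = b by rewrite projB_tpure eA1 scale1r.
  rewrite osum_W; last by lin.
  transitivity (\osum_(r, s <- R) \osum_(h1, h2 <- comul (1 \ox b)) Phi (projB (mul r h1)) (projB (mul s h2))).
    rewrite -[b in LHS]Eb.
    by sweedler ltac:(apply comul_projB; lin) ltac:(leaf).
  rewrite (R_comm (Phi := fun x y => Phi (projB x) (projB y))); last by lin.
  rewrite osum_W; last by lin.
  symmetry; rewrite -[b in LHS]Eb.
  by sweedler ltac:(apply comul_projB; lin) ltac:(leaf).
Qed.

End Projections.

(** * The component identities in terms of sigma and tau *)

Lemma act_expand (V : lmodType K) (f : A -> V) : is_linear f -> forall a b x,
  f (act (a \ox b) x) = \osum_(xs, bs <- sigma (b \ox x)) eB bs *: f (a * xs).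
Proof.
move=> fl a b x; rewrite act_tpure linear_osum //.
by apply: eq_osum => xs bs; rewrite is_linearZ.
Qed.

(** Acting by b * c is acting by c and then by b. *)
Lemma act_expand2 (V : lmodType K) (f : A -> V) : is_linear f -> forall a b c x,
  f (act (a \ox (b * c)) x) = \osum_(xs1, cs1 <- sigma (c \ox x))
    \osum_(xs1s2, bs2 <- sigma (b \ox xs1)) eB (bs2 * cs1) *: f (a * xs1s2).
Proof.
move=> fl a b c x; rewrite -mul_tpure_1l act_mul.
rewrite (@act_expand _ (fun y => f (act (a \ox b) y))); last by lin.
apply: eq_osum => xs1 cs1; rewrite mul1r (act_expand fl) scaler_osum.
by apply: eq_osum => xs2 bs2; rewrite scalerA eBM mulrC.
Qed.

Ltac expand_act :=
  lazymatch goal with |- ?L = _ =>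
    lazymatch L with context [act (?a \ox ?b) ?x] =>
      lazymatch eval pattern (act (a \ox b) x) in L with ?F _ =>
        refine (@act_expand _ F _ a b x); lin end end end.

Ltac scalars :=
  rewrite ?scalerA ?mul1r ?mulrA; first
   [ reflexivity
   | congr (_ *: _); rewrite ?eBM; first [reflexivity | exact: mulrC | rewrite mulrC ?mulrA; reflexivity
       | rewrite -?mulrA mulrC -?mulrA; reflexivity | rewrite [RHS]mulrC ?mulrA; reflexivity] ].
Ltac sw_act := sweedler ltac:(idtac; expand_act) ltac:(scalars).

Lemma comul_tpure1_BH (V : lmodType K) (Phi : B -> H -> V) : bilin Phi -> forall a,
  \osum_(h1, h2 <- comul (a \ox 1)) Phi (projB h1) h2 =
  \osum_(u, at' <- tau (a \ox 1)) Phi u (at' \ox 1).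
Proof. by move=> Phil a; rewrite comul_tpure_BH // DB1 osum_tpure //; lin. Qed.

Lemma comul_tpure1 (V : lmodType K) (Phi : H -> H -> V) : bilin Phi -> forall a,
  \osum_(h1, h2 <- comul (a \ox 1)) Phi h1 h2 =
  \osum_(a1, a2 <- DA a) \osum_(u, a2t <- tau (a2 \ox 1)) Phi (a1 \ox u) (a2t \ox 1).
Proof.
move=> Phil a; rewrite osum_comul_tpure //; apply: eq_osum => a1 a2.
by rewrite DB1 osum_tpure //; lin.
Qed.

Lemma comul_1tpure (V : lmodType K) (Phi : H -> H -> V) : bilin Phi -> forall b,
  \osum_(h1, h2 <- comul (1 \ox b)) Phi h1 h2 =
  \osum_(b1, b2 <- DB b) \osum_(b1t, v <- tau (1 \ox b1)) Phi (1 \ox b1t) (v \ox b2).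
Proof. by move=> Phil b; rewrite osum_comul_tpure // DA1 osum_tpure //; lin. Qed.

(** A is a left comodule algebra over B through a |-> tau (a \ox 1). *)
Lemma tau_mulA (V : lmodType K) (Phi : B -> A -> V) : bilin Phi -> forall a a',
  \osum_(u, x <- tau ((a * a') \ox 1)) Phi u x =
  \osum_(u, at' <- tau (a \ox 1)) \osum_(u', a't <- tau (a' \ox 1)) Phi (u * u') (at' * a't).
Proof.
move=> Phil a a'; rewrite -mul_tpure_1r tau_mul //.
rewrite (@comul_tpure1_BH _ (fun b h => \osum_(u, x <- tau (a' \ox 1)) Phi (b * u) (act h x))); last by lin.
by apply: eq_osum => u x; apply: eq_osum => u' x'; rewrite act_tpure1.
Qed.

Section Translation.
Variables (W : B \ox B) (X : A \ox B) (Y : B \ox A) (Z : A \ox A).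
Local Notation RB := (RB W X).
Local Notation BR := (BR W Y).
Local Notation AR := (AR W X Z).
Local Notation RA := (RA W X Y Z).
Local Notation RR := (RR W X Y Z).

Lemma RB_act (V : lmodType K) (Phi : A -> B -> V) : bilin Phi -> forall a,
  \osum_(X1, X2 <- X) \osum_(W1, W2 <- W) \osum_(a_s, W1s <- sigma (W1 \ox a))
      (eB W1s *: Phi (X1 * a_s) (X2 * W2)) =
  \osum_(r, b <- RB) Phi (act r a) b.
Proof.
move=> Phil a; symmetry; rewrite osum_RB; last by lin.
by sw_act.
Qed.

Lemma comul_X (V : lmodType K) (Phi : A -> B -> V) : bilin Phi -> forall a,
  \osum_(X1, X2 <- X) \osum_(u, a_t <- tau (a \ox 1)) Phi (a_t * X1) (u * X2) =
  \osum_(h1, h2 <- comul (a \ox 1)) \osum_(x, y <- X) Phi (act h2 x) (projB h1 * y).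
Proof.
move=> Phil a; symmetry.
transitivity (\osum_(u, a_t <- tau (a \ox 1)) \osum_(x, y <- X) Phi (act (a_t \ox 1) x) (u * y)).
  by sw_proj projB (fun h : H => h) @comul_tpure1_BH.
by reorder ltac:(rewrite ?act_tpure1; reflexivity).
Qed.

Lemma BR_tau (V : lmodType K) (Phi : B -> A -> V) : bilin Phi -> forall t : B \ox A,
  \osum_(W1, W2 <- W) \osum_(Y1, Y2 <- Y) \osum_(u, v <- t)
    \osum_(vs, W2s <- sigma (W2 \ox v)) (eB W2s *: Phi (W1 * Y1 * u) (Y2 * vs)) =
  \osum_(b, r <- BR) \osum_(u, v <- t) Phi (b * u) (act r v).
Proof.
move=> Phil t; symmetry; rewrite osum_BR; last by lin.
by sw_act.
Qed.

Lemma comul_ZZ_B (V : lmodType K) (Phi : A -> A -> V) : bilin Phi -> forall b,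
  \osum_(Z1, Z2 <- Z) \osum_(b1, b2 <- DB b)
      \osum_(b1t, v <- tau (1 \ox b1)) \osum_(Z1s1, b2s1 <- sigma (b2 \ox Z1))
      \osum_(Z2s2, b1ts2 <- sigma (b1t \ox Z2))
        ((eB b1ts2 * eB b2s1) *: Phi (v * Z1s1) Z2s2) =
  \osum_(h1, h2 <- comul (1 \ox b)) \osum_(z, z' <- Z) Phi (act h2 z) (act h1 z').
Proof.
move=> Phil b; symmetry; rewrite comul_1tpure; last by lin.
transitivity (\osum_(b1, b2 <- DB b) \osum_(b1t, v <- tau (1 \ox b1)) \osum_(z, z' <- Z)
  \osum_(z's, b1ts <- sigma (b1t \ox z')) eB b1ts *: Phi (act (v \ox b2) z) z's).
  apply: eq_osum => b1 b2; apply: eq_osum => b1t v; apply: eq_osum => z z'.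
  rewrite (@act_expand _ (Phi (act (v \ox b2) z))); last by lin.
  by apply: eq_osum => xs bs; rewrite mul1r.
by sw_act.
Qed.

Lemma comul_X_B (V : lmodType K) (Phi : A -> B -> V) : bilin Phi -> forall b,
  \osum_(X1, X2 <- X) \osum_(b1, b2 <- DB b)
      \osum_(b1t, v <- tau (1 \ox b1)) \osum_(X1s, b2s <- sigma (b2 \ox X1))
        (eB b2s *: Phi (v * X1s) (b1t * X2)) =
  \osum_(h1, h2 <- comul (1 \ox b)) \osum_(x, y <- X) Phi (act h2 x) (projB h1 * y).
Proof.
move=> Phil b; symmetry.
transitivity (\osum_(b1, b2 <- DB b) \osum_(b1t, v <- tau (1 \ox b1)) \osum_(x, y <- X) Phi (act (v \ox b2) x) (b1t * y)).
  by sw_proj projB (fun h : H => h) @comul_tpure_BH.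
by sw_act.
Qed.

Lemma sigma_Y (V : lmodType K) (Phi : B -> A -> V) : bilin Phi -> forall b,
  \osum_(Y1, Y2 <- Y) \osum_(Y2s, bs <- sigma (b \ox Y2)) Phi (bs * Y1) Y2s =
  \osum_(y, x <- Y) \osum_(b1, b2 <- DB b) Phi (b2 * y) (act (1 \ox b1) x).
Proof. by move=> Phil b; sw sigma_act. Qed.

Lemma BR_Z (V : lmodType K) (Phi : B -> A -> A -> V) : trilin Phi ->
  \osum_(W1, W2 <- W) \osum_(Y1, Y2 <- Y) \osum_(Z1, Z2 <- Z)
      \osum_(Z2s, W2s <- sigma (W2 \ox Z2)) (eB W2s *: Phi (W1 * Y1) Z1 (Y2 * Z2s)) =
  \osum_(b, r <- BR) \osum_(x, y <- Z) Phi b x (act r y).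
Proof.
move=> Phil; symmetry; rewrite osum_BR; last by lin.
by sw_act.
Qed.

Lemma BR_Y (V : lmodType K) (Phi : B -> B -> A -> V) : trilin Phi ->
  \osum_(W1, W2 <- W) \osum_(Y1, Y2 <- Y) \osum_(Y1', Y2' <- Y)
      \osum_(Y2's, W2s <- sigma (W2 \ox Y2')) (eB W2s *: Phi (W1 * Y1) Y1' (Y2 * Y2's)) =
  \osum_(b, r <- BR) \osum_(x, y <- Y) Phi b x (act r y).
Proof.
move=> Phil; symmetry; rewrite osum_BR; last by lin.
by sw_act.
Qed.

Lemma RB_X (V : lmodType K) (Phi : A -> B -> B -> V) : trilin Phi ->
  \osum_(X1, X2 <- X) \osum_(X1', X2' <- X) \osum_(W1, W2 <- W)
      \osum_(X1's, W1s <- sigma (W1 \ox X1'))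
        (eB W1s *: Phi (X1 * X1's) X2' (X2 * W2)) =
  \osum_(r, b <- RB) \osum_(x, y <- X) Phi (act r x) y b.
Proof.
move=> Phil; symmetry; rewrite osum_RB; last by lin.
by sw_act.
Qed.

Hypothesis cAB : forall (V : lmodType K) (Phi : A -> B -> V), bilin Phi -> forall a,
  \osum_(r, b <- RB) Phi (act r a) b =
  \osum_(h1, h2 <- comul (a \ox 1)) \osum_(x, y <- X) Phi (act h2 x) (projB h1 * y).

(** The identity for X and W that comes from a \ox 1 replaces an action of W by
    a coaction through tau.  This is what relates the definition of AR to the
    expressions with tau in the nineteen identities and in alpha. *)
Lemma RB_act_tau (V : lmodType K) (Phi : A -> B -> V) : bilin Phi -> forall a,
  \osum_(r, b <- RB) Phi (act r a) b =
  \osum_(X1, X2 <- X) \osum_(u, a_t <- tau (a \ox 1)) Phi (a_t * X1) (u * X2).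
Proof. by move=> Phil a; rewrite cAB // comul_X. Qed.

Lemma AR_tau (V : lmodType K) (Phi : A -> H -> V) : bilin Phi ->
  \osum_(a, r <- AR) Phi a r =
  \osum_(Z1, Z2 <- Z) \osum_(X1, X2 <- X) \osum_(u, Z1t <- tau (Z1 \ox 1))
    Phi (Z1t * X1) (Z2 \ox (u * X2)).
Proof.
move=> Phil; rewrite osum_AR; last by lin.
rewrite exchange_osum; apply: eq_osum => z z'.
by rewrite (@RB_act_tau _ (fun a b => Phi a (z' \ox b))) //; lin.
Qed.

Lemma AR_Z (V : lmodType K) (Phi : A -> A -> A -> V) : trilin Phi ->
  \osum_(Z1, Z2 <- Z) \osum_(X1, X2 <- X) \osum_(Z1', Z2' <- Z)
      \osum_(u, Z1t <- tau (Z1 \ox 1)) \osum_(Z2's, bs <- sigma ((u * X2) \ox Z2'))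
        (eB bs *: Phi (Z1t * X1) Z1' (Z2 * Z2's)) =
  \osum_(a, r <- AR) \osum_(x, y <- Z) Phi a x (act r y).
Proof.
move=> Phil; symmetry; rewrite AR_tau; last by lin.
by sw_act.
Qed.

Lemma RA_tau (V : lmodType K) (Phi : B -> A -> A -> V) : trilin Phi ->
  \osum_(Y1, Y2 <- Y) \osum_(Z1, Z2 <- Z) \osum_(X1, X2 <- X)
      \osum_(u2, Z1t2 <- tau (Z1 \ox 1))
      \osum_(Y1t1, ZXt1 <- tau ((Z1t2 * X1) \ox Y1))
      \osum_(Y2s, bs <- sigma ((u2 * X2) \ox Y2))
      (eB bs *: Phi Y1t1 ZXt1 (Z2 * Y2s)) =
  \osum_(r, a <- RA) \osum_(b, x <- tau r) Phi b x a.
Proof.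
move=> Phil; symmetry; rewrite osum_RA; last by lin.
rewrite AR_tau; last by lin.
by sw_act.
Qed.

Lemma AR_tau2 (V : lmodType K) (Phi : A -> B -> A -> V) : trilin Phi ->
  \osum_(Z1, Z2 <- Z) \osum_(X1, X2 <- X) \osum_(u1, Z1t1 <- tau (Z1 \ox 1))
    \osum_(bt2, Z2t2 <- tau (Z2 \ox (u1 * X2))) Phi (Z1t1 * X1) bt2 Z2t2 =
  \osum_(a, r <- AR) \osum_(b, x <- tau r) Phi a b x.
Proof. by move=> Phil; rewrite AR_tau //; lin. Qed.

(** The factor T is Z or X: the two identities for the second legs of Z and of
    tau on AR have the same shape. *)
Lemma RA_act (V U : lmodType K) (T : A \ox U) (Phi : A -> U -> A -> V) : trilin Phi ->
  \osum_(Z1, Z2 <- Z) \osum_(X1, X2 <- X) \osum_(T1, T2 <- T)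
      \osum_(Y1, Y2 <- Y) \osum_(u, Z1t <- tau (Z1 \ox 1))
      \osum_(T1s1, Y1s1 <- sigma (Y1 \ox T1))
      \osum_(Y2s2, bs2 <- sigma ((u * X2) \ox Y2))
        ((eB Y1s1 * eB bs2) *: Phi (Z1t * X1 * T1s1) T2 (Z2 * Y2s2)) =
  \osum_(r, a <- RA) \osum_(x, y <- T) Phi (act r x) y a.
Proof.
move=> Phil; symmetry; rewrite osum_RA; last by lin.
rewrite AR_tau; last by lin.
transitivity (\osum_(Z1, Z2 <- Z) \osum_(X1, X2 <- X) \osum_(u, Z1t <- tau (Z1 \ox 1))
   \osum_(Y1, Y2 <- Y) \osum_(T1, T2 <- T) \osum_(T1s1, Y1s1 <- sigma (Y1 \ox T1))
   \osum_(Y2s2, bs2 <- sigma ((u * X2) \ox Y2))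
        ((eB Y1s1 * eB bs2) *: Phi (Z1t * X1 * T1s1) T2 (Z2 * Y2s2))); last by reorder sw_assoc.
do 3 (apply: eq_osum => ? ?); apply: eq_osum => Y1 Y2; apply: eq_osum => T1 T2.
rewrite (@act_expand _ (fun x => Phi x T2 _)); last by lin.
apply: eq_osum => T1s1 Y1s1; rewrite (@act_expand _ (Phi _ T2)); last by lin.
by rewrite scaler_osum; apply: eq_osum => Y2s2 bs2; rewrite scalerA.
Qed.

Hypothesis normX : normalized eA eB X.
Hypothesis comps : comul_components W X Y Z.

(** In alpha the coaction by tau is spelled out on the product Z1t * X1', by
    [tau_mulA], and the action of u1 * X2' on Y2 by [act_expand2]. *)
Lemma osum_RR_alpha (V : lmodType K) (Phi : H -> H -> V) : bilin Phi ->
  \osum_(r, s <- RR) Phi r s =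
  \osum_(Z1, Z2 <- Z) \osum_(X1', X2' <- X) \osum_(X1, X2 <- X)
  \osum_(W1, W2 <- W) \osum_(Y1, Y2 <- Y)
  \osum_(u1, Z1t1 <- tau (Z1 \ox 1)) \osum_(u2, Z1t1t2 <- tau (Z1t1 \ox 1))
  \osum_(u3, X1't3 <- tau (X1' \ox 1))
  \osum_(Y2s1, X2's1 <- sigma (X2' \ox Y2))
  \osum_(Y2s1s2, u1s2 <- sigma (u1 \ox Y2s1))
    (eB (u1s2 * X2's1) *:
      Phi ((Z1t1t2 * X1't3 * X1) \ox (W1 * Y1)) ((Z2 * Y2s1s2) \ox (u2 * u3 * X2 * W2))).
Proof.
move=> Phil; rewrite osum_RR_split //.
transitivity (\osum_(a, s <- AR) \osum_(v, w <- W) \osum_(y, x <- Y)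
   \osum_(X1, X2 <- X) \osum_(u, at' <- tau (a \ox 1))
      Phi ((at' * X1) \ox v * y) (act s x \ox (u * X2 * w))).
  transitivity (\osum_(a, s <- AR) \osum_(v, w <- W) \osum_(y, x <- Y) \osum_(r, b <- RB)
    Phi (act r a \ox v * y) (act s x \ox b * w)).
    by reorder sw_assoc.
  do 3 (apply: eq_osum => ? ?).
  by rewrite (@RB_act_tau _ (fun a b => Phi (a \ox _) (_ \ox b * _))) //; lin.
rewrite AR_tau; last by lin.
transitivity (\osum_(Z1, Z2 <- Z) \osum_(X1', X2' <- X) \osum_(X1, X2 <- X)
  \osum_(W1, W2 <- W) \osum_(Y1, Y2 <- Y)
  \osum_(u1, Z1t1 <- tau (Z1 \ox 1)) \osum_(u2, Z1t1t2 <- tau (Z1t1 \ox 1))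
  \osum_(u3, X1't3 <- tau (X1' \ox 1))
  Phi ((Z1t1t2 * X1't3 * X1) \ox (W1 * Y1)) (act (Z2 \ox (u1 * X2')) Y2 \ox (u2 * u3 * X2 * W2))).
  by sw tau_mulA.
do 8 (apply: eq_osum => ? ?).
by rewrite (@act_expand2 _ (fun a => Phi _ (a \ox _))) //; lin.
Qed.

Lemma alpha_RR : alpha eB sigma tau W X Y Z = RR.
Proof.
rewrite -[RHS]osum_tpure_id osum_RR_alpha //; lin.
Qed.

Lemma RR_DA (V : lmodType K) (Phi : A -> A -> V) : bilin Phi -> forall a,
  \osum_(Z1, Z2 <- Z) \osum_(X1', X2' <- X) \osum_(X1, X2 <- X)
    \osum_(W1, W2 <- W) \osum_(Y1, Y2 <- Y) \osum_(a1, a2 <- DA a)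
    \osum_(u1, Z1t1 <- tau (Z1 \ox 1)) \osum_(u2, Z1t1t2 <- tau (Z1t1 \ox 1))
    \osum_(u3, X1't3 <- tau (X1' \ox 1))
    \osum_(Y2s1, X2's1 <- sigma (X2' \ox Y2))
    \osum_(Y2s1s2, u1s2 <- sigma (u1 \ox Y2s1))
    \osum_(a1s3, WYs3 <- sigma ((W1 * Y1) \ox a1))
    \osum_(a2s4, bs4 <- sigma ((u2 * u3 * X2 * W2) \ox a2))
      ((eB WYs3 * eB (u1s2 * X2's1) * eB bs4) *:
        Phi (Z1t1t2 * X1't3 * X1 * a1s3) (Z2 * Y2s1s2 * a2s4)) =
  \osum_(r, s <- RR) \osum_(a1, a2 <- DA a) Phi (act r a1) (act s a2).
Proof.
move=> Phil a; symmetry; rewrite osum_RR_alpha; last by lin.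
apply: eq_osum => Z1 Z2; apply: eq_osum => X1' X2'; apply: eq_osum => X1 X2.
apply: eq_osum => W1 W2; apply: eq_osum => Y1 Y2.
transitivity (\osum_(u1, Z1t1 <- tau (Z1 \ox 1)) \osum_(u2, Z1t1t2 <- tau (Z1t1 \ox 1))
    \osum_(u3, X1't3 <- tau (X1' \ox 1))
    \osum_(Y2s1, X2's1 <- sigma (X2' \ox Y2))
    \osum_(Y2s1s2, u1s2 <- sigma (u1 \ox Y2s1)) \osum_(a1, a2 <- DA a)
    \osum_(a1s3, WYs3 <- sigma ((W1 * Y1) \ox a1))
    \osum_(a2s4, bs4 <- sigma ((u2 * u3 * X2 * W2) \ox a2))
      ((eB WYs3 * eB (u1s2 * X2's1) * eB bs4) *:
        Phi (Z1t1t2 * X1't3 * X1 * a1s3) (Z2 * Y2s1s2 * a2s4))); last by reorder sw_assoc.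
do 5 (apply: eq_osum => ? ?); rewrite scaler_osum; apply: eq_osum => a1 a2.
rewrite (@act_expand _ (fun x => Phi x _)); last by lin.
rewrite scaler_osum; apply: eq_osum => a1s3 WYs3.
rewrite (@act_expand _ (Phi _)); last by lin.
rewrite !scaler_osum; apply: eq_osum => a2s4 bs4.
by rewrite !scalerA [_ * eB WYs3]mulrC.
Qed.

Lemma comul_ZZ_A (V : lmodType K) (Phi : A -> A -> V) : bilin Phi -> forall a,
  \osum_(Z1, Z2 <- Z) \osum_(a1, a2 <- DA a)
      \osum_(u, a2t <- tau (a2 \ox 1)) \osum_(Z2s, us <- sigma (u \ox Z2))
        (eB us *: Phi (a2t * Z1) (a1 * Z2s)) =
  \osum_(h1, h2 <- comul (a \ox 1)) \osum_(z, z' <- Z) Phi (act h2 z) (act h1 z').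
Proof.
move=> Phil a; symmetry; rewrite comul_tpure1; last by lin.
transitivity (\osum_(a1, a2 <- DA a) \osum_(u, a2t <- tau (a2 \ox 1)) \osum_(z, z' <- Z)
   Phi (a2t * z) (act (a1 \ox u) z')).
  by reorder ltac:(rewrite act_tpure1; reflexivity).
by sw_act.
Qed.

End Translation.

(** * The equivalence *)

(** Evaluates [osum F] on an iterated sum of scaled pure tensors. *)
Ltac push_osum :=
  cbv beta;
  lazymatch goal with
  | |- osum ?F (osum ?f ?t) = _ =>
      refine (etrans (@osum_bind _ _ _ _ _ _ f F t _) _);
      [lin | refine (eq_osum _ _); intros ? ?; push_osum]
  | |- osum ?F (?k *: ?x) = _ =>
      refine (etrans (@is_linearZ _ _ _ (osum F) k x _) (congr1 (GRing.scale k) _)); [lin | push_osum]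
  | |- osum ?F (?x \ox ?y) = _ =>
      refine (etrans (@osum_tpure _ _ _ _ F x y _) _); [lin | push_osum]
  | |- _ => reflexivity
  end.

(** From the equation E between tensors to the identity between their images
    under [osum F]. *)
Ltac transport E F tacL tacR :=
  refine (etrans _ (etrans (congr1 (osum F) E) _));
  [ symmetry; refine (etrans _ _); [push_osum | cbv beta; tacL]
  | refine (etrans _ _); [push_osum | cbv beta; tacR] ].

Ltac transport3 E Phi tacL tacR :=
  let F := constr:(fun u vw => osum (Phi u) vw) in transport E F tacL tacR.

Section Equivalence.
Variables (W : B \ox B) (X : A \ox B) (Y : B \ox A) (Z : A \ox A).

Lemma data_components : normalized eA eB X ->
  quasitriangular_data DA DB eB sigma tau W X Y Z ->
  comul_components W X Y Z /\ cocomm_components W X Y Z.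
Proof.
move=> normX d.
have cAB (V : lmodType K) (Phi : A -> B -> V) : bilin Phi -> forall a,
    \osum_(r, b <- RB W X) Phi (act r a) b =
    \osum_(h1, h2 <- comul (a \ox 1)) \osum_(x, y <- X) Phi (act h2 x) (projB h1 * y).
  move=> Phil a.
  transport (C2 d a) Phi ltac:(exact (RB_act W X Phil a)) ltac:(exact (comul_X X Phil a)).
have comps : comul_components W X Y Z.
  split=> V Phi Phil.
  - transport3 (C9 d) Phi ltac:(reflexivity) ltac:(reflexivity).
  - transport3 (C13 d) Phi ltac:(reflexivity) ltac:(reflexivity).
  - transport3 (C11 d) Phi ltac:(by reorder sw_assoc) ltac:(reflexivity).
  - transport3 (C8 d) Phi ltac:(reflexivity) ltac:(exact (AR_Z Z cAB Phil)).
  - transport3 (C12 d) Phi ltac:(reflexivity) ltac:(exact (BR_Y W Y Phil)).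
  - transport3 (C10 d) Phi ltac:(exact (RA_tau Y Z cAB Phil)) ltac:(exact (BR_Z W Y Z Phil)).
  - transport3 (C16 d) Phi ltac:(reflexivity) ltac:(exact (RB_X W X Phil)).
  - transport3 (C19 d) Phi ltac:(reflexivity) ltac:(reflexivity).
  - transport3 (C18 d) Phi ltac:(reflexivity) ltac:(by reorder sw_assoc).
  - transport3 (C14 d) Phi ltac:(reflexivity) ltac:(exact (RA_act Y Z cAB Z Phil)).
  - transport3 (C17 d) Phi ltac:(reflexivity) ltac:(reflexivity).
  - transport3 (C15 d) Phi ltac:(exact (AR_tau2 Z cAB Phil)) ltac:(exact (RA_act Y Z cAB X Phil)).
split=> //; split=> V Phi Phil.
- move=> a; transport (C1 d a) Phi ltac:(exact (RR_DA cAB normX comps Phil a)) ltac:(exact (comul_ZZ_A Z Phil a)).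
- exact: cAB.
- move=> a; transport (C3 d a) Phi ltac:(exact (BR_tau W Y Phil (tau (a \ox 1)))) ltac:(reflexivity).
- move=> b; rewrite scaler_osum.
  transport (C4 d b) Phi ltac:(reflexivity) ltac:(exact (comul_ZZ_B Z Phil b)).
- move=> b; transport (C5 d b) Phi ltac:(reflexivity) ltac:(exact (comul_X_B X Phil b)).
- move=> b; transport (C6 d b) Phi ltac:(exact (BR_tau W Y Phil (tau (1 \ox b)))) ltac:(exact (sigma_Y Y Phil b)).
- move=> b; transport (C7 d b) Phi ltac:(reflexivity) ltac:(reflexivity).
Qed.

Lemma components_data : normalized eA eB X ->
  comul_components W X Y Z -> cocomm_components W X Y Z ->
  quasitriangular_data DA DB eB sigma tau W X Y Z.
Proof.
move=> normX comps cocomm.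
have cAB (V : lmodType K) (Phi : A -> B -> V) (Phil : bilin Phi) := cocommAB_A cocomm Phil.
have t2 (U V : lmodType K) : bilin (fun (x : U) (y : V) => x \ox y) by lin.
have t3 (U V U' : lmodType K) : trilin (fun (x : U) (y : V) (z : U') => x \ox y \ox z) by lin.
split.
- move=> a; refine (etrans (RR_DA cAB normX comps (t2 _ _) a) _).
  by rewrite (comul_ZZ_A Z (t2 _ _) a) (cocommAA_A cocomm (t2 _ _)).
- move=> a; refine (etrans (RB_act W X (t2 _ _) a) _).
  by rewrite (comul_X X (t2 _ _) a) (cAB _ _ (t2 _ _)).
- move=> a; refine (etrans (BR_tau W Y (t2 _ _) (tau (a \ox 1))) _).
  exact (cocommBA_A cocomm (t2 _ _) a).
- move=> b; rewrite -scaler_osum; refine (etrans (cocommAA_B cocomm (t2 _ _) b) _).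
  by rewrite -(comul_ZZ_B Z (t2 _ _) b).
- move=> b; refine (etrans (cocommAB_B cocomm (t2 _ _) b) _).
  by rewrite -(comul_X_B X (t2 _ _) b).
- move=> b; refine (etrans (BR_tau W Y (t2 _ _) (tau (1 \ox b))) _).
  by rewrite (sigma_Y Y (t2 _ _) b) (cocommBA_B cocomm (t2 _ _)).
- by move=> b; exact (cocommBB_B cocomm (t2 _ _) b).
- by refine (etrans (comulZ_l comps (t3 _ _ _)) _); rewrite (AR_Z Z cAB (t3 _ _ _)).
- exact (comulX_l comps (t3 _ _ _)).
- by refine (etrans (RA_tau Y Z cAB (t3 _ _ _)) _); rewrite (BR_Z W Y Z (t3 _ _ _)) (tauRA comps (t3 _ _ _)).
- refine (etrans _ (tauXW comps (t3 _ _ _))); exact: exchange_osum.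
- by refine (etrans (comulY_l comps (t3 _ _ _)) _); rewrite (BR_Y W Y (t3 _ _ _)).
- exact (comulW_l comps (t3 _ _ _)).
- by refine (etrans (comulZ_r comps (t3 _ _ _)) _); rewrite (RA_act Y Z cAB Z (t3 _ _ _)).
- by refine (etrans (AR_tau2 Z cAB (t3 _ _ _)) _); rewrite (RA_act Y Z cAB X (t3 _ _ _)) (tauAR comps (t3 _ _ _)).
- by refine (etrans (comulX_r comps (t3 _ _ _)) _); rewrite (RB_X W X (t3 _ _ _)).
- exact (comulY_r comps (t3 _ _ _)).
- by refine (etrans (tauBR comps (t3 _ _ _)) _); exact: exchange_osum.
- exact (comulW_r comps (t3 _ _ _)).
Qed.

End Equivalence.

Lemma data_quasitriangular W X Y Z :
  normalized_quasitriangular_data DA eA DB eB sigma tau W X Y Z ->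
  is_smash_quasitriangular DA eA DB eB sigma tau (alpha eB sigma tau W X Y Z).
Proof.
case=> nW nX nY nZ d; have [comps cocomm] := data_components nX d.
have -> : alpha eB sigma tau W X Y Z = RR W X Y Z.
  exact (alpha_RR (fun V Phi => @cocommAB_A _ _ _ _ cocomm V Phi) nX comps).
exact: RR_quasitriangular.
Qed.

Lemma quasitriangular_data_exists R :
  is_smash_quasitriangular DA eA DB eB sigma tau R ->
  exists W X Y Z, normalized_quasitriangular_data DA eA DB eB sigma tau W X Y Z /\
    R = alpha eB sigma tau W X Y Z.
Proof.
move=> /quasitriangularE qtR.
have [nW nX nY nZ] := R_normalized qtR.
have comps := R_comul_components qtR; have cocomm := R_cocomm_components qtR.
do 4 eexists; split; first by split; [exact: nW | exact: nX | exact: nY | exact: nZ | exact: components_data].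
rewrite -[LHS](RR_R qtR); symmetry.
exact (alpha_RR (fun V Phi => @cocommAB_A _ _ _ _ cocomm V Phi) nX comps).
Qed.

End Smash.

Theorem theorem3p7 (K : fieldType) (A B : algType K)
    (DA : A -> A \ox A) (eA : A -> K) (DB : B -> B \ox B) (eB : B -> K)
    (sigma : {linear (B \ox A)%type -> (A \ox B)%type})
    (tau : {linear (A \ox B)%type -> (B \ox A)%type}) :
  is_smash_biproduct_bialgebra DA eA DB eB sigma tau ->
  is_counital_algebra eA -> is_counital_algebra eB ->
  is_unital_coalgebra DA eA -> is_unital_coalgebra DB eB ->
  right_conormal eA sigma ->
  [/\ (exists R, is_smash_quasitriangular DA eA DB eB sigma tau R) <->
      (exists W X Y Z,
        normalized_quasitriangular_data DA eA DB eB sigma tau W X Y Z),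
      forall W X Y Z,
        normalized_quasitriangular_data DA eA DB eB sigma tau W X Y Z ->
        is_smash_quasitriangular DA eA DB eB sigma tau (alpha eB sigma tau W X Y Z)
    & forall R, is_smash_quasitriangular DA eA DB eB sigma tau R ->
        exists W X Y Z,
          normalized_quasitriangular_data DA eA DB eB sigma tau W X Y Z /\
          R = alpha eB sigma tau W X Y Z].
Proof.
move=> biproduct cA cB uA uB conormal.
have to_qt := data_quasitriangular biproduct cA cB uA uB conormal.
have from_qt := quasitriangular_data_exists biproduct cA cB uA uB conormal.
split=> //; split=> [[R /from_qt [W [X [Y [Z [d _]]]]]] | [W [X [Y [Z d]]]]].
  by exists W, X, Y, Z.
by exists (alpha eB sigma tau W X Y Z); apply: to_qt.
Qed.
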